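(* For a set $P_6=\{p_1,\dots,p_6\}$ of six points in $\mathbb{P}^2(\mathbb{C})$, consider the property (P): the union of the lines containing two points of $P_6$ possesses exactly six triple points $p_1',\dots,p_6'$, and the points of $P_6$ are not contained in a conic. Suppose that $P_6$ is generic among sets satisfying (P). Then the set of triple points $P_6'=\{p_1',\dots,p_6'\}$ also satisfies (P). Moreover, if the points of $P_6$ are real, there exists a unique set $P_6^-$ of six real points satisfying (P) such that $(P_6^-)'=P_6$.
   Context: Here a triple point of a union of lines is a point where exactly three of the lines meet. For a set $Q$ of six points satisfying (P), $Q'$ denotes the set of the six triple points of the union of lines through two points of $Q$. *)

(* Defs.v *)
From HB Require Import structures.
From mathcomp Require Import all_boot all_order all_algebra.
From mathcomp Require Import complex.
From mathcomp Require Import classical_sets functions cardinality reals.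
From mathcomp Require Import mpoly.

Set Implicit Arguments.
Unset Strict Implicit.
Unset Printing Implicit Defensive.

Import GRing.Theory.
Local Open Scope ring_scope.
Local Open Scope classical_set_scope.
Local Open Scope card_scope.

(* The projective plane over K, as the set of vector lines of K^3. *)
Definition P2 (K : fieldType) := {V : {vspace 'rV[K]_3} | \dim V == 1%N}.

Definition represents (K : fieldType) (v : 'rV[K]_3) (p : P2 K) : Prop :=
  val p = <[v]>%VS.

(* A projective line is a vector plane; the one through p <> q is p + q. *)
Definition lines_through_pairs (K : fieldType) (A : set (P2 K)) :
    set {vspace 'rV[K]_3} :=
  [set L | exists p q, [/\ A p, A q, p <> q & L = (val p + val q)%VS]].

Definition triple_points (K : fieldType) (A : set (P2 K)) : set (P2 K) :=
  [set x : P2 K | [set L | lines_through_pairs A L /\ (val x <= L)%VS] #= `I_3].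

(* Conics may be degenerate: q is any nonzero quadratic form. *)
Definition on_conic (K : fieldType) (A : set (P2 K)) : Prop :=
  exists q : {mpoly K[3]},
    [/\ q != 0, q \is 2.-homog &
        forall p v, A p -> represents v p -> q.@[v 0] = 0].

Definition propertyP (K : fieldType) (A : set (P2 K)) : Prop :=
  [/\ A #= `I_6, triple_points A #= `I_6 & ~ on_conic A].

Definition real_points (R : realType) (A : set (P2 R[i])) : Prop :=
  forall p, A p -> exists v : 'rV[R]_3, represents (map_mx (real_complex R) v) p.

(* Polynomials in the coordinates of six vectors of K^3, stored as the rows of
   a 6 x 3 matrix; the variable of index mxvec_index i j is the j-th coordinate
   of the i-th vector. *)
Definition multihomogeneous (K : fieldType) (f : {mpoly K[(6 * 3)%N]}) : Prop :=
  exists d : 'I_6 -> nat, forall m, m \in msupp f ->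
    forall i : 'I_6, (\sum_(j < 3) m (mxvec_index i j))%N = d i.

Definition vanishes_at (K : fieldType) (f : {mpoly K[(6 * 3)%N]})
    (P : 'I_6 -> P2 K) : Prop :=
  forall v : 'M[K]_(6, 3),
    (forall i, represents (row i v) (P i)) -> f.@[mxvec v 0] = 0.

Definition zariski_closed (K : fieldType) (Z : set ('I_6 -> P2 K)) : Prop :=
  exists S : set {mpoly K[(6 * 3)%N]},
    (forall f, S f -> multihomogeneous f) /\
    Z = [set P | forall f, S f -> vanishes_at f P].

(* Sets of six points are parametrized by their orderings.  A property C holds
   for a generic element of X, a subset of (P^2)^6, when it holds on a dense
   open subset U of X for the Zariski topology induced on X; such a U meets
   every irreducible component of X. *)
Definition holds_generically (K : fieldType) (X : set ('I_6 -> P2 K))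
    (C : ('I_6 -> P2 K) -> Prop) : Prop :=
  exists U : set ('I_6 -> P2 K),
    [/\ exists Z, zariski_closed Z /\ U = X `\` Z,
        forall Z, zariski_closed Z -> U `<=` Z -> X `<=` Z &
        forall P, U P -> C P].

(* Main.v *)
(* Let P be six points with property (P).  A triple point outside P is the
   concurrency point of three lines ab, cd, ef partitioning P, i.e. of one of the
   15 synthemes of the labels.  Two concurrent synthemes without a common line force
   a third one (the three polynomials expressing concurrency add up to 0), so the set
   of concurrent synthemes is a disjoint union of cliques once the synthemes are
   viewed, through the outer automorphism of S_6, as the edges of K_6; six triple
   points leave only the types K_4 and K_3 + K_3.  Collinear triples in P only add
   the complete quadrilateral, which is a limit of the type K_4.
   - Type K_4: in a basis whose triangle is cut out by three of the lines, P consists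
     of (0,1,a), (0,1,-a), (b,0,1), (-b,0,1), (1,c,0), (1,-c,0), and the triple points
     have the same form in the same basis, with (1/bc, 1/ca, 1/ab) in place of (a,b,c).
     Hence t = abc becomes 1/t^2, and (P) excludes only finitely many values of t.  A
     real preimage has parameters (aT, bT, cT) with T^2 = 1/|t|; it is unique because
     the sides of the triangle are the lines with two points of P and two of P'.
   - Type K_3 + K_3: P is projectively rigid, formed by two triangles in sixfold
     perspective, and the triple points are the vertices of two further such triangles.
     It has no real realization.
   The bad values of t are cut out by a product, over all labellings, of a polynomial
   in two bracket monomials without nontrivial rational zeros; so it vanishes neither
   on the rigid type nor on the configuration with (a,b,c) = (2,1,1). *)
Require Import Defs.
From HB Require Import structures.
From mathcomp Require Import all_boot all_order all_algebra.
From mathcomp Require Import complex.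
From mathcomp Require Import boolp classical_sets functions cardinality reals.
From mathcomp Require Import mpoly.
From mathcomp Require Import ring lra zify.

Set Implicit Arguments.
Unset Strict Implicit.
Unset Printing Implicit Defensive.

(** * Combinatorics of six labelled points *)

(** The combinatorial type of six points is stored as 35 bits: 20 collinearities and 15
    concurrencies. Since collinear triples interfere with the clique argument, four families of
    clauses are read off from the geometry, and an exhaustive search shows that every table obeying
    them either codes fewer than six triple points or contains one of two patterns. A pattern
    records only six concurrencies and the noncollinearities that make coordinates possible. For
    type K_4 it leaves open the eight triples with one point on each side of the triangle, so that
    the quadrilateral becomes the case t^2 = 1 of the same normal form. The obstructions are then
    explicit: t^2 = 1 makes triples collinear, t^2 = -1 puts the points on a conic, and (t^2 - 1)^2
    = 16 t^2 creates further concurrencies. The same conditions at 1/t^2 control the triple points;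
    at the real preimage, where t^2 is replaced by 1/|t|, the last one becomes t^4 - 322 t^2 + 1 =
    0. Normal forms are developed over any number field structure, so that real sextuples are
    normalized with real vectors before being embedded in the complex plane. *)

Definition perms6 : seq (seq nat) := permutations (iota 0 6).

Definition swap_within (s : seq nat) :=
  if s is [:: a; b; c; d; e; f] then [:: b; a; c; d; e; f] else s.
Definition swap_pairs12 (s : seq nat) :=
  if s is [:: a; b; c; d; e; f] then [:: c; d; a; b; e; f] else s.
Definition swap_pairs23 (s : seq nat) :=
  if s is [:: a; b; c; d; e; f] then [:: a; b; e; f; c; d] else s.

Definition order_within s :=
  if nth 0 s 1 < nth 0 s 0 then swap_within s else s.
Definition order_pairs12 s :=
  if nth 0 s 2 < nth 0 s 0 then swap_pairs12 s else s.
Definition order_pairs23 s :=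
  if nth 0 s 4 < nth 0 s 2 then swap_pairs23 s else s.

(* [:: a; b; c; d; e; f] stands for the syntheme ab|cd|ef. *)
Definition synth_normal (s : seq nat) : seq nat :=
  let s := swap_pairs12 (order_within (swap_pairs12 (order_within s))) in
  let s := swap_pairs23 (swap_pairs12 (order_within (swap_pairs12 (swap_pairs23 s)))) in
  order_pairs12 (order_pairs23 (order_pairs12 s)).

(** The normal form is a composite of conditional swaps, and the three swaps generate the stabilizer
    of a syntheme. An invariant of the syntheme, of whatever kind, therefore only has to be checked
    on three generators. *)
Lemma synth_normalE (T : Type) (Q : seq nat -> T) :
  (forall s, Q (swap_within s) = Q s) -> (forall s, Q (swap_pairs12 s) = Q s) ->
  (forall s, Q (swap_pairs23 s) = Q s) -> forall s, Q (synth_normal s) = Q s.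
Proof.
move=> Q1 Q2 Q3.
have Q1' s : Q (order_within s) = Q s by rewrite /order_within; case: ifP.
have Q2' s : Q (order_pairs12 s) = Q s by rewrite /order_pairs12; case: ifP.
have Q3' s : Q (order_pairs23 s) = Q s by rewrite /order_pairs23; case: ifP.
by move=> s; rewrite /synth_normal !(Q1', Q2', Q3', Q1, Q2, Q3).
Qed.

Definition swap3_12 (t : seq nat) := if t is [:: i; j; k] then [:: j; i; k] else t.
Definition swap3_23 (t : seq nat) := if t is [:: i; j; k] then [:: i; k; j] else t.
Definition order3_12 t := if nth 0 t 1 < nth 0 t 0 then swap3_12 t else t.
Definition order3_23 t := if nth 0 t 2 < nth 0 t 1 then swap3_23 t else t.
Definition triple_normal t := order3_12 (order3_23 (order3_12 t)).

Lemma triple_normalE (T : Type) (Q : seq nat -> T) :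
  (forall t, Q (swap3_12 t) = Q t) -> (forall t, Q (swap3_23 t) = Q t) ->
  forall t, Q (triple_normal t) = Q t.
Proof.
move=> Q1 Q2.
have Q1' s : Q (order3_12 s) = Q s by rewrite /order3_12; case: ifP.
have Q2' s : Q (order3_23 s) = Q s by rewrite /order3_23; case: ifP.
by move=> s; rewrite /triple_normal !(Q1', Q2').
Qed.

Definition triples : seq (seq nat) :=
  Eval vm_compute in undup [seq triple_normal (take 3 l) | l <- perms6].
Definition synthemes : seq (seq nat) :=
  Eval vm_compute in undup [seq synth_normal l | l <- perms6].

Lemma mem_perms6 l : (l \in perms6) = perm_eq l (iota 0 6).
Proof. by rewrite mem_permutations. Qed.

Lemma perms6_uniq l : uniq l -> size l = 6 -> all (fun i => i < 6) l -> l \in perms6.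
Proof.
move=> Ul Sl /allP ltl; rewrite mem_perms6; apply: uniq_perm => //.
have sub : {subset l <= iota 0 6} by move=> i /ltl; rewrite mem_iota.
by have [] := uniq_min_size Ul sub; rewrite ?Sl.
Qed.

Lemma synth_normal_mem l : l \in perms6 -> synth_normal l \in synthemes.
Proof.
suff /allP H : all (fun l => synth_normal l \in synthemes) perms6 by apply: H.
by vm_compute.
Qed.

Lemma triple_normal_mem i j k : i < 6 -> j < 6 -> k < 6 -> i != j -> i != k -> j != k ->
  triple_normal [:: i; j; k] \in triples.
Proof.
have /allP H : all (fun i => all (fun j => all (fun k =>
    [|| i == j, i == k, j == k | triple_normal [:: i; j; k] \in triples])
    (iota 0 6)) (iota 0 6)) (iota 0 6) by vm_compute.
move=> i6 j6 k6 /negPf ij /negPf ik /negPf jk.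
have /allP Hi := H i (etrans (mem_iota 0 6 i) i6).
have /allP Hj := Hi j (etrans (mem_iota 0 6 j) j6).
by have := Hj k (etrans (mem_iota 0 6 k) k6); rewrite ij ik jk.
Qed.

(** * Truth tables, clauses and the exhaustive search *)

Definition ztab (s : seq bool) t := nth false s (index (triple_normal t) triples).
(** The offset 20 is the number of triples: concurrency bits follow the collinearity bits. *)
Definition ctab (s : seq bool) t := nth false s (20 + index (synth_normal t) synthemes).

Definition literal := (nat * bool)%type.
Definition zlit t (b : bool) : literal := (index (triple_normal t) triples, b).
Definition clit s (b : bool) : literal := (20 + index (synth_normal s) synthemes, b).
Definition sat (s : seq bool) (cl : seq literal) :=
  has (fun x => nth false s x.1 == x.2) cl.

(* Respectively: no four collinear points, no two lines covering the six points (either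
   would put them on a conic), the hexagon identity, and a concurrency forced by two
   collinear triples. *)
Definition clauses_of (l : seq nat) : seq (seq literal) :=
  if l is [:: a; b; c; d; e; f] then
  [:: [:: zlit [:: a; b; c] false; zlit [:: a; b; d] false];
      [:: zlit [:: a; b; c] false; zlit [:: d; e; f] false];
      [:: clit [:: a; b; c; d; e; f] false; clit [:: a; d; c; f; e; b] false;
          clit [:: a; f; c; b; e; d] true];
      [:: zlit [:: a; c; d] false; zlit [:: a; e; f] false;
          clit [:: a; b; c; d; e; f] true]]
  else [::].

(** A clause can be tested as soon as its last bit is known. Grouping the clauses by that bit lets
    the search test each of them once along a branch, at the earliest moment. *)
Definition level (cl : seq literal) := foldr maxn 0 (map fst cl).
Definition clause_table : seq (seq (seq literal)) :=
  let cls := undup (flatten (map clauses_of perms6)) in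
  mkseq (fun n => [seq cl <- cls | level cl == n]) 35.

(* Conditionals rather than && and ||, whose two arguments vm_compute would evaluate. *)
Fixpoint search (stop good : seq bool -> bool) (tbl : seq (seq (seq literal)))
    (acc : seq bool) : bool :=
  if stop acc then true else
  if tbl is cls :: tbl then
    let try_ b :=
      let acc := rcons acc b in
      if has (fun cl => all (fun x => x.1 < size acc) cl && ~~ sat acc cl) cls
      then true else search stop good tbl acc in
    if try_ true then try_ false else false
  else good acc.

(** A clause that fails on a prefix containing all its bits fails on every extension. The search
    itself checks that the bits are in the prefix, so soundness requires nothing of the way in which
    the clauses are grouped. *)
Lemma search_sound (stop good : seq bool -> bool) tbl acc s :
  (forall a b, stop a -> good (a ++ b)) ->
  search stop good tbl acc -> size s = size tbl ->
  (forall cls, cls \in tbl -> forall cl, cl \in cls -> sat (acc ++ s) cl) ->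
  good (acc ++ s).
Proof.
move=> stopP; elim: tbl acc s => [|cls tbl IH] acc [|b s] //=.
  by rewrite cats0; case: ifP => // Hst _; have := stopP _ [::] Hst; rewrite cats0.
move=> H [Ss] Hs; case: ifP H => [/stopP-> // | _ H].
have {H} : has (fun cl => all (fun x => x.1 < size (rcons acc b)) cl &&
      ~~ sat (rcons acc b) cl) cls || search stop good tbl (rcons acc b).
  by case: b {Hs} H; case: ifP => //; case: has.
rewrite -cat_rcons in Hs *; case/orP => [/hasP[cl clP /andP[/allP lt_cl]]|H].
  have := Hs cls (mem_head _ _) cl clP; rewrite /sat => /hasP[x xcl /eqP xE].
  case/hasP; exists x => //; rewrite -xE nth_cat lt_cl //.
by apply: IH => // cls' cls'P; apply: Hs; rewrite inE cls'P orbT.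
Qed.

(* [:: i] codes a triple point at the i-th point of the configuration, which must then
   lie on two collinear triples; a syntheme codes its concurrency point. *)
Definition codes : seq (seq nat) := [seq [:: i] | i <- iota 0 6] ++ synthemes.

(** Some pair of [s] lies in [t]. If such a [t] is collinear, a line of the syntheme passes through
    a third point of the configuration, and the three lines cannot be distinct lines meeting outside
    it. *)
Definition touches (s t : seq nat) :=
  has (fun k => (nth 0 s k.*2 \in t) && (nth 0 s k.*2.+1 \in t)) [:: 0; 1; 2].

Definition code_ok (z c : seq nat -> bool) (x : seq nat) :=
  if x is [:: i] then 2 <= count z [seq t <- triples | i \in t]
  else c x && ~~ has z [seq t <- triples | touches x t].

Definition sel (l x : seq nat) := [seq nth 0 l i | i <- x].

(* The order is the one that makes kpt (bc)^-1 (ca)^-1 (ab)^-1 j below the concurrency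
   point of the j-th syntheme for the points kpt a b c. *)
Definition K_synths : seq (seq nat) :=
  [:: [:: 0; 1; 2; 5; 3; 4]; [:: 0; 1; 2; 4; 3; 5]; [:: 2; 3; 0; 5; 1; 4];
      [:: 2; 3; 0; 4; 1; 5]; [:: 4; 5; 0; 3; 1; 2]; [:: 4; 5; 0; 2; 1; 3]].
(** The triples containing one of the pairs 01, 23, 45. The eight triples with one label in each
    pair are left free, because four of them become collinear when t^2 = 1. *)
Definition K_triples : seq (seq nat) :=
  [:: [:: 0; 1; 2]; [:: 0; 1; 3]; [:: 0; 1; 4]; [:: 0; 1; 5];
      [:: 2; 3; 0]; [:: 2; 3; 1]; [:: 2; 3; 4]; [:: 2; 3; 5];
      [:: 4; 5; 0]; [:: 4; 5; 1]; [:: 4; 5; 2]; [:: 4; 5; 3]].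
(** The six bijections between 012 and 345: the two triangles are perspective in every possible
    way. *)
Definition Y_synths : seq (seq nat) :=
  [:: [:: 0; 3; 1; 4; 2; 5]; [:: 0; 3; 1; 5; 2; 4]; [:: 0; 4; 1; 3; 2; 5];
      [:: 0; 4; 1; 5; 2; 3]; [:: 0; 5; 1; 3; 2; 4]; [:: 0; 5; 1; 4; 2; 3]].
(** Exactly what makes 0, 1, 2 a reference triangle and keeps the other three points off its
    sides. *)
Definition Y_triples : seq (seq nat) :=
  [:: [:: 0; 1; 2]; [:: 0; 1; 3]; [:: 0; 1; 4]; [:: 0; 1; 5];
      [:: 0; 2; 3]; [:: 0; 2; 4]; [:: 0; 2; 5];
      [:: 1; 2; 3]; [:: 1; 2; 4]; [:: 1; 2; 5]].

Definition pattern (S T : seq (seq nat)) (z c : seq nat -> bool) (l : seq nat) :=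
  all (fun x => c (sel l x)) S && ~~ has (fun t => z (sel l t)) T.

(** The first pattern depends only on the pairing 01|23|45 and the second only on the half 012, so
    15 synthemes and 20 halves represent all labellings. *)
Definition good (s : seq bool) :=
  if count (code_ok (ztab s) (ctab s)) codes < 6 then true else
  has (pattern K_synths K_triples (ztab s) (ctab s)) synthemes
  || has (pattern Y_synths Y_triples (ztab s) (ctab s))
       [seq t ++ [seq i <- iota 0 6 | i \notin t] | t <- triples].

(* Once the 20 collinearities are known, too few triple points can be left
   even if all the syntheme bits are true. *)
Definition stop (s : seq bool) :=
  if size s == 20 then count (code_ok (ztab s) (fun=> true)) codes < 6 else false.

Lemma stopP a b : stop a -> good (a ++ b).
Proof.
rewrite /stop /good; case: eqP => // Sa lt6; case: ifP => // /negbT/negP[].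
apply: leq_ltn_trans lt6; apply: sub_count => x.
have zE (p : pred (seq nat)) : {in filter p triples, ztab (a ++ b) =1 ztab a}.
  have /allP T20 : all (fun t => index (triple_normal t) triples < 20) triples.
    by vm_compute.
  by move=> t; rewrite mem_filter => /andP[_ /T20 lt20]; rewrite /ztab nth_cat Sa lt20.
case: x => [|i [|j x]]; rewrite /code_ok ?(eq_in_count (zE _)) ?(eq_in_has (zE _)) //.
  by case/andP.
by case/andP.
Qed.

Lemma search_good : search stop good clause_table [::].
Proof. vm_cast_no_check (erefl true). Qed.

Lemma good_of_clauses (s : seq bool) : size s = 35 ->
  (forall l cl, l \in perms6 -> cl \in clauses_of l -> sat s cl) -> good s.
Proof.
move=> S35 Hs; apply: (@search_sound stop good clause_table [::] s stopP search_good).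
- by rewrite S35 /clause_table size_mkseq.
- move=> cls /mapP[n _ ->] cl; rewrite mem_filter mem_undup => /andP[_].
  by case/flatten_mapP => l lP; apply: Hs.
Qed.

Import Order.TTheory GRing.Theory Num.Theory.
Local Open Scope ring_scope.
Local Open Scope classical_set_scope.
Local Open Scope card_scope.

(** * Brackets *)

Definition o0 : 'I_3 := ord0.
Definition o1 : 'I_3 := @Ordinal 3 1 isT.
Definition o2 : 'I_3 := @Ordinal 3 2 isT.

Lemma forall_I3 (Q : 'I_3 -> Prop) : Q o0 -> Q o1 -> Q o2 -> forall j, Q j.
Proof.
move=> Q0 Q1 Q2 [[|[|[|j]]] jP] //.
- by rewrite (_ : Ordinal _ = o0) //; apply: val_inj.
- by rewrite (_ : Ordinal _ = o1) //; apply: val_inj.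
- by rewrite (_ : Ordinal _ = o2) //; apply: val_inj.
Qed.

Lemma sum3 (V : nmodType) (f : 'I_3 -> V) : \sum_j f j = f o0 + f o1 + f o2.
Proof.
rewrite !big_ord_recl big_ord0 addr0 addrA.
by congr (_ + f _ + f _); apply: val_inj.
Qed.

Section Brackets.
Variable F : numFieldType.
Implicit Types (u v w x : 'rV[F]_3) (M : 'M[F]_3).

Definition vec (a b c : F) : 'rV[F]_3 := \row_j nth 0 [:: a; b; c] j.

Lemma vec0 a b c : vec a b c 0 o0 = a. Proof. by rewrite mxE. Qed.
Lemma vec1 a b c : vec a b c 0 o1 = b. Proof. by rewrite mxE. Qed.
Lemma vec2 a b c : vec a b c 0 o2 = c. Proof. by rewrite mxE. Qed.
Definition vecE := (vec0, vec1, vec2).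

Lemma rV3P u v : u 0 o0 = v 0 o0 -> u 0 o1 = v 0 o1 -> u 0 o2 = v 0 o2 -> u = v.
Proof.
by move=> *; apply/rowP; apply: forall_I3; rewrite // -[ord0]/(0 : 'I_1).
Qed.

Definition br u v w : F :=
  u 0 o0 * (v 0 o1 * w 0 o2 - v 0 o2 * w 0 o1)
  - u 0 o1 * (v 0 o0 * w 0 o2 - v 0 o2 * w 0 o0)
  + u 0 o2 * (v 0 o0 * w 0 o1 - v 0 o1 * w 0 o0).

Definition cross u v : 'rV[F]_3 :=
  vec (u 0 o1 * v 0 o2 - u 0 o2 * v 0 o1)
      (u 0 o2 * v 0 o0 - u 0 o0 * v 0 o2)
      (u 0 o0 * v 0 o1 - u 0 o1 * v 0 o0).

(* Vanishes when the lines ab, cd and ef are concurrent. *)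
Definition conc a b c d e f : F := br a c d * br b e f - br b c d * br a e f.

Lemma br_swap12 u v w : br v u w = - br u v w. Proof. rewrite /br; ring. Qed.
Lemma br_swap23 u v w : br u w v = - br u v w. Proof. rewrite /br; ring. Qed.
Lemma br_rot u v w : br v w u = br u v w. Proof. rewrite /br; ring. Qed.
Lemma bruu u v : br u u v = 0. Proof. rewrite /br; ring. Qed.
Lemma bruvu u v : br u v u = 0. Proof. rewrite /br; ring. Qed.
Lemma bruvv u v : br u v v = 0. Proof. rewrite /br; ring. Qed.

Lemma conc_swap_within a b c d e f : conc b a c d e f = - conc a b c d e f.
Proof. rewrite /conc; ring. Qed.
Lemma conc_swap12 a b c d e f : conc c d a b e f = - conc a b c d e f.
Proof. rewrite /conc /br; ring. Qed.
Lemma conc_swap23 a b c d e f : conc a b e f c d = - conc a b c d e f.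
Proof. rewrite /conc; ring. Qed.
(** Each syntheme expresses a perspectivity between the triangles [a c e] and [b d f], and the three
    differ by a cyclic shift: doubly perspective triangles are triply perspective. *)
Lemma conc_hexagon a b c d e f :
  conc a b c d e f + conc a d c f e b + conc a f c b e d = 0.
Proof. rewrite /conc /br; ring. Qed.

Lemma brZ a b c u v w : br (a *: u) (b *: v) (c *: w) = a * b * c * br u v w.
Proof. rewrite /br !mxE; ring. Qed.

Lemma mul_rV3 v M j : (v *m M) 0 j = v 0 o0 * M o0 j + v 0 o1 * M o1 j + v 0 o2 * M o2 j.
Proof. by rewrite mxE sum3. Qed.

Lemma brM M u v w : br (u *m M) (v *m M) (w *m M) =
  br u v w * br (row o0 M) (row o1 M) (row o2 M).
Proof. rewrite /br !mul_rV3 !mxE; ring. Qed.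

Lemma det_br M : \det M = br (row o0 M) (row o1 M) (row o2 M).
Proof.
(* Natural number indices let the lifted ordinals of nested cofactors reduce to common numerals,
   which [ring] needs in order to identify entries. *)
pose m i j := M (inord i) (inord j).
have E i j : M i j = m (val i) (val j) by rewrite /m !inord_val.
rewrite (expand_det_row _ ord0) !big_ord_recl big_ord0 /cofactor.
rewrite !(expand_det_row _ ord0) !big_ord_recl !big_ord0 /cofactor !det_mx11 /br !mxE !E /=.
by rewrite /bump /=; ring.
Qed.

Lemma brM_det M u v w : br (u *m M) (v *m M) (w *m M) = br u v w * \det M.
Proof. by rewrite brM det_br. Qed.

(** Cramer's rule for the 2 by 2 minor given by a nonzero coordinate of [cross u v]; the coordinate
    left over is supplied by the vanishing bracket. *)
Lemma br_eq0_span u v w : cross u v != 0 ->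
  br u v w = 0 -> exists a b, w = a *: u + b *: v.
Proof.
move=> nz uvw0.
have [n0|n0] := eqVneq (cross u v 0 o0) 0; last first.
  exists ((w 0 o1 * v 0 o2 - w 0 o2 * v 0 o1) / cross u v 0 o0),
         ((u 0 o1 * w 0 o2 - u 0 o2 * w 0 o1) / cross u v 0 o0).
  rewrite /cross !vecE in n0 *.
  apply: rV3P; rewrite !mxE; [|by field|by field].
  apply: (mulIf n0); apply/eqP; rewrite -subr_eq0; apply/eqP.
  by rewrite -[RHS]uvw0 /br; field.
have [n1|n1] := eqVneq (cross u v 0 o1) 0; last first.
  exists ((w 0 o2 * v 0 o0 - w 0 o0 * v 0 o2) / cross u v 0 o1),
         ((u 0 o2 * w 0 o0 - u 0 o0 * w 0 o2) / cross u v 0 o1).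
  rewrite /cross !vecE in n1 *.
  apply: rV3P; rewrite !mxE; [by field| |by field].
  apply: (mulIf n1); apply/eqP; rewrite -subr_eq0; apply/eqP.
  by rewrite -[RHS]uvw0 /br; field.
have [n2|n2] := eqVneq (cross u v 0 o2) 0; last first.
  exists ((w 0 o0 * v 0 o1 - w 0 o1 * v 0 o0) / cross u v 0 o2),
         ((u 0 o0 * w 0 o1 - u 0 o1 * w 0 o0) / cross u v 0 o2).
  rewrite /cross !vecE in n2 *.
  apply: rV3P; rewrite !mxE; [by field|by field| ].
  apply: (mulIf n2); apply/eqP; rewrite -subr_eq0; apply/eqP.
  by rewrite -[RHS]uvw0 /br; field.
by case/eqP: nz; apply: rV3P; rewrite [RHS]mxE.
Qed.

Lemma cross_eq0 u v : u != 0 -> cross u v = 0 -> exists a, v = a *: u.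
Proof.
move=> nz uv0.
have c0 : u 0 o1 * v 0 o2 - u 0 o2 * v 0 o1 = 0.
  by have := congr1 (fun x => x 0 o0) uv0; rewrite /cross vecE mxE.
have c1 : u 0 o2 * v 0 o0 - u 0 o0 * v 0 o2 = 0.
  by have := congr1 (fun x => x 0 o1) uv0; rewrite /cross vecE mxE.
have c2 : u 0 o0 * v 0 o1 - u 0 o1 * v 0 o0 = 0.
  by have := congr1 (fun x => x 0 o2) uv0; rewrite /cross vecE mxE.
move/eqP: c0; rewrite subr_eq0 => /eqP c0.
move/eqP: c1; rewrite subr_eq0 => /eqP c1.
move/eqP: c2; rewrite subr_eq0 => /eqP c2.
have [n0|n0] := eqVneq (u 0 o0) 0; last first.
  exists (v 0 o0 / u 0 o0); apply: rV3P; rewrite !mxE ?divfK //; apply: (mulfI n0).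
    by rewrite c2; field.
  by rewrite -c1; field.
have [n1|n1] := eqVneq (u 0 o1) 0; last first.
  exists (v 0 o1 / u 0 o1); apply: rV3P; rewrite !mxE ?divfK //; apply: (mulfI n1).
    by rewrite -c2; field.
  by rewrite c0; field.
have [n2|n2] := eqVneq (u 0 o2) 0; last first.
  exists (v 0 o2 / u 0 o2); apply: rV3P; rewrite !mxE ?divfK //; apply: (mulfI n2).
    by rewrite c1; field.
  by rewrite -c0; field.
by case/eqP: nz; apply: rV3P; rewrite [RHS]mxE.
Qed.

(** [conc] is the determinant of the linear forms [cross a b], [cross c d], [cross e f]. By Cramer's
    rule its product with any coordinate of [x] is a combination of the three incidences. *)
Lemma conc_eq0 a b c d e f x : x != 0 ->
  br a b x = 0 -> br c d x = 0 -> br e f x = 0 -> conc a b c d e f = 0.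
Proof.
move=> nz ab cd ef.
pose r k := cross (cross c d) (cross e f) 0 k * br a b x
          + cross (cross e f) (cross a b) 0 k * br c d x
          + cross (cross a b) (cross c d) 0 k * br e f x.
have E k : conc a b c d e f * x 0 k = r k.
  by move: k; apply: forall_I3; rewrite /r /conc /br /cross !vecE; ring.
have [//|D0] := eqVneq (conc a b c d e f) 0.
by case/eqP: nz; apply: rV3P; rewrite mxE; apply: (mulfI D0); rewrite E /r ab cd ef !mulr0 !addr0.
Qed.

End Brackets.

(** * Incidence in the projective plane *)

Section Enumeration.
Variable T : eqType.
Implicit Types (A : set T) (f g : nat -> T).

(** Configurations are functions on all of [nat] of which only the first values matter; labels can
    then be plain numerals in lists, as the computations require. *)
Definition inj_below n f := forall i j, (i < n)%N -> (j < n)%N -> f i = f j -> i = j.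

Lemma card_enum A n : (0 < n)%N -> A #= `I_n ->
  exists2 f, inj_below n f & A = f @` `I_n.
Proof.
move=> n0 /card_set_bijP[h [hfun hinj hsurj]].
have [x0 Ax0 _] := hsurj _ n0.
have /choice[f fP] : forall i, exists x, (i < n)%N -> A x /\ h x = i.
  move=> i; have [lt|ge] := ltnP i n; last by exists x0.
  by have [x Ax hx] := hsurj _ lt; exists x.
exists f => [i j lti ltj eqf|].
  by rewrite -(proj2 (fP i lti)) eqf (proj2 (fP j ltj)).
apply/seteqP; split=> [x Ax|_ [i /= lti <-]]; last by have [] := fP i lti.
have lt : (h x < n)%N by exact: (hfun x Ax).
exists (h x) => //; have [Af hf] := fP _ lt.
by apply: hinj; rewrite ?inE.
Qed.

Lemma card_of_enum f n : inj_below n f -> (f @` `I_n) #= `I_n.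
Proof. by move=> inj; apply: inj_card_eq => i j; rewrite !inE /=; apply: inj. Qed.

Lemma enum_seq f n x : (f @` `I_n) x <-> x \in [seq f i | i <- iota 0 n].
Proof.
split=> [[i /= lti <-]|/mapP[j]]; first by rewrite map_f // mem_iota.
by rewrite mem_iota => /= lti ->; exists j.
Qed.

Lemma enum_uniq f n : inj_below n f -> uniq [seq f i | i <- iota 0 n].
Proof.
move=> inj; rewrite map_inj_in_uniq ?iota_uniq // => i j.
by rewrite !mem_iota; apply: inj.
Qed.

Lemma enum_sub_eq A f n : (0 < n)%N -> A #= `I_n -> inj_below n f ->
  (forall i, (i < n)%N -> A (f i)) -> A = f @` `I_n.
Proof.
move=> n0 /(card_enum n0)[g injg ->] injf fA.
have sub : {subset [seq f i | i <- iota 0 n] <= [seq g i | i <- iota 0 n]}.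
  by move=> x /mapP[j]; rewrite mem_iota /= => lti ->; apply/enum_seq/fA.
have [|_ eqfg] := uniq_min_size (enum_uniq injf) sub; first by rewrite !size_map.
by apply/seteqP; split=> x /enum_seq xP; apply/enum_seq; rewrite ?eqfg // -eqfg.
Qed.

End Enumeration.

Section Incidence.
Variable F : numFieldType.
Implicit Types (p q r x y : P2 F) (u v w : 'rV[F]_3) (P : nat -> P2 F).

Definition line p q : {vspace 'rV[F]_3} := (val p + val q)%VS.
Definition on x (L : {vspace 'rV[F]_3}) := (val x <= L)%VS.
Definition six P := P @` `I_6.

Lemma rep_exists p : exists v, represents v p.
Proof.
case: p => V dV; exists (vpick V); rewrite /represents /=.
have V0 : V != 0%VS by rewrite -dimv_eq0 (eqP dV).
apply/eqP; rewrite eq_sym eqEdim -memvE memv_pick (eqP dV) dim_vline.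
by rewrite vpick0 V0.
Qed.

Lemma rep_neq0 v p : represents v p -> v != 0.
Proof.
case: p => V dV; rewrite /represents /= => E; apply/eqP => v0.
by move/eqP: dV; rewrite E v0 dim_vline eqxx.
Qed.

Lemma rep_on w x (L : {vspace 'rV[F]_3}) : represents w x -> on x L = (w \in L).
Proof. by rewrite /represents /on => ->; rewrite -memvE. Qed.

Lemma rep_scale a v p : a != 0 -> represents v p -> represents (a *: v) p.
Proof.
rewrite /represents => a0 ->; apply/eqP; rewrite eqEdim -!memvE !dim_vline scaler_eq0 negb_or a0.
rewrite leqnn andbT; apply/vlineP; exists a^-1.
by rewrite scalerA mulVf // scale1r.
Qed.

Lemma rep_prop u v p : represents u p -> represents v p -> exists2 a, a != 0 & v = a *: u.
Proof.
move=> Eu Ev; have : v \in <[u]>%VS by rewrite -Eu Ev memv_line.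
case/vlineP => a va; exists a => //; apply: contraTneq (rep_neq0 Ev) => a0.
by rewrite va a0 scale0r negbK.
Qed.

Lemma rep_inj v p q : represents v p -> represents v q -> p = q.
Proof. by move=> Ep Eq; apply: val_inj; rewrite Ep Eq. Qed.

Lemma rep_eq u v p q : represents u p -> represents v q ->
  p = q <-> cross u v = 0.
Proof.
move=> Eu Ev; split=> [pq|uv0].
  have [a _ ->] := rep_prop Eu (etrans (congr1 val pq) Ev : represents v p).
  by apply: rV3P; rewrite /cross !vecE !mxE; ring.
have [a va] := cross_eq0 (rep_neq0 Eu) uv0.
have a0 : a != 0 by apply: contraTneq (rep_neq0 Ev) => a0; rewrite va a0 scale0r negbK.
by apply: rep_inj Ev; rewrite va; apply: rep_scale.
Qed.

Lemma on_lineE u v w p q x : represents u p -> represents v q -> represents w x ->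
  p <> q -> on x (line p q) = (br u v w == 0).
Proof.
move=> Eu Ev Ew pq; rewrite (rep_on _ Ew) /line Eu Ev.
apply/idP/eqP => [/memv_addP[_ /vlineP[a ->] [_ /vlineP[b ->] ->]]|uvw0].
  by rewrite /br !mxE; ring.
have nz : cross u v != 0 by apply/eqP => /(rep_eq Eu Ev).
have [a [b ->]] := br_eq0_span nz uvw0.
by rewrite memv_add // memvZ // memv_line.
Qed.

Lemma on_l p q : on p (line p q). Proof. exact: addvSl. Qed.
Lemma on_r p q : on q (line p q). Proof. exact: addvSr. Qed.
Lemma lineC p q : line p q = line q p. Proof. exact: addvC. Qed.

Lemma dim_line p q : p <> q -> \dim (line p q) = 2.
Proof.
move=> pq; have [u Eu] := rep_exists p; have [v Ev] := rep_exists q.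
rewrite /line dimv_disjoint_sum; first by rewrite Eu Ev !dim_vline (rep_neq0 Eu) (rep_neq0 Ev).
apply/eqP; rewrite -subv0; apply/subvP => w /memv_capP[]; rewrite Eu Ev.
case/vlineP => a -> /vlineP[b ab]; rewrite memv0; apply/eqP.
have [->|a0] := eqVneq a 0; first by rewrite scale0r.
case: pq; apply: rep_inj Ev; have -> : v = (b^-1 * a) *: u; last apply: rep_scale => //.
  rewrite -scalerA ab scalerA mulVf ?scale1r //.
  apply: contraTneq (rep_neq0 Eu) => b0; rewrite negbK; move/eqP: ab.
  by rewrite b0 scale0r scaler_eq0 (negPf a0).
rewrite mulf_neq0 // invr_eq0; apply: contraTneq (rep_neq0 Eu) => b0.
by rewrite negbK; move/eqP: ab; rewrite b0 scale0r scaler_eq0 (negPf a0).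
Qed.

Lemma line_eq p q x y : p <> q -> x <> y -> on x (line p q) -> on y (line p q) ->
  line x y = line p q.
Proof.
move=> pq xy xL yL; apply/eqP; rewrite eqEdim !dim_line // leqnn andbT.
by rewrite subv_add; apply/andP; split.
Qed.

Lemma two_lines p q r s x y : p <> q -> r <> s -> x <> y ->
  on x (line p q) -> on y (line p q) -> on x (line r s) -> on y (line r s) ->
  line p q = line r s.
Proof. by move=> pq rs xy *; rewrite -(line_eq pq xy) // -(line_eq rs xy). Qed.

Lemma lines_sixP P L : inj_below 6 P -> lines_through_pairs (six P) L <->
  exists i j, [/\ (i < 6)%N, (j < 6)%N, i <> j & L = line (P i) (P j)].
Proof.
move=> inj; split=> [[_ [_ [[i /= i6 <-] [j /= j6 <-] pq ->]]]|[i [j [i6 j6 ij ->]]]].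
  by exists i, j; split=> // ij; rewrite ij in pq.
by exists (P i), (P j); split; [exists i|exists j|move/inj=> /(_ i6 j6)|].
Qed.

Definition rel P x (s : seq nat) : Prop :=
  match s with
  | [:: i] => x = P i
  | [:: a; b; c; d; e; f] =>
      [/\ on x (line (P a) (P b)), on x (line (P c) (P d)) & on x (line (P e) (P f))]
  | _ => False
  end.

Definition collinear (v : nat -> 'rV[F]_3) (t : seq nat) : bool :=
  if t is [:: i; j; k] then br (v i) (v j) (v k) == 0 else false.
Definition concurrent (v : nat -> 'rV[F]_3) (s : seq nat) : bool :=
  if s is [:: a; b; c; d; e; f] then conc (v a) (v b) (v c) (v d) (v e) (v f) == 0
  else false.

Lemma collinear_normal (v : nat -> 'rV[F]_3) t : collinear v (triple_normal t) = collinear v t.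
Proof.
apply: (@triple_normalE _ (collinear v)) => -[|i [|j [|k [|l r]]]] //=.
  by rewrite br_swap12 oppr_eq0.
by rewrite br_swap23 oppr_eq0.
Qed.

Lemma concurrent_normal (v : nat -> 'rV[F]_3) s : concurrent v (synth_normal s) = concurrent v s.
Proof.
apply: (@synth_normalE _ (concurrent v)) => -[|a [|b [|c [|d [|e [|f [|g r]]]]]]] //=.
- by rewrite conc_swap_within oppr_eq0.
- by rewrite conc_swap12 oppr_eq0.
- by rewrite conc_swap23 oppr_eq0.
Qed.

Lemma rel_normal P x s : rel P x (synth_normal s) = rel P x s.
Proof.
apply: (@synth_normalE _ (rel P x)) => -[|a [|b [|c [|d [|e [|f [|g r]]]]]]] //=.
- by rewrite lineC.
- by rewrite propeqE; split=> -[].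
- by rewrite propeqE; split=> -[].
Qed.

End Incidence.

(** * Coding triple points by labels *)

Fixpoint colorings n : seq (seq nat) :=
  if n is n'.+1 then [seq c :: w | c <- iota 0 3, w <- colorings n'] else [:: [::]].

Lemma mem_colorings n w : size w = n -> all (fun c => (c < 3)%N) w -> w \in colorings n.
Proof.
elim: n w => [|n IH] [|c w] // [Sw] /andP[c3 wP].
by apply/allpairsP; exists (c, w); split; rewrite ?mem_iota ?IH.
Qed.

(** Five objects in three classes, at best 2 + 2 + 1, contain two pairs of equal class. The objects
    will be the labels other than [i], the classes the three lines through the point [i], and each
    such pair gives a collinear triple. *)
Lemma three_colors_collide i w : (i < 6)%N -> w \in colorings 6 ->
  (2 <= count (fun t => let r := [seq j <- t | j != i] in
                        nth 0 w (nth 0 r 0) == nth 0 w (nth 0 r 1))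
              [seq t <- triples | i \in t])%N.
Proof.
move=> i6; suff /allP H : all (fun i => all (fun w =>
  (2 <= count (fun t => let r := [seq j <- t | j != i] in
                        nth 0 w (nth 0 r 0) == nth 0 w (nth 0 r 1))
              [seq t <- triples | i \in t])%N) (colorings 6)) (iota 0 6).
  by move=> wP; have /allP := H i (etrans (mem_iota 0 6 i) i6); apply.
by vm_cast_no_check (erefl true).
Qed.

Lemma triple_split i t : (i < 6)%N -> t \in triples -> i \in t ->
  let r := [seq j <- t | j != i] in
  [/\ (nth 0 r 0 < 6)%N, (nth 0 r 1 < 6)%N, nth 0 r 0 != i, nth 0 r 1 != i &
      (nth 0 r 0 != nth 0 r 1) && (triple_normal [:: i; nth 0 r 0; nth 0 r 1] == t)].
Proof.
move=> i6 tP it.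
have /allP H : all (fun i => all (fun t => let r := [seq j <- t | j != i] in
   (i \in t) ==> [&& (nth 0 r 0 < 6)%N, (nth 0 r 1 < 6)%N, nth 0 r 0 != i, nth 0 r 1 != i,
      nth 0 r 0 != nth 0 r 1 & triple_normal [:: i; nth 0 r 0; nth 0 r 1] == t])
   triples) (iota 0 6) by vm_cast_no_check (erefl true).
have /allP/(_ t tP) := H i (etrans (mem_iota 0 6 i) i6).
by rewrite it => /and5P.
Qed.

Lemma triple_third a b t : (a < 6)%N -> (b < 6)%N -> a != b -> t \in triples ->
  a \in t -> b \in t ->
  exists k, [/\ (k < 6)%N, k != a, k != b & triple_normal [:: a; b; k] = t].
Proof.
move=> a6 b6 ab tP at_ bt.
have /allP H : all (fun a => all (fun b => all (fun t =>
   [&& a != b, a \in t & b \in t] ==> has (fun k => [&& k != a, k != b &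
      triple_normal [:: a; b; k] == t]) (iota 0 6)) triples) (iota 0 6)) (iota 0 6).
  by vm_cast_no_check (erefl true).
have /allP Ha := H a (etrans (mem_iota 0 6 a) a6).
have /allP Hb := Ha b (etrans (mem_iota 0 6 b) b6).
have := Hb t tP; rewrite ab at_ bt => /hasP[k]; rewrite mem_iota => k6 /and3P[ka kb /eqP kt].
by exists k.
Qed.

Lemma touches_normal s t : touches (synth_normal s) t = touches s t.
Proof.
apply: (@synth_normalE _ (touches^~ t)) => -[|a [|b [|c [|d [|e [|f [|g r]]]]]]] //=.
- by rewrite /touches /= (andbC (b \in t)).
- by rewrite /touches /= orbCA.
- by rewrite /touches /=; congr (_ || _); rewrite orbCA.
Qed.

Lemma code_ok_synth z c s : s \in synthemes ->
  code_ok z c s = c s && ~~ has z [seq t <- triples | touches s t].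
Proof.
move=> sP; have /allP/(_ s sP) : all (fun s => size s == 6) synthemes by [].
by case: s {sP} => [|a [|b s]].
Qed.

Section TriplePoints.
Variable F : numFieldType.
Implicit Types (P : nat -> P2 F) (v : nat -> 'rV[F]_3).

Definition reps v P := forall i, represents (v i) (P i).

Lemma neq_pt P i j : inj_below 6 P -> (i < 6)%N -> (j < 6)%N -> i != j -> P i <> P j.
Proof. by move=> inj i6 j6 /eqP ij /inj E; apply: ij; apply: E. Qed.

Lemma on_lineZ P v i j k : inj_below 6 P -> reps v P -> (i < 6)%N -> (j < 6)%N -> i != j ->
  on (P k) (line (P i) (P j)) = collinear v [:: i; j; k].
Proof. by move=> inj vP i6 j6 ij; rewrite /= (on_lineE (vP i) (vP j) (vP k)) //; apply: neq_pt. Qed.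

(** Two distinct lines meet only in [x], which is not a point of the configuration; hence no point
    of the configuration lies on both. *)
Lemma pencil_disjoint P v x a b c d : inj_below 6 P -> reps v P ->
  ~ six P x -> (a < 6)%N -> (b < 6)%N -> (c < 6)%N -> (d < 6)%N -> a != b -> c != d ->
  on x (line (P a) (P b)) -> on x (line (P c) (P d)) ->
  line (P a) (P b) <> line (P c) (P d) ->
  [/\ a != c, b != c, ~~ collinear v [:: a; b; c] & ~~ collinear v [:: c; d; a]].
Proof.
move=> inj vP xP a6 b6 c6 d6 ab cd xab xcd neq.
have xNP i : (i < 6)%N -> x <> P i by move=> i6 xi; apply: xP; exists i.
have ab' := neq_pt inj a6 b6 ab; have cd' := neq_pt inj c6 d6 cd.
have abc : ~~ collinear v [:: a; b; c].
  rewrite -(on_lineZ _ inj vP) //; apply/negP => abc; apply: neq.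
  by apply: (two_lines ab' cd' (xNP c c6)) => //; apply: on_l.
have cda : ~~ collinear v [:: c; d; a].
  rewrite -(on_lineZ _ inj vP) //; apply/negP => cda; apply: neq.
  by apply: (two_lines ab' cd' (xNP a a6)) => //; apply: on_l.
split=> //; apply: contraNneq abc => ->; rewrite /= ?bruvu ?bruvv ?eqxx //.
Qed.

(** At a point of the configuration the colouring by the three lines produces two collinear triples.
    Elsewhere the three lines use disjoint pairs of labels, which form a syntheme. *)
Lemma triple_code P v x : inj_below 6 P -> reps v P -> triple_points (six P) x ->
  exists2 s, s \in codes & code_ok (collinear v) (concurrent v) s /\ rel P x s.
Proof.
move=> inj vP; rewrite /triple_points /= => /(card_enum (isT : 0 < 3)%N)[L injL LP].
have linesL k : (k < 3)%N -> lines_through_pairs (six P) (L k) /\ on x (L k).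
  move=> k3; have : (L @` `I_3) (L k) by exists k.
  by rewrite -LP.
have [[i /= i6 Pi]|xP] := pselect (six P x).
  exists [:: i]; first by rewrite mem_cat map_f ?mem_iota.
  split=> //.
  (* The colour of [j] is the number of the line joining it to [i]; the colour 0 is a mere default
     for [j = i] and for labels out of range. *)
  have /choice[q qP] : forall j, exists c, (c < 3)%N /\
      ((j < 6)%N -> j != i -> line (P i) (P j) = L c).
    move=> j; have [/andP[j6 ji]|] := boolP ((j < 6)%N && (j != i)); last first.
      by move=> jN; exists 0%N; split=> // j6 ji; rewrite j6 ji in jN.
    have : (L @` `I_3) (line (P i) (P j)).
      rewrite -LP; split; last by rewrite -Pi; apply: on_l.
      by apply/lines_sixP => //; exists i, j; split=> //; apply/eqP; rewrite eq_sym.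
    by case=> c /= c3 cE; exists c; split=> // _ _; rewrite cE.
  have wP : [seq q j | j <- iota 0 6] \in colorings 6.
    by apply: mem_colorings; rewrite ?size_map //; apply/allP=> _ /mapP[j _ ->]; have [] := qP j.
  rewrite /code_ok; apply: leq_trans (three_colors_collide i6 wP) _.
  have nthq j : (j < 6)%N -> nth 0%N [seq q j | j <- iota 0 6] j = q j.
    by move=> j6; rewrite (nth_map 0%N) ?size_iota // nth_iota.
  have sub t : t \in [seq t <- triples | i \in t] ->
      (let r := [seq j <- t | j != i] in
       nth 0 [seq q j | j <- iota 0 6] (nth 0 r 0) ==
       nth 0 [seq q j | j <- iota 0 6] (nth 0 r 1)) -> collinear v t.
    rewrite mem_filter => /andP[it tP].
    have [j6 k6 ji ki /andP[jk /eqP tE]] := triple_split i6 tP it.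
    cbv zeta; rewrite !nthq // => /eqP qjk.
    rewrite -tE collinear_normal -(on_lineZ _ inj vP) //; last by rewrite eq_sym.
    by rewrite (proj2 (qP _) j6 ji) qjk -(proj2 (qP _) k6 ki); apply: on_r.
  by rewrite -!size_filter; apply: uniq_leq_size => [|t]; rewrite ?filter_uniq //
    !mem_filter => /and3P[H1 H2 H3]; rewrite H2 H3 sub // mem_filter H2 H3.
have [[/lines_sixP-/(_ inj)[a [b [a6 b6 /eqP ab Eab]]] xab]
      [/lines_sixP-/(_ inj)[c [d [c6 d6 /eqP cd Ecd]]] xcd]
      [/lines_sixP-/(_ inj)[e [f [e6 f6 /eqP ef Eef]]] xef]] :=
  And3 (linesL 0%N isT) (linesL 1%N isT) (linesL 2%N isT).
have N01 : line (P a) (P b) <> line (P c) (P d) by rewrite -Eab -Ecd => /injL-/(_ isT isT).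
have N02 : line (P a) (P b) <> line (P e) (P f) by rewrite -Eab -Eef => /injL-/(_ isT isT).
have N12 : line (P c) (P d) <> line (P e) (P f) by rewrite -Ecd -Eef => /injL-/(_ isT isT).
rewrite Eab in xab; rewrite Ecd in xcd; rewrite Eef in xef.
have D i j k l : (i < 6)%N -> (j < 6)%N -> (k < 6)%N -> (l < 6)%N -> i != j -> k != l ->
   on x (line (P i) (P j)) -> on x (line (P k) (P l)) -> line (P i) (P j) <> line (P k) (P l) ->
   [/\ [&& i != k, i != l, j != k & j != l], ~~ collinear v [:: i; j; k], ~~ collinear v [:: i; j; l],
       ~~ collinear v [:: k; l; i] & ~~ collinear v [:: k; l; j]].
  move=> i6 j6 k6 l6 ij kl xij xkl N.
  have [ik jk ijk kli] := pencil_disjoint inj vP xP i6 j6 k6 l6 ij kl xij xkl N.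
  have := @pencil_disjoint P v x j i l k inj vP xP j6 i6 l6 k6.
  rewrite eq_sym ij eq_sym kl !(lineC (P j)) !(lineC (P l)) => /(_ isT isT xij xkl N)[jl il jil lkj].
  split=> //; first by rewrite ik il jk jl.
    by move: jil; rewrite /= br_swap12 oppr_eq0.
  by move: lkj; rewrite /= br_swap12 oppr_eq0.
have [/and4P[ac ad bc bd] abc abd cda cdb] := D _ _ _ _ a6 b6 c6 d6 ab cd xab xcd N01.
have [/and4P[ae af be bf] abe abf efa efb] := D _ _ _ _ a6 b6 e6 f6 ab ef xab xef N02.
have [/and4P[ce cf de df] cde cdf efc efd] := D _ _ _ _ c6 d6 e6 f6 cd ef xcd xef N12.
pose l := [:: a; b; c; d; e; f].
have lP : l \in perms6.
  apply: perms6_uniq; rewrite //= ?a6 ?b6 ?c6 ?d6 ?e6 ?f6 //.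
  by rewrite !inE !negb_or ab ac ad ae af bc bd be bf cd ce cf de df ef.
exists (synth_normal l); first by rewrite mem_cat synth_normal_mem ?orbT.
split; last by rewrite rel_normal.
rewrite code_ok_synth ?synth_normal_mem // concurrent_normal.
apply/andP; split.
  have [w wx] := rep_exists x.
  apply/eqP/(conc_eq0 (rep_neq0 wx)); apply/eqP; rewrite -(on_lineE (vP _) (vP _) wx) //;
    exact: neq_pt.
(* A collinear triple containing one pair would have its third label in another pair, so a point of
   the second line would lie on the first; [D] excluded all these cases. *)
apply/negP => /hasP[t]; rewrite mem_filter touches_normal => /andP[touch tP] Zt.
have memk k : (k < 6)%N -> k \in l.
  by move=> k6; move: lP; rewrite mem_perms6 => /perm_mem ->; rewrite mem_iota.
move: touch; rewrite /touches /= orbF => /or3P[] /andP[it jt].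
- have [k [k6 ka kb tE]] := triple_third a6 b6 ab tP it jt.
  have := memk k k6.
  rewrite !inE (negPf ka) (negPf kb) /= => /or4P[]/eqP kE;
    by move: Zt; rewrite -tE collinear_normal kE; apply/negP.
- have [k [k6 kc kd tE]] := triple_third c6 d6 cd tP it jt.
  have := memk k k6.
  rewrite !inE (negPf kc) (negPf kd) /= => /or4P[]/eqP kE;
    by move: Zt; rewrite -tE collinear_normal kE; apply/negP.
- have [k [k6 ke kf tE]] := triple_third e6 f6 ef tP it jt.
  have := memk k k6.
  rewrite !inE (negPf ke) (negPf kf) /= !orbF => /or4P[]/eqP kE;
    by move: Zt; rewrite -tE collinear_normal kE; apply/negP.
Qed.

End TriplePoints.

Lemma perms6P l : l \in perms6 -> exists a b c d e f, l = [:: a; b; c; d; e; f].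
Proof.
rewrite mem_perms6 => /perm_size; rewrite size_iota.
by case: l => [|a [|b [|c [|d [|e [|f [|g l]]]]]]] // _; exists a, b, c, d, e, f.
Qed.

Lemma perms6_lt l i : l \in perms6 -> i \in l -> (i < 6)%N.
Proof. by rewrite mem_perms6 => /perm_mem ->; rewrite mem_iota. Qed.

Lemma perms6_mem l i : l \in perms6 -> (i < 6)%N -> i \in l.
Proof. by rewrite mem_perms6 => /perm_mem -> ; rewrite mem_iota. Qed.

Lemma perms6_uniqP l : l \in perms6 -> uniq l.
Proof. by rewrite mem_perms6 => /perm_uniq ->. Qed.

Lemma synthemes_perms6 s : s \in synthemes -> s \in perms6.
Proof.
have /allP H : all (mem perms6) synthemes by vm_cast_no_check (erefl true).
exact: H.
Qed.

(** * Configurations without collinear triples *)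

Section Nondegenerate.
Variable F : numFieldType.
Implicit Types (P Q : nat -> P2 F) (v : nat -> 'rV[F]_3).

Definition nondeg v := forall i j k, (i < 6)%N -> (j < 6)%N -> (k < 6)%N ->
  i != j -> i != k -> j != k -> br (v i) (v j) (v k) != 0.

Lemma nondeg_inj P v : reps v P -> nondeg v -> inj_below 6 P.
Proof.
move=> vP nd i j i6 j6 Pij; apply/eqP; apply: contraT => ij.
have [a _ E] := rep_prop (vP i) (etrans (congr1 val Pij) (vP j) : represents (v j) (P i)).
have [k [k6 ik jk]] : exists k, [/\ (k < 6)%N, i != k & j != k].
  have : has (fun k => (i != k) && (j != k)) (iota 0 6).
    by case: i j i6 j6 {Pij ij E} => [|[|[|[|[|[|i]]]]]] [|[|[|[|[|[|j]]]]]].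
  by case/hasP => k; rewrite mem_iota => k6 /andP[ik jk]; exists k.
by have := nd i j k i6 j6 k6 ij ik jk; rewrite E /br !mxE => /eqP[]; ring.
Qed.

Section Config.
Variables (P : nat -> P2 F) (v : nat -> 'rV[F]_3).
Hypotheses (vP : reps v P) (nd : nondeg v).

Let inj : inj_below 6 P := nondeg_inj vP nd.

Lemma nondeg_off i j k : (i < 6)%N -> (j < 6)%N -> (k < 6)%N ->
  i != j -> i != k -> j != k -> ~~ on (P k) (line (P i) (P j)).
Proof. by move=> *; rewrite (on_lineZ _ inj vP) //=; apply: nd. Qed.

Lemma nondeg_line_neq i j k l : (i < 6)%N -> (j < 6)%N -> (k < 6)%N ->
  i != j -> i != k -> j != k -> line (P i) (P j) <> line (P k) (P l).
Proof.
move=> i6 j6 k6 ij ik jk E; have := nondeg_off i6 j6 k6 ij ik jk.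
by rewrite E on_l.
Qed.

Lemma rel_unique x y s : s \in perms6 -> rel P x s -> rel P y s -> x = y.
Proof.
move=> sP; have [a [b [c [d [e [f sE]]]]]] := perms6P sP; have U := perms6_uniqP sP.
have lt i := perms6_lt (i := i) sP; rewrite sE in U lt *.
have [a6 b6 c6 d6] : [/\ a < 6, b < 6, c < 6 & d < 6]%N.
  by split; apply: lt; rewrite !inE eqxx ?orbT.
move: U; rewrite /= !inE !negb_or => /and5P[/and5P[ab ac ad _ _] /and4P[bc bd _ _] /and3P[cd _ _] _ _].
move=> [xab xcd _] [yab ycd _]; apply: contrapT => xy.
apply: (nondeg_line_neq (l := d) a6 b6 c6 ab ac bc).
by apply: (two_lines _ _ xy) => //; apply: (neq_pt inj).
Qed.

Lemma rel_off x s i : s \in perms6 -> rel P x s -> (i < 6)%N -> x <> P i.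
Proof.
move=> sP; have [a [b [c [d [e [f sE]]]]]] := perms6P sP; have U := perms6_uniqP sP.
have lt j := perms6_lt (i := j) sP; have mem j := perms6_mem (i := j) sP.
rewrite sE in U lt mem *.
have [a6 b6 c6 d6] : [/\ a < 6, b < 6, c < 6 & d < 6]%N.
  by split; apply: lt; rewrite !inE eqxx ?orbT.
move: U; rewrite /= !inE !negb_or => /and5P[/and5P[ab ac ad ae af] /and4P[bc bd be bf] /and3P[cd ce cf] /andP[de df] _].
move=> [xab xcd _] i6 xi; rewrite xi in xab xcd.
have [/andP[ia ib]|] := boolP ((i != a) && (i != b)).
  by have := nondeg_off a6 b6 i6 ab; rewrite eq_sym ia eq_sym ib xab => /(_ isT isT).
rewrite negb_and !negbK => iab; have := nondeg_off c6 d6 i6 cd.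
by rewrite xcd; case/orP: iab => /eqP->; rewrite eq_sym ?ac ?bc eq_sym ?ad ?bd => /(_ isT isT).
Qed.

Lemma rel_pencil x s i : s \in perms6 -> rel P x s -> (i < 6)%N ->
  exists k, [/\ (k < 3)%N, i \in [:: nth 0%N s k.*2; nth 0%N s k.*2.+1],
     on x (line (P (nth 0%N s k.*2)) (P (nth 0%N s k.*2.+1))) &
     on (P i) (line (P (nth 0%N s k.*2)) (P (nth 0%N s k.*2.+1)))].
Proof.
move=> sP; have [a [b [c [d [e [f sE]]]]]] := perms6P sP.
have mem j := perms6_mem (i := j) sP; rewrite sE in mem *.
move=> [xab xcd xef] /mem; rewrite !inE.
case/or4P => [|||/or3P[]] /eqP ->.
- by exists 0%N; split; rewrite /= ?inE ?eqxx ?on_l.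
- by exists 0%N; split; rewrite /= ?inE ?eqxx ?orbT ?on_r.
- by exists 1%N; split; rewrite /= ?inE ?eqxx ?on_l.
- by exists 1%N; split; rewrite /= ?inE ?eqxx ?orbT ?on_r.
- by exists 2%N; split; rewrite /= ?inE ?eqxx ?on_l.
- by exists 2%N; split; rewrite /= ?inE ?eqxx ?orbT ?on_r.
Qed.

(** The pair of [s] containing [i] gives a line through both [x] and [P i], hence the given line.
    Without collinear triples a line has only two labels, so [j] is in the same pair. *)
Lemma rel_duad x s i j : s \in perms6 -> rel P x s -> (i < 6)%N -> (j < 6)%N -> i != j ->
  on x (line (P i) (P j)) ->
  exists2 k, (k < 3)%N &
    line (P i) (P j) = line (P (nth 0%N s k.*2)) (P (nth 0%N s k.*2.+1)) /\
    {subset [:: i; j] <= [:: nth 0%N s k.*2; nth 0%N s k.*2.+1]}.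
Proof.
move=> sP xs i6 j6 ij xij; have [k [k3 ik xk Pik]] := rel_pencil sP xs i6.
have sz : size s = 6 by move: sP; rewrite mem_perms6 => /perm_size ->.
have [A6 B6] : (nth 0%N s k.*2 < 6)%N /\ (nth 0%N s k.*2.+1 < 6)%N.
  by split; apply: (perms6_lt sP); rewrite mem_nth // sz; case: k k3 {ik xk Pik} => [|[|[|k]]].
have AB : nth 0%N s k.*2 != nth 0%N s k.*2.+1.
  by rewrite nth_uniq ?(perms6_uniqP sP) ?sz //; case: k k3 {ik xk Pik A6 B6} => [|[|[|k]]].
have E : line (P i) (P j) = line (P (nth 0%N s k.*2)) (P (nth 0%N s k.*2.+1)).
  by apply: (two_lines _ _ (rel_off sP xs i6)) => //; try exact: (neq_pt inj); apply: on_l.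
exists k => //; split=> // h; rewrite inE => /orP[/eqP->//|]; rewrite inE => /eqP->.
move: (on_r (P i) (P j)); rewrite E => Pj; apply: contraT; rewrite !inE negb_or => /andP[jA jB].
by have := nondeg_off A6 B6 j6 AB; rewrite eq_sym jA eq_sym jB Pj => /(_ isT isT).
Qed.

Lemma synth_triple x s : s \in perms6 -> rel P x s -> triple_points (six P) x.
Proof.
move=> sP xs; pose f k := line (P (nth 0%N s k.*2)) (P (nth 0%N s k.*2.+1)).
have sz : size s = 6 by move: sP; rewrite mem_perms6 => /perm_size ->.
have lt k : (k < 6)%N -> (nth 0%N s k < 6)%N.
  by move=> k6; apply: (perms6_lt sP); rewrite mem_nth ?sz.
have U i j : (i < 6)%N -> (j < 6)%N -> (nth 0%N s i != nth 0%N s j) = (i != j).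
  by move=> i6 j6; rewrite nth_uniq ?sz ?(perms6_uniqP sP).
have lt3 k : (k < 3)%N -> (k.*2 < 6)%N && (k.*2.+1 < 6)%N by case: k => [|[|[|k]]].
rewrite /triple_points /=.
rewrite (_ : [set L | _] = f @` `I_3).
  apply: card_of_enum => i j /[dup] i3 /lt3/andP[i6 i6'] /[dup] j3 /lt3/andP[j6 j6'] fij.
  apply/eqP; apply: contraT => ij; exfalso; move: fij.
  apply: nondeg_line_neq; rewrite ?lt ?U //;
    case: i j i3 j3 ij {i6 i6' j6 j6'} => [|[|[|i]]] [|[|[|j]]] //.
apply/seteqP; split=> L.
  case=> /lines_sixP-/(_ inj)[i [j [i6 j6 /eqP ij ->]]] xij.
  by have [k k3 [E _]] := rel_duad sP xs i6 j6 ij xij; exists k.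
case=> k /= /[dup] k3 /lt3/andP[k6 k6'] <-; split.
  apply/lines_sixP => //; exists (nth 0%N s k.*2), (nth 0%N s k.*2.+1).
  by split; rewrite ?lt //; apply/eqP; rewrite U // neq_ltn leqnn.
move: xs k3 {k6 k6'}; rewrite /f; have [a [b [c [d [e [g ->]]]]]] := perms6P sP.
by case=> xab xcd xef; case: k => [|[|[|k]]].
Qed.

(** Six distinct concurrency points exhaust a set of six elements, so nothing has to be known about
    the other synthemes. [triple_points_exact] makes the opposite trade: no cardinality is assumed,
    but the other synthemes must be excluded. *)
Lemma triple_points_eq Q (S : nat -> seq nat) : inj_below 6 Q ->
  (forall j, (j < 6)%N -> S j \in perms6 /\ rel P (Q j) (S j)) ->
  triple_points (six P) #= `I_6 -> triple_points (six P) = six Q.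
Proof.
move=> injQ SP c6; apply: enum_sub_eq => // j j6.
by have [sP] := SP j j6; apply: synth_triple.
Qed.

Lemma triple_points_exact Q (S : nat -> seq nat) :
  (forall j, (j < 6)%N -> S j \in perms6 /\ rel P (Q j) (S j)) ->
  (forall s, s \in synthemes -> concurrent v s -> exists2 j, (j < 6)%N & s = synth_normal (S j)) ->
  triple_points (six P) = six Q.
Proof.
move=> SP ex; apply/seteqP; split=> x.
  move=> /(triple_code inj vP)[s]; rewrite mem_cat => /orP[/mapP[h]|sP].
    rewrite mem_iota => i6 -> [+ _]; rewrite /code_ok -size_filter.
    case E: [seq x <- _ | collinear v x] => [//|t r] _; exfalso.
    have : t \in [seq x <- [seq t <- triples | h \in t] | collinear v x] by rewrite E mem_head.
    rewrite !mem_filter => /and3P[+ it tP].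
    have [j6 k6 ji ki /andP[jk /eqP <-]] := triple_split i6 tP it.
    by rewrite collinear_normal /=; apply/negP; apply: nd; rewrite // eq_sym.
  rewrite code_ok_synth // => -[/andP[Cs _]].
  have [j j6 ->] := ex s sP Cs; rewrite rel_normal => xs.
  exists j => //; have [Sj Qj] := SP j j6; exact: rel_unique Qj xs.
by case=> j /= j6 <-; have [Sj Qj] := SP j j6; apply: synth_triple Qj.
Qed.

End Config.
End Nondegenerate.

(** * Classification *)

Section Classification.
Variable F : numFieldType.
Implicit Types (P : nat -> P2 F) (v : nat -> 'rV[F]_3).

Definition linear_form (n : 'rV[F]_3) : {mpoly F[3]} := \sum_j n 0 j *: 'X_j.

Lemma linear_formE n (w : 'rV[F]_3) : (linear_form n).@[w 0] = \sum_j n 0 j * w 0 j.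
Proof. by rewrite /linear_form raddf_sum; apply: eq_bigr => j _ /=; rewrite mevalZ mevalXU. Qed.

Lemma linear_form_neq0 n : n != 0 -> linear_form n != 0.
Proof.
apply: contra_neq => n0; apply/rowP => j; rewrite mxE -[RHS](mcoeff0 _ U_(j)%MM) -n0.
rewrite /linear_form raddf_sum (bigD1 j) //= mcoeffZ mcoeffXU eqxx mulr1 big1 ?addr0 //.
by move=> i ij; rewrite mcoeffZ mcoeffXU (negPf ij) mulr0.
Qed.

Lemma linear_form_homog n : linear_form n \is 1.-homog.
Proof. by apply: rpred_sum => j _; apply: dhomogZ; rewrite dhomogX /= mdeg1. Qed.

Lemma two_lines_conic P v i j k l : reps v P ->
  cross (v i) (v j) != 0 -> cross (v k) (v l) != 0 ->
  (forall m, (m < 6)%N -> br (v i) (v j) (v m) = 0 \/ br (v k) (v l) (v m) = 0) ->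
  on_conic (six P).
Proof.
move=> vP ij kl Hm.
exists (linear_form (cross (v i) (v j)) * linear_form (cross (v k) (v l))); split.
- by rewrite mulf_neq0 ?linear_form_neq0.
- exact: (dhomogM (linear_form_homog _) (linear_form_homog _)).
- move=> _ w [m /= m6 <-] /(rep_prop (vP m))[a _ ->].
  rewrite mevalM !linear_formE !sum3 /cross !vecE !mxE.
  apply/eqP; rewrite mulf_eq0; apply/orP.
  have E (u1 u2 : 'rV[F]_3) : (u1 0 o1 * u2 0 o2 - u1 0 o2 * u2 0 o1) * (a * v m 0 o0) +
     (u1 0 o2 * u2 0 o0 - u1 0 o0 * u2 0 o2) * (a * v m 0 o1) +
     (u1 0 o0 * u2 0 o1 - u1 0 o1 * u2 0 o0) * (a * v m 0 o2) = a * br u1 u2 (v m).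
    by rewrite /br; ring.
  by rewrite !E; case: (Hm m m6) => ->; rewrite mulr0 eqxx; [left|right].
Qed.

Section Table.
Variables (P : nat -> P2 F) (v : nat -> 'rV[F]_3).
Hypotheses (inj : inj_below 6 P) (vP : reps v P) (nc : ~ on_conic (six P)).

Definition table := map (collinear v) triples ++ map (concurrent v) synthemes.

Lemma zlitE t : triple_normal t \in triples ->
  nth false table (index (triple_normal t) triples) = collinear v t.
Proof.
move=> tP; rewrite nth_cat size_map index_mem tP.
by rewrite (nth_map [::]) ?index_mem // nth_index // collinear_normal.
Qed.

Lemma clitE s : synth_normal s \in synthemes ->
  nth false table (20 + index (synth_normal s) synthemes) = concurrent v s.
Proof.
move=> sP; rewrite nth_cat size_map -[size triples]/20%N ltnNge leq_addr [~~ _]/= addKn.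
by rewrite (nth_map [::]) ?index_mem // nth_index // concurrent_normal.
Qed.

Lemma sat_zlit t b cl : triple_normal t \in triples ->
  sat table (zlit t b :: cl) = (collinear v t == b) || sat table cl.
Proof. by move=> tP; rewrite -(zlitE tP). Qed.

Lemma sat_clit s b cl : synth_normal s \in synthemes ->
  sat table (clit s b :: cl) = (concurrent v s == b) || sat table cl.
Proof. by move=> sP; rewrite -(clitE sP). Qed.

Lemma cross_neq0 i j : (i < 6)%N -> (j < 6)%N -> i != j -> cross (v i) (v j) != 0.
Proof.
move=> i6 j6 ij; apply/eqP => /(rep_eq (vP i) (vP j)); exact: neq_pt.
Qed.

Lemma clauses_sat l cl : l \in perms6 -> cl \in clauses_of l -> sat table cl.
Proof.
move=> lP; have [a [b [c [d [e [f lE]]]]]] := perms6P lP.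
have U := perms6_uniqP lP; have lt i := perms6_lt (i := i) lP.
have mem i := perms6_mem (i := i) lP.
rewrite lE in U lt mem *.
have [a6 b6 c6] : [/\ a < 6, b < 6 & c < 6]%N.
  by split; apply: lt; rewrite !inE eqxx ?orbT.
have [d6 e6 f6] : [/\ d < 6, e < 6 & f < 6]%N.
  by split; apply: lt; rewrite !inE eqxx ?orbT.
have synP s : perm_eq s [:: a; b; c; d; e; f] -> synth_normal s \in synthemes.
  move=> sl; apply: synth_normal_mem; rewrite mem_perms6 (perm_trans sl) //.
  by rewrite -lE -mem_perms6.
move=> clP; move: U; rewrite /= !inE !negb_or => /and5P[/and5P[ab ac ad ae af] /and4P[bc bd be bf]
  /and3P[cd ce cf] /andP[de df] /andP[ef _]].
move: clP; rewrite /clauses_of !inE; case/or4P => /eqP->.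
- rewrite !sat_zlit ?triple_normal_mem // orbF !eqbF_neg -negb_and.
  apply/negP => /andP[/eqP abc /eqP abd]; apply: nc.
  apply: (two_lines_conic (i := a) (j := b) (k := e) (l := f) vP); rewrite ?cross_neq0 //.
  move=> m /mem; rewrite !inE => /or4P[|||/or3P[]] /eqP->; rewrite ?bruvu ?bruvv; auto.
- rewrite !sat_zlit ?triple_normal_mem // orbF !eqbF_neg -negb_and.
  apply/negP => /andP[/eqP abc /eqP def]; apply: nc.
  apply: (two_lines_conic (i := a) (j := b) (k := d) (l := e) vP); rewrite ?cross_neq0 //.
  move=> m /mem; rewrite !inE => /or4P[|||/or3P[]] /eqP->; rewrite ?bruvu ?bruvv; auto.
- have p1 : perm_eq [:: a; d; c; f; e; b] [:: a; b; c; d; e; f].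
    by apply/permP => q /=; ring.
  have p2 : perm_eq [:: a; f; c; b; e; d] [:: a; b; c; d; e; f].
    by apply/permP => q /=; ring.
  rewrite !sat_clit ?synP // orbF !eqbF_neg eqb_id -!implybE; apply/implyP => /eqP E1; apply/implyP => /eqP E2.
  rewrite /concurrent; apply/eqP; rewrite -[RHS](conc_hexagon (v a) (v b) (v c) (v d) (v e) (v f)).
  by rewrite E1 E2 !add0r.
- rewrite !sat_zlit ?triple_normal_mem // sat_clit ?synP // orbF !eqbF_neg eqb_id -!implybE.
  apply/implyP => /eqP E1; apply/implyP => /eqP E2.
  by rewrite /= /conc E1 E2 mul0r mulr0 subr0.
Qed.

Lemma code_ok_table s : s \in codes ->
  code_ok (ztab table) (ctab table) s = code_ok (collinear v) (concurrent v) s.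
Proof.
have zE (p : pred (seq nat)) : {in filter p triples, ztab table =1 collinear v}.
  have /allP T : all (fun t => triple_normal t \in triples) triples by vm_cast_no_check (erefl true).
  by move=> t; rewrite mem_filter => /andP[_ /T tP]; rewrite /ztab zlitE.
rewrite mem_cat => /orP[/mapP[i _ ->]|sP].
  by rewrite /code_ok (eq_in_count (zE (fun t => i \in t))).
by rewrite !code_ok_synth // (eq_in_has (zE (touches s))) /ctab clitE // synth_normal_mem // synthemes_perms6.
Qed.

Lemma pattern_table S T l : l \in perms6 -> {subset S <= perms6} ->
  {subset T <= K_triples ++ Y_triples} ->
  pattern S T (ztab table) (ctab table) l = pattern S T (collinear v) (concurrent v) l.
Proof.
move=> lP SP TP; congr (_ && ~~ _).
  apply: eq_in_all => s /SP sP; rewrite /ctab clitE // synth_normal_mem // mem_perms6.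
  have lE : sel l (iota 0 6) = l by have := perms6P lP; case=> a [b [c [d [e [f ->]]]]].
  apply: (@perm_trans _ l); last by rewrite -mem_perms6.
  by rewrite -[X in perm_eq _ X]lE; apply: perm_map; rewrite -mem_perms6.
apply: eq_in_has => t /TP tP; rewrite /ztab zlitE //.
have /allP H : all (fun l => all (fun t => triple_normal (sel l t) \in triples)
  (K_triples ++ Y_triples)) perms6 by vm_cast_no_check (erefl true).
by have /allP := H l lP; apply.
Qed.

(** A valid code determines its point, so six triple points require six codes. *)
Lemma count_codes : triple_points (six P) #= `I_6 ->
  (6 <= count (code_ok (collinear v) (concurrent v)) codes)%N.
Proof.
move=> /(card_enum (isT : 0 < 6)%N)[f injf fP].
have /choice[g gP] : forall j, exists s, (j < 6)%N ->
    [/\ s \in codes, code_ok (collinear v) (concurrent v) s & rel P (f j) s].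
  move=> j; have [j6|] := boolP (j < 6)%N; last by exists [::].
  have : triple_points (six P) (f j) by rewrite fP; exists j.
  by move=> /(triple_code inj vP)[s sc [ok r]]; exists s.
(* If two distinct points had the same syntheme, its first two lines would coincide, and [a], [b],
   [c] would be a collinear triple containing the pair [a], [b]. *)
have rel_inj x y s : s \in codes -> code_ok (collinear v) (concurrent v) s -> rel P x s -> rel P y s -> x = y.
  rewrite mem_cat => /orP[/mapP[i _ ->] _ -> -> //|sP].
  rewrite code_ok_synth // => /andP[_ noZ].
  have sP6 := synthemes_perms6 sP.
  have [a [b [c [d [e [h sE]]]]]] := perms6P sP6.
  have U := perms6_uniqP sP6; have lt i := perms6_lt (i := i) sP6.
  rewrite sE in noZ U lt *; have [a6 b6 c6 d6] : [/\ a < 6, b < 6, c < 6 & d < 6]%N.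
    by split; apply: lt; rewrite !inE eqxx ?orbT.
  move: U; rewrite [uniq _]/= !inE !negb_or => /and5P[/and5P[ab ac ad _ _] /and4P[bc bd _ _]
     /and3P[cd _ _] _ _] [xab xcd _] [yab ycd _]; apply: contrapT => xy.
  case/negP: noZ; apply/hasP; exists (triple_normal [:: a; b; c]).
    rewrite mem_filter triple_normal_mem // andbT.
    have tm i : (i \in triple_normal [:: a; b; c]) = (i \in [:: a; b; c]).
      apply: (@triple_normalE _ (fun t : seq nat => i \in t)) => -[|p [|q [|r [|? ?]]]] //=;
        by rewrite !inE; case: (i == p); case: (i == q); case: (i == r).
    have := tm b; have := tm a; rewrite !inE !eqxx orbT => ta tb.
    by apply/hasP; exists 0%N => //; apply/andP.
  rewrite collinear_normal -(on_lineZ _ inj vP) //.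
  rewrite (two_lines (neq_pt inj a6 b6 ab) (neq_pt inj c6 d6 cd) xy) //; exact: on_l.
have Ug : uniq [seq g j | j <- iota 0 6].
  rewrite map_inj_in_uniq ?iota_uniq // => i j; rewrite !mem_iota => i6 j6 gij.
  have [ic io ir] := gP i i6; have [jc jo jr] := gP j j6.
  by apply: injf => //; rewrite -gij in jr; apply: rel_inj ir jr.
rewrite -size_filter -[6%N]/(size [seq g j | j <- iota 0 6]); apply: uniq_leq_size => // s.
by case/mapP => j; rewrite mem_iota => /gP[? ? _] ->; rewrite mem_filter; apply/andP.
Qed.

Lemma classification : triple_points (six P) #= `I_6 ->
  exists2 l, l \in perms6 &
    pattern K_synths K_triples (collinear v) (concurrent v) l || pattern Y_synths Y_triples (collinear v) (concurrent v) l.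
Proof.
move=> /count_codes c6.
have := good_of_clauses (s := table) erefl clauses_sat.
rewrite /good (eq_in_count code_ok_table) ifN -?leqNgt; last exact: c6.
have subK : {subset K_synths <= perms6}.
  by apply/allP; vm_cast_no_check (erefl true).
have subY : {subset Y_synths <= perms6}.
  by apply/allP; vm_cast_no_check (erefl true).
case/orP => /hasP[l lP].
  have lP6 := synthemes_perms6 lP.
  rewrite (pattern_table lP6 subK) => [p|t tK]; last by rewrite mem_cat tK.
  by exists l; rewrite // p.
have lP6 : l \in perms6.
  have /allP H : all (mem perms6) [seq t ++ [seq i <- iota 0 6 | i \notin t] | t <- triples].
    by vm_cast_no_check (erefl true).
  exact: H.
rewrite (pattern_table lP6 subY) => [p|t tY]; last by rewrite mem_cat tY orbT.
by exists l; rewrite // p orbT.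
Qed.

End Table.
End Classification.

(** * The two normal forms *)

Section Configurations.
Variable F : numFieldType.
Implicit Types (P Q : nat -> P2 F) (v w : nat -> 'rV[F]_3) (E : 'M[F]_3).

Lemma char0_neq0 n : (n.+1%:R : F) != 0. Proof. by rewrite pnatr_eq0. Qed.

(** [reps] speaks of all indices while coordinates are only given for the first six; the others are
    filled arbitrarily. *)
Lemma reps_extend w P : (forall i, (i < 6)%N -> represents (w i) (P i)) ->
  exists2 v, reps v P & forall i, (i < 6)%N -> v i = w i.
Proof.
move=> wP; have /choice[u uP] : forall i, exists u, represents u (P i) by move=> i; apply: rep_exists.
exists (fun i => if (i < 6)%N then w i else u i) => [i|i ->//].
by case: ifP => [/wP|_].
Qed.

Lemma collinear_config E w : E \in unitmx -> forall t, collinear (fun i => w i *m E) t = collinear w t.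
Proof.
rewrite unitmxE unitfE => detE [|i [|j [|k [|]]]] //=.
by rewrite brM_det mulf_eq0 (negPf detE) orbF.
Qed.

Lemma concM E (a b c d e f : 'rV[F]_3) :
  conc (a *m E) (b *m E) (c *m E) (d *m E) (e *m E) (f *m E) = conc a b c d e f * \det E ^+ 2.
Proof. by rewrite /conc !brM_det; ring. Qed.

Lemma concurrent_config E w : E \in unitmx -> forall s, concurrent (fun i => w i *m E) s = concurrent w s.
Proof.
rewrite unitmxE unitfE => detE [|a [|b [|c [|d [|e [|f [|]]]]]]] //=.
by rewrite concM mulf_eq0 sqrf_eq0 (negPf detE) orbF.
Qed.

Lemma collinear_eq v w t : (forall i, (i < 6)%N -> v i = w i) -> all (fun i => i < 6)%N t -> collinear v t = collinear w t.
Proof. by move=> vw; case: t => [|i [|j [|k [|]]]] //= /and4P[? ? ? _]; rewrite !vw. Qed.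

Lemma concurrent_eq v w s : (forall i, (i < 6)%N -> v i = w i) -> all (fun i => i < 6)%N s -> concurrent v s = concurrent w s.
Proof.
move=> vw; case: s => [|a [|b [|c [|d [|e [|f [|]]]]]]] //=.
by move=> /and5P[? ? ? ? /and3P[? ? _]]; rewrite !vw.
Qed.

Lemma nondeg_triples v : all (fun t => ~~ collinear v t) triples -> nondeg v.
Proof.
move=> /allP H i j k i6 j6 k6 ij ik jk.
by have := H _ (triple_normal_mem i6 j6 k6 ij ik jk); rewrite collinear_normal.
Qed.

Definition quad (q : F * F * F * F * F * F) (x : 'rV[F]_3) : F :=
  let: (q0, q1, q2, q01, q02, q12) := q in
  q0 * x 0 o0 ^+ 2 + q1 * x 0 o1 ^+ 2 + q2 * x 0 o2 ^+ 2
  + q01 * (x 0 o0 * x 0 o1) + q02 * (x 0 o0 * x 0 o2) + q12 * (x 0 o1 * x 0 o2).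

Definition mons2 : seq 'X_{1..3} :=
  [:: U_(o0) + U_(o0); U_(o1) + U_(o1); U_(o2) + U_(o2);
      U_(o0) + U_(o1); U_(o0) + U_(o2); U_(o1) + U_(o2)]%MM.

Lemma mem_mons2 (m : 'X_{1..3}) : mdeg m = 2%N -> m \in mons2.
Proof.
have E (m' : 'X_{1..3}) : m o0 = m' o0 -> m o1 = m' o1 -> m o2 = m' o2 -> m = m'.
  by move=> *; apply/mnmP; apply: forall_I3.
rewrite mdegE sum3; move: (E); case: (m o0) (m o1) (m o2) => [|[|[|x]]] [|[|[|y]]] [|[|[|z]]] //= H _.
all: rewrite !inE.
- by rewrite (H (U_(o2) + U_(o2))%MM) ?eqxx ?orbT // mnmDE !mnm1E.
- by rewrite (H (U_(o1) + U_(o2))%MM) ?eqxx ?orbT // mnmDE !mnm1E.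
- by rewrite (H (U_(o1) + U_(o1))%MM) ?eqxx ?orbT // mnmDE !mnm1E.
- by rewrite (H (U_(o0) + U_(o2))%MM) ?eqxx ?orbT // mnmDE !mnm1E.
- by rewrite (H (U_(o0) + U_(o1))%MM) ?eqxx ?orbT // mnmDE !mnm1E.
- by rewrite (H (U_(o0) + U_(o0))%MM) ?eqxx ?orbT // mnmDE !mnm1E.
Qed.

Lemma mons2_uniq : uniq mons2.
Proof.
have N (m m' : 'X_{1..3}) j : m j != m' j -> m != m' by apply: contra_neq => ->.
rewrite /= !inE !negb_or.
repeat (apply/andP; split=> //); first
 [ by apply: (N _ _ o0); rewrite !mnmDE !mnm1E
 | by apply: (N _ _ o1); rewrite !mnmDE !mnm1E
 | by apply: (N _ _ o2); rewrite !mnmDE !mnm1E ].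
Qed.

Lemma homog2_quad (q : {mpoly F[3]}) : q \is 2.-homog ->
  exists c, (forall x : 'rV[F]_3, q.@[x 0] = quad c x) /\ (c = (0, 0, 0, 0, 0, 0) -> q = 0).
Proof.
move=> /dhomogP hq.
have qE : q = \sum_(m <- mons2) q@_m *: 'X_[m].
  apply/mpolyP => m; rewrite raddf_sum /=.
  under eq_bigr do rewrite mcoeffZ mcoeffX.
  have [mL|mL] := boolP (m \in mons2).
    rewrite (bigD1_seq m) ?mons2_uniq //= eqxx mulr1 big1 ?addr0 // => i /negPf ->.
    by rewrite mulr0.
  rewrite big1_seq => [|i /= iL]; last first.
    by rewrite (_ : (i == m) = false) ?mulr0 //; apply: contraNF mL => /eqP <-.
  have [/hq mm|] := boolP (m \in msupp q); last exact: memN_msupp_eq0.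
  by case/negP: mL; apply: mem_mons2.
exists (q@_(U_(o0) + U_(o0))%MM, q@_(U_(o1) + U_(o1))%MM, q@_(U_(o2) + U_(o2))%MM,
        q@_(U_(o0) + U_(o1))%MM, q@_(U_(o0) + U_(o2))%MM, q@_(U_(o1) + U_(o2))%MM).
split=> [x|[E0 E1 E2 E3 E4 E5]].
  rewrite {1}qE raddf_sum /= !big_cons big_nil /= !mevalZ /quad.
  rewrite !mpolyXD !mevalM !mevalXU.
  move: q@_(U_(o0) + U_(o0))%MM q@_(U_(o1) + U_(o1))%MM q@_(U_(o2) + U_(o2))%MM.
  move: q@_(U_(o0) + U_(o1))%MM q@_(U_(o0) + U_(o2))%MM q@_(U_(o1) + U_(o2))%MM.
  move: (x 0 o0) (x 0 o1) (x 0 o2) => *; ring.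
by rewrite qE !big_cons big_nil E0 E1 E2 E3 E4 E5 !scale0r !addr0.
Qed.

Lemma quad_eq0 c : (forall x, quad c x = 0) -> c = (0, 0, 0, 0, 0, 0).
Proof.
move: c => [[[[[c0 c1] c2] c01] c02] c12] H.
have e0 : c0 = 0 by rewrite -[RHS](H (vec 1 0 0)) /quad !vecE; ring.
have e1 : c1 = 0 by rewrite -[RHS](H (vec 0 1 0)) /quad !vecE; ring.
have e2 : c2 = 0 by rewrite -[RHS](H (vec 0 0 1)) /quad !vecE; ring.
have e3 : c01 = 0 by rewrite -[RHS](H (vec 1 1 0)) /quad !vecE e0 e1; ring.
have e4 : c02 = 0 by rewrite -[RHS](H (vec 1 0 1)) /quad !vecE e0 e2; ring.
have e5 : c12 = 0 by rewrite -[RHS](H (vec 0 1 1)) /quad !vecE e1 e2; ring.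
by rewrite e0 e1 e2 e3 e4 e5.
Qed.

Lemma quad_change c E : exists c', forall x, quad c (x *m E) = quad c' x.
Proof.
move: c => [[[[[c0 c1] c2] c01] c02] c12]; set c := (c0, c1, c2, c01, c02, c12).
pose pol (u v : 'rV[F]_3) := quad c (u + v) - quad c u - quad c v.
exists (quad c (row o0 E), quad c (row o1 E), quad c (row o2 E),
  pol (row o0 E) (row o1 E), pol (row o0 E) (row o2 E), pol (row o1 E) (row o2 E)) => x.
by rewrite /pol /quad /c !mul_rV3 !mxE; ring.
Qed.

(** Conics correspond under a change of basis, so only the six coefficients of a quadratic form on
    the normal form have to be examined. *)
Lemma not_conic P w E : E \in unitmx -> (forall i, (i < 6)%N -> represents (w i *m E) (P i)) ->
  (forall c, (forall i, (i < 6)%N -> quad c (w i) = 0) -> c = (0, 0, 0, 0, 0, 0)) ->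
  ~ on_conic (six P).
Proof.
move=> uE wP wc [q [q0 /homog2_quad[c [qc c0]] qP]].
have [c' cc'] := quad_change c E.
have c'0 : c' = (0, 0, 0, 0, 0, 0).
  by apply: wc => i i6; rewrite -cc' -qc; apply: qP (wP i i6); exists i.
case/eqP: q0; apply: c0; apply: quad_eq0 => x.
by rewrite -[x](mulmxKV uE) cc' c'0 /quad !mul0r !addr0.
Qed.

Definition kpt (a b c : F) (i : nat) : 'rV[F]_3 :=
  nth (vec 0 1 a) [:: vec 0 1 a; vec 0 1 (- a); vec b 0 1; vec (- b) 0 1; vec 1 c 0; vec 1 (- c) 0] i.

(** The twelve brackets that contain a pair are nonzero monomials; the other eight are 1 + abc or 1
    - abc. *)
Lemma kpt_nondeg a b c : a != 0 -> b != 0 -> c != 0 -> (a * b * c) ^+ 2 != 1 ->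
  nondeg (kpt a b c).
Proof.
move=> a0 b0 c0 t1; have two := char0_neq0 1.
have [tp tm] : 1 + a * b * c != 0 /\ 1 - a * b * c != 0.
  apply/andP; rewrite -negb_or -mulf_eq0; apply: contra_neq t1 => E.
  by apply/eqP; rewrite eq_sym -subr_eq0 -[X in _ == X]E; apply/eqP; ring.
apply: nondeg_triples; rewrite /= !andbT /kpt /=.
have B (x y e : F) : x != 0 -> y != 0 -> (e = 2 * x * y \/ e = - (2 * x * y)) -> e != 0.
  by move=> x0 y0 [] ->; rewrite ?oppr_eq0 !mulf_neq0.
have T (x e : F) : x != 0 -> e = x -> e != 0 by move=> ? ->.
repeat (apply/andP; split).
- by apply: (B a b) => //; right; rewrite /br !vecE; ring.
- by apply: (B a b) => //; left; rewrite /br !vecE; ring.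
- by apply: (B a 1); rewrite ?oner_eq0 //; right; rewrite /br !vecE; ring.
- by apply: (B a 1); rewrite ?oner_eq0 //; right; rewrite /br !vecE; ring.
- by apply: (B b 1); rewrite ?oner_eq0 //; right; rewrite /br !vecE; ring.
- by apply: (T (1 + a * b * c)) => //; rewrite /br !vecE; ring.
- by apply: (T (1 - a * b * c)) => //; rewrite /br !vecE; ring.
- by apply: (T (1 - a * b * c)) => //; rewrite /br !vecE; ring.
- by apply: (T (1 + a * b * c)) => //; rewrite /br !vecE; ring.
- by apply: (B c a) => //; right; rewrite /br !vecE; ring.
- by apply: (B b 1); rewrite ?oner_eq0 //; right; rewrite /br !vecE; ring.
- by apply: (T (1 - a * b * c)) => //; rewrite /br !vecE; ring.
- by apply: (T (1 + a * b * c)) => //; rewrite /br !vecE; ring.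
- by apply: (T (1 + a * b * c)) => //; rewrite /br !vecE; ring.
- by apply: (T (1 - a * b * c)) => //; rewrite /br !vecE; ring.
- by apply: (B c a) => //; left; rewrite /br !vecE; ring.
- by apply: (B b c) => //; right; rewrite /br !vecE; ring.
- by apply: (B b c) => //; left; rewrite /br !vecE; ring.
- by apply: (B c 1); rewrite ?oner_eq0 //; right; rewrite /br !vecE; ring.
- by apply: (B c 1); rewrite ?oner_eq0 //; right; rewrite /br !vecE; ring.
Qed.

(** Up to sign the remaining nine polynomials are 8t for the pairing itself, and t^2 + 4t - 1 or t^2
    - 4t - 1 for the synthemes that share no pair with it. The product of the last two is (t^2 -
    1)^2 - 16 t^2. *)
Lemma kpt_conc a b c s : a != 0 -> b != 0 -> c != 0 ->
  ((a * b * c) ^+ 2 - 1) ^+ 2 != 16 * (a * b * c) ^+ 2 ->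
  s \in synthemes -> concurrent (kpt a b c) s ->
  exists2 j, (j < 6)%N & s = synth_normal (nth [::] K_synths j).
Proof.
set t := a * b * c => a0 b0 c0 tg.
have t0 : t != 0 by rewrite !mulf_neq0.
have tg' : (t ^+ 2 + 4 * t - 1) * (t ^+ 2 - 4 * t - 1) != 0.
  by rewrite -subr_eq0 in tg; apply: contra_neq tg => <-; ring.
have [tp tm] : t ^+ 2 + 4 * t - 1 != 0 /\ t ^+ 2 - 4 * t - 1 != 0.
  by move: tg'; rewrite mulf_eq0 negb_or => /andP[].
have T (x e : F) : x != 0 -> (e = x \/ e = - x) -> (e == 0) = false.
  by move=> x0 []->; rewrite ?oppr_eq0; apply: negPf.
have eight := char0_neq0 7.
rewrite /synthemes !inE => /or4P[|||/or4P[|||/or4P[|||/or4P[|||/or3P[]]]]] /eqP-> Cs;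
  try by [exists 0%N | exists 1%N | exists 2%N | exists 3%N | exists 4%N | exists 5%N].
all: exfalso; move: Cs; rewrite /concurrent /conc /kpt /=;
  first [ rewrite (T (t ^+ 2 + 4 * t - 1)) //; rewrite /t /br !vecE; by [left; ring | right; ring]
        | rewrite (T (t ^+ 2 - 4 * t - 1)) //; rewrite /t /br !vecE; by [left; ring | right; ring]
        | rewrite (T (8 * t)) ?mulf_neq0 //; rewrite /t /br !vecE; by [left; ring | right; ring] ].
Qed.

(** The two points of each pair differ by a sign, which kills the mixed coefficients. The squares
    then satisfy q1 = -a^2 q2, q2 = -b^2 q0, q0 = -c^2 q1, and going round once gives (t^2 + 1) q1 =
    0. *)
Lemma kpt_not_conic a b c P E : E \in unitmx -> a != 0 -> b != 0 -> c != 0 -> (a * b * c) ^+ 2 != -1 ->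
  (forall i, (i < 6)%N -> represents (kpt a b c i *m E) (P i)) -> ~ on_conic (six P).
Proof.
move=> uE a0 b0 c0 t1 kP; apply: (not_conic uE kP).
move=> [[[[[q0 q1] q2] q01] q02] q12] H; have two := char0_neq0 1.
have := (H 0 isT, H 1 isT, H 2 isT, H 3 isT, H 4 isT, H 5 isT)%N.
rewrite /kpt /quad /= !vecE => -[[[[[H0 H1] H2] H3] H4] H5].
have z12 : q12 = 0.
  apply: (mulfI (mulf_neq0 two a0)); rewrite mulr0 -[RHS](subrr 0) -[X in _ = X - _]H0 -[X in _ = _ - X]H1; ring.
have z02 : q02 = 0.
  apply: (mulfI (mulf_neq0 two b0)); rewrite mulr0 -[RHS](subrr 0) -[X in _ = X - _]H2 -[X in _ = _ - X]H3; ring.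
have z01 : q01 = 0.
  apply: (mulfI (mulf_neq0 two c0)); rewrite mulr0 -[RHS](subrr 0) -[X in _ = X - _]H4 -[X in _ = _ - X]H5; ring.
have z1 : q1 = - (a ^+ 2 * q2) by apply/eqP; rewrite -addr_eq0 -[X in _ == X]H0 z12; apply/eqP; ring.
have z2 : q2 = - (b ^+ 2 * q0) by apply/eqP; rewrite -addr_eq0 -[X in _ == X]H2 z02; apply/eqP; ring.
have z0 : q0 = - (c ^+ 2 * q1) by apply/eqP; rewrite -addr_eq0 -[X in _ == X]H4 z01; apply/eqP; ring.
have zz : q1 = 0.
  have n1 : (a * b * c) ^+ 2 + 1 != 0 by rewrite addr_eq0.
  apply: (mulfI n1); rewrite mulr0; apply/eqP; rewrite mulrDl mul1r addrC addr_eq0; apply/eqP.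
  by rewrite {1}z1 z2 z0; ring.
by rewrite z12 z02 z01 z0 z2 z0 zz !(mulr0, oppr0).
Qed.

End Configurations.

(** * Configurations of type K_4 *)

Section KTheory.
Variable F : numFieldType.
Implicit Types (P Q : nat -> P2 F) (v w : nat -> 'rV[F]_3) (E : 'M[F]_3) (a b c : F).

Definition krep E a b c P := forall i, (i < 6)%N -> represents (kpt a b c i *m E) (P i).

Lemma krep_reps E a b c P : krep E a b c P ->
  exists2 v, reps v P & forall i, (i < 6)%N -> v i = kpt a b c i *m E.
Proof. exact: reps_extend. Qed.

Lemma nondeg_config E v w : E \in unitmx -> nondeg w -> (forall i, (i < 6)%N -> v i = w i *m E) ->
  nondeg v.
Proof.
rewrite unitmxE unitfE => detE nd vE i j k i6 j6 k6 ij ik jk.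
by rewrite !vE // brM_det mulf_neq0 // nd.
Qed.

Lemma concZ (k0 k1 k2 k3 k4 k5 : F) (a b c d e f : 'rV[F]_3) :
  conc (k0 *: a) (k1 *: b) (k2 *: c) (k3 *: d) (k4 *: e) (k5 *: f) =
  k0 * k1 * k2 * k3 * k4 * k5 * conc a b c d e f.
Proof. by rewrite /conc !brZ; ring. Qed.

Lemma conc_config_eq0 E (k0 k1 k2 k3 k4 k5 : F) (a b c d e f : 'rV[F]_3) : E \in unitmx ->
  conc (k0 *: (a *m E)) (k1 *: (b *m E)) (k2 *: (c *m E)) (k3 *: (d *m E))
       (k4 *: (e *m E)) (k5 *: (f *m E)) = 0 ->
  k0 != 0 -> k1 != 0 -> k2 != 0 -> k3 != 0 -> k4 != 0 -> k5 != 0 -> conc a b c d e f = 0.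
Proof.
rewrite unitmxE unitfE => detE /eqP; rewrite concZ concM => H k00 k10 k20 k30 k40 k50.
move: H; rewrite !mulf_eq0 (negPf detE) (negPf k00) (negPf k10) (negPf k20).
by rewrite (negPf k30) (negPf k40) (negPf k50) !orbF => /eqP.
Qed.

Section Generic.
Variables (E : 'M[F]_3) (a b c : F) (P : nat -> P2 F).
Hypotheses (uE : E \in unitmx) (a0 : a != 0) (b0 : b != 0) (c0 : c != 0).
Hypotheses (t1 : (a * b * c) ^+ 2 != 1) (kP : krep E a b c P).

Lemma krep_inj : inj_below 6 P.
Proof.
have [v vP vE] := krep_reps kP.
exact: nondeg_inj vP (nondeg_config uE (kpt_nondeg a0 b0 c0 t1) vE).
Qed.

Lemma krep_on Q a' b' c' i j k : krep E a' b' c' Q -> (i < 6)%N -> (j < 6)%N -> (k < 6)%N ->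
  i != j -> on (Q k) (line (P i) (P j)) = (br (kpt a b c i) (kpt a b c j) (kpt a' b' c' k) == 0).
Proof.
move=> kQ i6 j6 k6 ij.
rewrite (on_lineE (kP i6) (kP j6) (kQ k k6)); last exact: (neq_pt krep_inj).
by rewrite brM_det mulf_eq0; move: uE; rewrite unitmxE unitfE => /negPf ->; rewrite orbF.
Qed.

Lemma krep_rel Q j : krep E (b * c)^-1 (c * a)^-1 (a * b)^-1 Q -> (j < 6)%N ->
  nth [::] K_synths j \in perms6 /\ rel P (Q j) (nth [::] K_synths j).
Proof.
move=> kQ j6; split.
  have /allP H : all (mem perms6) K_synths by vm_cast_no_check (erefl true).
  by apply: H; apply: mem_nth.
case: j j6 => [|[|[|[|[|[|j]]]]]] // j6; split; rewrite (krep_on kQ) //; apply/eqP;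
  rewrite /br /kpt /= !vecE; field; by rewrite ?a0 ?b0 ?c0.
Qed.

Lemma krep_triple Q : krep E (b * c)^-1 (c * a)^-1 (a * b)^-1 Q -> inj_below 6 Q ->
  triple_points (six P) #= `I_6 -> triple_points (six P) = six Q.
Proof.
move=> kQ injQ; have [v vP vE] := krep_reps kP.
apply: (triple_points_eq vP (nondeg_config uE (kpt_nondeg a0 b0 c0 t1) vE) injQ
  (S := nth [::] K_synths)) => j; exact: krep_rel.
Qed.

Hypothesis tgold : ((a * b * c) ^+ 2 - 1) ^+ 2 != 16 * (a * b * c) ^+ 2.

Lemma krep_triple_exact Q : krep E (b * c)^-1 (c * a)^-1 (a * b)^-1 Q ->
  triple_points (six P) = six Q.
Proof.
move=> kQ; have [v vP vE] := krep_reps kP.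
apply: (triple_points_exact vP (nondeg_config uE (kpt_nondeg a0 b0 c0 t1) vE)
  (S := nth [::] K_synths)) => [j|s sP Cs]; first exact: krep_rel.
apply: (@kpt_conc F a b c s) => //; rewrite -(concurrent_config _ uE) -(concurrent_eq vE) //.
by apply/allP => i; apply: perms6_lt; apply: synthemes_perms6.
Qed.

End Generic.

Lemma inv_t a b c : a != 0 -> b != 0 -> c != 0 ->
  (b * c)^-1 * (c * a)^-1 * (a * b)^-1 = ((a * b * c) ^+ 2)^-1.
Proof. by move=> a0 b0 c0; field; rewrite a0 b0 c0. Qed.

(** The triple points have parameter 1/t^2, whose square differs from 1 exactly when t^2 is neither
    1 nor -1. *)
Lemma krep_inj' E a b c Q : E \in unitmx -> a != 0 -> b != 0 -> c != 0 ->
  (a * b * c) ^+ 2 != 1 -> (a * b * c) ^+ 2 != - 1 ->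
  krep E (b * c)^-1 (c * a)^-1 (a * b)^-1 Q -> inj_below 6 Q.
Proof.
move=> uE a0 b0 c0 t1 t2 kQ; apply: krep_inj kQ => //; rewrite ?invr_neq0 ?mulf_neq0 //.
by rewrite inv_t // exprVn invr_eq1 sqrf_eq1 negb_or t1.
Qed.

Lemma P2_pt (w : 'rV[F]_3) : w != 0 -> exists p : P2 F, represents w p.
Proof.
move=> w0; have dw : \dim <[w]>%VS == 1%N by rewrite dim_vline w0.
by exists (exist (fun V : {vspace 'rV[F]_3} => \dim V == 1%N) _ dw).
Qed.

Lemma kpt_neq0 a b c i : kpt a b c i != 0.
Proof.
have N (x : 'rV[F]_3) j : x 0 j = 1 -> x != 0.
  by move=> xj; apply/eqP => x0; have := oner_neq0 F; rewrite -xj x0 mxE eqxx.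
case: i => [|[|[|[|[|[|i]]]]]]; rewrite /kpt /= ?nth_nil; try by apply: (N _ o1); rewrite vecE.
- by apply: (N _ o2); rewrite vecE.
- by apply: (N _ o2); rewrite vecE.
- by apply: (N _ o0); rewrite vecE.
- by apply: (N _ o0); rewrite vecE.
Qed.

Lemma krep_exists E a b c : E \in unitmx -> exists P, krep E a b c P.
Proof.
move=> uE; have /choice[P kP] : forall i, exists p : P2 F, represents (kpt a b c i *m E) p.
  move=> i; apply: P2_pt; apply: contra_neq (kpt_neq0 a b c i) => E0.
  by rewrite -[LHS](mulmxK uE) E0 mul0mx.
by exists P => i _.
Qed.

Lemma krep_property E a b c P : E \in unitmx -> a != 0 -> b != 0 -> c != 0 ->
  (a * b * c) ^+ 2 != 1 -> (a * b * c) ^+ 2 != - 1 ->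
  ((a * b * c) ^+ 2 - 1) ^+ 2 != 16 * (a * b * c) ^+ 2 ->
  krep E a b c P -> propertyP (six P).
Proof.
move=> uE a0 b0 c0 t1 t2 t3 kP; split; last exact: kpt_not_conic kP.
  exact/card_of_enum/(krep_inj uE a0 b0 c0 t1 kP).
have [Q kQ] := krep_exists (b * c)^-1 (c * a)^-1 (a * b)^-1 uE.
rewrite (krep_triple_exact uE a0 b0 c0 t1 kP t3 kQ).
exact/card_of_enum/(krep_inj' uE a0 b0 c0 t1 t2 kQ).
Qed.

Definition dot (n v : 'rV[F]_3) := n 0 o0 * v 0 o0 + n 0 o1 * v 0 o1 + n 0 o2 * v 0 o2.

Lemma dot_cross (u v w : 'rV[F]_3) : dot (cross u v) w = br u v w.
Proof. by rewrite /dot /cross /br !vecE; ring. Qed.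

Lemma br_orth (n u v w : 'rV[F]_3) : n != 0 -> dot n u = 0 -> dot n v = 0 -> dot n w = 0 ->
  br u v w = 0.
Proof.
move=> n0 nu nv nw; have [//|D0] := eqVneq (br u v w) 0.
have E k : br u v w * n 0 k = cross v w 0 k * dot n u + cross w u 0 k * dot n v + cross u v 0 k * dot n w.
  by move: k; apply: forall_I3; rewrite /br /cross /dot !vecE; ring.
by case/eqP: n0; apply: rV3P; rewrite mxE; apply: (mulfI D0); rewrite E nu nv nw !mulr0 !addr0.
Qed.

Lemma br_cross (n1 n2 n3 : 'rV[F]_3) :
  br (cross n2 n3) (cross n3 n1) (cross n1 n2) = br n1 n2 n3 ^+ 2.
Proof. by rewrite /br /cross !vecE; ring. Qed.

Lemma br_three_lines (a b c d e f : 'rV[F]_3) :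
  br (cross a b) (cross c d) (cross e f) = conc a b c d e f.
Proof. by rewrite /conc /br /cross !vecE; ring. Qed.

Lemma dot_meet (n a b c d : 'rV[F]_3) : dot n (cross (cross a b) (cross c d)) = br n (cross a b) (cross c d).
Proof. by rewrite /dot /br /cross !vecE; ring. Qed.

(* The diagonal triangle of a quadrangle is nondegenerate away from characteristic 2. *)
Lemma br_diagonal (a b c d : 'rV[F]_3) :
  br (cross (cross a b) (cross c d)) (cross (cross a c) (cross b d)) (cross (cross a d) (cross b c))
  = - 2 * (br a b c * br a b d * br a c d * br b c d).
Proof.
have X (p q r s : 'rV[F]_3) : cross (cross p q) (cross r s) = br p r s *: q - br q r s *: p.
  by apply: rV3P; rewrite /br /cross !mxE /= ; ring.
have M x1 x2 x3 y1 y2 y3 : br (x1 *: b - y1 *: a) (x2 *: c - y2 *: a) (x3 *: d - y3 *: a) =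
    x1 * x2 * x3 * br b c d - x1 * x2 * y3 * br b c a
    - x1 * y2 * x3 * br b a d - y1 * x2 * x3 * br a c d.
  by rewrite /br !mxE; ring.
rewrite !X M (br_swap12 a b d) (br_swap12 b c d) (br_rot a b c) -(br_rot d b c).
by move: (br a b c) (br a b d) (br a c d) (br b c d) => *; ring.
Qed.

(** Expansion of [p] in the basis dual to the three sides; the first coordinate is absent because
    [p] lies on the side [cross p q]. *)
Lemma side_coord (p q n2 n3 : 'rV[F]_3) :
  br (cross p q) n2 n3 *: p =
  dot n2 p *: cross n3 (cross p q) + dot n3 p *: cross (cross p q) n2.
Proof. by apply: rV3P; rewrite /br /dot /cross !mxE /=; ring. Qed.

Lemma side_coord' (p q n2 n3 : 'rV[F]_3) :
  br (cross p q) n2 n3 *: q =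
  dot n2 q *: cross n3 (cross p q) + dot n3 q *: cross (cross p q) n2.
Proof. by apply: rV3P; rewrite /br /dot /cross !mxE /=; ring. Qed.

Definition rows3 (e1 e2 e3 : 'rV[F]_3) : 'M[F]_3 :=
  \matrix_(i, j) (nth 0 [:: e1; e2; e3] i) 0 j.

Lemma vec_rows3 x y z e1 e2 e3 : vec x y z *m rows3 e1 e2 e3 = x *: e1 + y *: e2 + z *: e3.
Proof. by apply/rowP => j; rewrite mul_rV3 !vecE !mxE. Qed.

Lemma det_rows3 e1 e2 e3 : \det (rows3 e1 e2 e3) = br e1 e2 e3.
Proof. by rewrite det_br /br !mxE. Qed.

Lemma K_normal_form v :
  (forall s, s \in K_synths -> concurrent v s) -> (forall t, t \in K_triples -> ~~ collinear v t) ->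
  exists E a b c, [/\ E \in unitmx, [/\ a != 0, b != 0 & c != 0] &
    forall i, (i < 6)%N -> exists2 k, k != 0 & v i = k *: (kpt a b c i *m E)].
Proof.
move=> Cv Zv.
pose n1 := cross (v 0%N) (v 1%N); pose n2 := cross (v 2%N) (v 3%N); pose n3 := cross (v 4%N) (v 5%N).
have c1 := eqP (Cv [:: 0; 1; 2; 4; 3; 5]%N isT).
have c1' := eqP (Cv [:: 0; 1; 2; 5; 3; 4]%N isT).
have c2 := eqP (Cv [:: 2; 3; 0; 4; 1; 5]%N isT).
have c2' := eqP (Cv [:: 2; 3; 0; 5; 1; 4]%N isT).
have c3 := eqP (Cv [:: 4; 5; 0; 2; 1; 3]%N isT).
have c3' := eqP (Cv [:: 4; 5; 0; 3; 1; 2]%N isT).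
have z012 := Zv [:: 0; 1; 2]%N isT; have z013 := Zv [:: 0; 1; 3]%N isT.
have z014 := Zv [:: 0; 1; 4]%N isT; have z015 := Zv [:: 0; 1; 5]%N isT.
have z230 := Zv [:: 2; 3; 0]%N isT; have z231 := Zv [:: 2; 3; 1]%N isT.
have z234 := Zv [:: 2; 3; 4]%N isT; have z235 := Zv [:: 2; 3; 5]%N isT.
have z450 := Zv [:: 4; 5; 0]%N isT; have z451 := Zv [:: 4; 5; 1]%N isT.
have z452 := Zv [:: 4; 5; 2]%N isT; have z453 := Zv [:: 4; 5; 3]%N isT.
rewrite /= in c1 c1' c2 c2' c3 c3' z012 z013 z014 z015 z230 z231 z234 z235 z450 z451 z452 z453.
have D0 : br n1 n2 n3 != 0.
  apply/eqP => D0; have n10 : n1 != 0.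
    by apply: contraNneq z012 => n10; rewrite -dot_cross -/n1 n10 /dot !mxE !mul0r !addr0.
  have := br_diagonal (v 2%N) (v 3%N) (v 4%N) (v 5%N); rewrite (br_orth n10).
  - move=> /esym/eqP; rewrite !mulf_eq0 oppr_eq0 pnatr_eq0 (negPf z234) (negPf z235) /=.
    by rewrite -(br_rot (v 2%N)) (negPf z452) -(br_rot (v 3%N)) (negPf z453).
  - by rewrite dot_meet.
  - by rewrite dot_meet br_three_lines.
  - by rewrite dot_meet br_three_lines.
pose e1 := cross n2 n3; pose e2 := cross n3 n1; pose e3 := cross n1 n2.
pose E := rows3 e1 e2 e3.
have uE : E \in unitmx by rewrite unitmxE unitfE det_rows3 br_cross expf_neq0.
set D := br n1 n2 n3 in D0.
have L (u x f1 f2 : 'rV[F]_3) (p q : F) : p != 0 -> D *: u = p *: f1 + q *: f2 ->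
    u = (p / D) *: (f1 + (q / p) *: f2).
  move=> p0 uD; rewrite scalerDr scalerA (_ : p / D * (q / p) = D^-1 * q); last by field; rewrite p0 D0.
  by rewrite [p / D]mulrC -!scalerA -scalerDr -uD scalerA mulVf // scale1r.
pose al i := br (v 4%N) (v 5%N) (v i) / br (v 2%N) (v 3%N) (v i).
pose be i := br (v 0%N) (v 1%N) (v i) / br (v 4%N) (v 5%N) (v i).
pose ga i := br (v 2%N) (v 3%N) (v i) / br (v 0%N) (v 1%N) (v i).
have D2 : br n2 n3 n1 = D by rewrite br_rot.
have D3 : br n3 n1 n2 = D by rewrite br_rot.
have w0 : v 0%N = (br (v 2%N) (v 3%N) (v 0%N) / D) *: (vec 0 1 (al 0%N) *m E).
  rewrite vec_rows3 scale0r add0r scale1r; apply: L => //.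
  by rewrite -!dot_cross; apply: side_coord.
have w1 : v 1%N = (br (v 2%N) (v 3%N) (v 1%N) / D) *: (vec 0 1 (al 1%N) *m E).
  rewrite vec_rows3 scale0r add0r scale1r; apply: L => //.
  by rewrite -!dot_cross; apply: side_coord'.
have w2 : v 2%N = (br (v 4%N) (v 5%N) (v 2%N) / D) *: (vec (be 2%N) 0 1 *m E).
  rewrite vec_rows3 scale0r addr0 scale1r addrC; apply: L => //.
  by rewrite -!dot_cross -D2; apply: side_coord.
have w3 : v 3%N = (br (v 4%N) (v 5%N) (v 3%N) / D) *: (vec (be 3%N) 0 1 *m E).
  rewrite vec_rows3 scale0r addr0 scale1r addrC; apply: L => //.
  by rewrite -!dot_cross -D2; apply: side_coord'.
have w4 : v 4%N = (br (v 0%N) (v 1%N) (v 4%N) / D) *: (vec 1 (ga 4%N) 0 *m E).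
  rewrite vec_rows3 scale0r addr0 scale1r; apply: L => //.
  by rewrite -!dot_cross -D3; apply: side_coord.
have w5 : v 5%N = (br (v 0%N) (v 1%N) (v 5%N) / D) *: (vec 1 (ga 5%N) 0 *m E).
  rewrite vec_rows3 scale0r addr0 scale1r; apply: L => //.
  by rewrite -!dot_cross -D3; apply: side_coord'.
have nz x : x != 0 -> x / D != 0 by move=> x0; rewrite mulf_neq0 ?invr_eq0.
have [[a00 a10] [b20 b30] [g40 g50]] :
    [/\ al 0%N != 0 /\ al 1%N != 0, be 2%N != 0 /\ be 3%N != 0 & ga 4%N != 0 /\ ga 5%N != 0].
  by split; split; rewrite mulf_neq0 ?invr_eq0.
move: (nz _ z230) (nz _ z231) (nz _ z452) (nz _ z453) (nz _ z014) (nz _ z015) w0 w1 w2 w3 w4 w5.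
move: (_ / D) (_ / D) (_ / D) (_ / D) (_ / D) (_ / D) => k5 k4 k3 k2 k1 k0 k00 k10 k20 k30 k40 k50.
move: (al 0%N) (al 1%N) (be 2%N) (be 3%N) (ga 4%N) (ga 5%N) a00 a10 b20 b30 g40 g50.
move=> a a' b b' c c' a0 a0' b0 b0' c0 c0' w0 w1 w2 w3 w4 w5.
have nz2 (x y : F) : x != y -> forall z, (x - y) * z = 0 -> z = 0.
  by rewrite -subr_eq0 => xy z /eqP; rewrite mulf_eq0 (negPf xy) => /eqP.
have aa' : a != a'.
  by apply: contraNneq z012 => aa'; rewrite w0 w1 w2 brZ brM_det aa' bruu mul0r mulr0.
have bb' : b != b'.
  by apply: contraNneq z230 => bb'; rewrite w0 w2 w3 brZ brM_det bb' bruu mul0r mulr0.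
have cc' : c != c'.
  by apply: contraNneq z450 => cc'; rewrite w0 w4 w5 brZ brM_det cc' bruu mul0r mulr0.
rewrite w0 w1 w2 w3 w4 w5 in c1 c1' c2 c2'.
(* Each concurrency polynomial factors through the difference of the two ratios on one side, which
   is nonzero because the points of a pair are distinct. *)
have r1 : b * c - b' * c' = 0.
  by apply: (nz2 _ _ aa'); rewrite -[RHS](conc_config_eq0 uE c1) // /conc /br !vecE; ring.
have r2 : b * c' - b' * c = 0.
  by apply: (nz2 _ _ aa'); rewrite -[RHS](conc_config_eq0 uE c1') // /conc /br !vecE; ring.
have r3 : a * c - a' * c' = 0.
  by apply: (nz2 _ _ bb'); rewrite -[RHS](conc_config_eq0 uE c2) // /conc /br !vecE; ring.
have r4 : a * c' - a' * c = 0.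
  by apply: (nz2 _ _ bb'); rewrite -[RHS](conc_config_eq0 uE c2') // /conc /br !vecE; ring.
(* The two relations give x^2 = x'^2 after multiplication by y y', and x differs from x'. *)
have opp (x x' y y' : F) : x != x' -> y != 0 -> y' != 0 ->
    x * y - x' * y' = 0 -> x * y' - x' * y = 0 -> x' = - x.
  move=> xx y0 y0' e1' e2'; apply/eqP; rewrite -addr_eq0.
  rewrite (nz2 _ _ xx (x' + x)) //; apply: (mulfI (mulf_neq0 y0 y0')).
  transitivity (x * y' * (x * y - x' * y') + x' * y' * (x * y' - x' * y)); first by ring.
  by rewrite e1' e2' !mulr0 addr0.
have Ea := opp _ _ _ _ aa' c0 c0' r3 r4.
have Eb := opp _ _ _ _ bb' c0 c0' r1 r2.
have Ec : c' = - c.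
  apply: (opp _ _ _ _ cc' b0 b0'); first by rewrite -[RHS]r1; ring.
  by rewrite -[RHS]oppr0 -r2; ring.
exists E, a, b, c; split=> // i; case: i => [|[|[|[|[|[|i]]]]]] // _; rewrite /kpt /=.
- by exists k0 => //; rewrite w0.
- by exists k1 => //; rewrite w1 Ea.
- by exists k2 => //; rewrite w2.
- by exists k3 => //; rewrite w3 Eb.
- by exists k4 => //; rewrite w4.
- by exists k5 => //; rewrite w5 Ec.
Qed.

End KTheory.

(** * Configurations of type K_3 + K_3 *)

Section YTheory.
Variable F : numFieldType.
Implicit Types (P Q : nat -> P2 F) (v : nat -> 'rV[F]_3) (E : 'M[F]_3).

Section Omega.
Variable w : F.
Hypothesis hw : w ^+ 2 + w + 1 = 0.

(** The reference triangle together with the rows of the Fourier matrix of order 3: [w] is a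
    primitive cube root of unity and [- 1 - w] is its square. *)
Definition ypt (i : nat) : 'rV[F]_3 :=
  nth (vec 1 0 0) [:: vec 1 0 0; vec 0 1 0; vec 0 0 1; vec 1 1 1;
    vec 1 w (- 1 - w); vec 1 (- 1 - w) w] i.

(* The norm of p + q w over the rationals. *)
Lemma omega_neq0 (p q : int) : p ^+ 2 - p * q + q ^+ 2 != 0 -> p%:~R + q%:~R * w != 0.
Proof.
move=> n0; have : (p ^+ 2 - p * q + q ^+ 2)%:~R != 0 :> F by rewrite intr_eq0.
apply: contraNneq => e0.
have -> : (p ^+ 2 - p * q + q ^+ 2)%:~R =
    (p%:~R + q%:~R * w) * (p%:~R - q%:~R - q%:~R * w) + q%:~R ^+ 2 * (w ^+ 2 + w + 1).
  by rewrite !rmorphD !rmorphN !rmorphM ?rmorphXn /=; ring.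
by rewrite e0 hw mul0r mulr0 addr0.
Qed.

Lemma ypt_nondeg : nondeg ypt.
Proof.
have w0 : w != 0 by have := @omega_neq0 0 1 isT; rewrite mul1r add0r.
have w1 : 1 + w != 0 by have := @omega_neq0 1 1 isT; rewrite mul1r.
have w2 : 1 + 2 * w != 0 := @omega_neq0 1 2 isT.
have w3 : 2 + w != 0 by have := @omega_neq0 2 1 isT; rewrite mul1r.
have w4 : 1 - w != 0 by have := @omega_neq0 1 (-1) isT; rewrite mulN1r.
have w5 : 3 * (1 + 2 * w) != 0 by rewrite mulf_neq0 // (char0_neq0 _ 2).
have o1 := oner_neq0 F.
have T (x e : F) : x != 0 -> (e = x \/ e = - x) -> e != 0.
  by move=> x0 []->; rewrite ?oppr_eq0.
apply: nondeg_triples; rewrite /= !andbT /ypt /=.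
repeat (apply/andP; split).
- by apply: (T 1) => //; left; rewrite /br !vecE; ring.
- by apply: (T 1) => //; left; rewrite /br !vecE; ring.
- by apply: (T (1 + w)) => //; right; rewrite /br !vecE; ring.
- by apply: (T w) => //; left; rewrite /br !vecE; ring.
- by apply: (T 1) => //; right; rewrite /br !vecE; ring.
- by apply: (T w) => //; right; rewrite /br !vecE; ring.
- by apply: (T (1 + w)) => //; left; rewrite /br !vecE; ring.
- by apply: (T (1 + 2 * w)) => //; right; rewrite /br !vecE; ring.
- by apply: (T (1 + 2 * w)) => //; left; rewrite /br !vecE; ring.
- by apply: (T (1 + 2 * w)) => //; right; rewrite /br !vecE; ring.
- by apply: (T 1) => //; left; rewrite /br !vecE; ring.
- by apply: (T 1) => //; left; rewrite /br !vecE; ring.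
- by apply: (T 1) => //; left; rewrite /br !vecE; ring.
- by apply: (T (2 + w)) => //; left; rewrite /br !vecE; ring.
- by apply: (T (1 - w)) => //; left; rewrite /br !vecE; ring.
- by apply: (T (1 + 2 * w)) => //; right; rewrite /br !vecE; ring.
- by apply: (T (1 - w)) => //; right; rewrite /br !vecE; ring.
- by apply: (T (2 + w)) => //; right; rewrite /br !vecE; ring.
- by apply: (T (1 + 2 * w)) => //; right; rewrite /br !vecE; ring.
- by apply: (T (3 * (1 + 2 * w))) => //; right; rewrite /br !vecE; ring.
Qed.

Lemma ypt_conc s : s \in synthemes -> concurrent ypt s ->
  exists2 j, (j < 6)%N & s = synth_normal (nth [::] Y_synths j).
Proof.
have w2 : 2 + 4 * w != 0 := @omega_neq0 2 4 isT.
(* The identities only hold modulo w^2 + w + 1; [f] is the quotient that turns them into polynomial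
   identities. *)
have T (e f : F) : (e = 2 + 4 * w + f * (w ^+ 2 + w + 1) \/ e = - (2 + 4 * w) + f * (w ^+ 2 + w + 1)) ->
    (e == 0) = false.
  by move=> []->; rewrite hw mulr0 addr0 ?oppr_eq0; apply: negPf.
rewrite /synthemes !inE => /or4P[|||/or4P[|||/or4P[|||/or4P[|||/or3P[]]]]] /eqP-> Cs;
  try by [exists 0%N | exists 1%N | exists 2%N | exists 3%N | exists 4%N | exists 5%N].
all: exfalso; move: Cs; rewrite /concurrent /conc /ypt /=;
  first [ rewrite (@T _ 0) //; rewrite /br !vecE; by [left; ring | right; ring]
        | rewrite (@T _ 1) //; rewrite /br !vecE; by [left; ring | right; ring] ].
Qed.

Lemma ypt_not_conic E P : E \in unitmx ->
  (forall i, (i < 6)%N -> represents (ypt i *m E) (P i)) -> ~ on_conic (six P).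
Proof.
move=> uE yP; apply: (not_conic uE yP).
move=> [[[[[q0 q1] q2] q01] q02] q12] H.
have := (H 0 isT, H 1 isT, H 2 isT, H 3 isT, H 4 isT, H 5 isT)%N.
rewrite /ypt /quad /= !vecE => -[[[[[H0 H1] H2] H3] H4] H5].
have z0 : q0 = 0 by rewrite -[RHS]H0; ring.
have z1 : q1 = 0 by rewrite -[RHS]H1; ring.
have z2 : q2 = 0 by rewrite -[RHS]H2; ring.
rewrite z0 z1 z2 in H3 H4 H5.
have w2 : 1 + 2 * w != 0 := @omega_neq0 1 2 isT.
have {}H3 : q01 + q02 + q12 = 0 by rewrite -[RHS]H3; ring.
have {}H4 : w * q01 + (- 1 - w) * q02 + w * (- 1 - w) * q12 = 0 by rewrite -[RHS]H4; ring.
have {}H5 : (- 1 - w) * q01 + w * q02 + w * (- 1 - w) * q12 = 0 by rewrite -[RHS]H5; ring.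
have z12 : q12 = 0.
  apply: (mulfI (char0_neq0 F 2)); rewrite mulr0.
  (* Orthogonality of the three characters: the sum of the conditions at the last three points
     isolates 3 q12, modulo w^2 + w + 1. *)
  transitivity (q01 + q02 + q12 + (w * q01 + (- 1 - w) * q02 + w * (- 1 - w) * q12)
     + ((- 1 - w) * q01 + w * q02 + w * (- 1 - w) * q12) + 2 * q12 * (w ^+ 2 + w + 1)).
    by ring.
  by rewrite hw H3 H4 H5 !(mulr0, addr0).
rewrite z12 !mulr0 !addr0 in H3 H4.
have z02 : q02 = - q01 by apply/eqP; rewrite -addr_eq0 addrC H3.
have z01 : q01 = 0.
  by apply: (mulfI w2); rewrite mulr0 -[RHS]H4 z02; ring.
by rewrite z0 z1 z2 z12 z02 z01 oppr0.
Qed.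

Definition yrep E P := forall i, (i < 6)%N -> represents (ypt i *m E) (P i).

(* The concurrency points of the synthemes in Y_synths. *)
Definition ypt' (i : nat) : 'rV[F]_3 :=
  nth (vec w 1 1) [:: vec w 1 1; vec (- 1 - w) 1 1; vec 1 (- 1 - w) 1;
    vec 1 1 w; vec 1 w 1; vec 1 1 (- 1 - w)] i.

Section Rep.
Variables (E : 'M[F]_3) (P Q : nat -> P2 F).
Hypotheses (uE : E \in unitmx) (yP : yrep E P).
Hypothesis yQ : forall i, (i < 6)%N -> represents (ypt' i *m E) (Q i).

Lemma yrep_nondeg : exists2 v, reps v P & nondeg v /\ forall i, (i < 6)%N -> v i = ypt i *m E.
Proof.
have [v vP vE] := reps_extend yP.
by exists v => //; split=> //; apply: nondeg_config uE ypt_nondeg vE.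
Qed.

Lemma yrep_rel j : (j < 6)%N ->
  nth [::] Y_synths j \in perms6 /\ rel P (Q j) (nth [::] Y_synths j).
Proof.
have [v vP [nd vE]] := yrep_nondeg; have injP := nondeg_inj vP nd.
have onE i k l : (i < 6)%N -> (k < 6)%N -> (l < 6)%N -> i != k ->
    on (Q l) (line (P i) (P k)) = (br (ypt i) (ypt k) (ypt' l) == 0).
  move=> i6 k6 l6 ik; rewrite (on_lineE (yP i6) (yP k6) (yQ l6)); last exact: (neq_pt injP).
  by rewrite brM_det mulf_eq0; move: uE; rewrite unitmxE unitfE => /negPf ->; rewrite orbF.
have Z0 (e f : F) : e = f * (w ^+ 2 + w + 1) -> e == 0 by move=> ->; rewrite hw mulr0.
move=> j6; split.
  have /allP H : all (mem perms6) Y_synths by vm_cast_no_check (erefl true).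
  by apply: H; apply: mem_nth.
by case: j j6 => [|[|[|[|[|[|j]]]]]] // j6; split; rewrite onE //; rewrite /br /ypt /ypt' /= !vecE;
  first [ by apply: (@Z0 _ 0); ring | by apply: (@Z0 _ 1); ring | by apply: (@Z0 _ (-1)); ring ].
Qed.

Lemma yrep_triple : triple_points (six P) = six Q.
Proof.
have [v vP [nd vE]] := yrep_nondeg.
apply: (triple_points_exact vP nd (S := nth [::] Y_synths)) => [j|s sP Cs]; first exact: yrep_rel.
apply: ypt_conc => //; rewrite -(concurrent_config _ uE) -(concurrent_eq vE) //.
by apply/allP => i; apply: perms6_lt; apply: synthemes_perms6.
Qed.

End Rep.

Lemma yrep_dual E Q : E \in unitmx ->
  (forall i, (i < 6)%N -> represents (ypt' i *m E) (Q i)) ->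
  exists2 E', E' \in unitmx & yrep E' (fun i => Q (nth 0%N [:: 0; 4; 3; 1; 5; 2]%N i)).
Proof.
move=> uE yQ; pose w2 := - 1 - w.
(* The rows are three triple points, forming the first triangle of the new configuration. The
   factors [w2] are chosen so that their sum represents a fourth triple point, the image of (1, 1,
   1). *)
pose B := rows3 (vec w 1 1) (w2 *: vec 1 w 1) (w2 *: vec 1 1 w).
have w2E : 1 + 2 * w != 0 := @omega_neq0 1 2 isT.
have w2n0 : w2 != 0.
  by have := @omega_neq0 (-1) (-1) isT; rewrite /w2 mulN1r.
have w1 : 1 - w != 0 by have := @omega_neq0 1 (-1) isT; rewrite mulN1r.
have Em (f x y : F) : x = y + f * (w ^+ 2 + w + 1) -> x = y by move=> ->; rewrite hw mulr0 addr0.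
have uB : B \in unitmx.
  rewrite unitmxE unitfE det_rows3.
  have -> : br (vec w 1 1) (w2 *: vec 1 w 1) (w2 *: vec 1 1 w) = 3 * (1 + 2 * w).
    by apply: (Em (- 1 - 4 * w + w ^+ 2 + w ^+ 3)); rewrite /br /w2 !mxE /=; ring.
  by rewrite mulf_neq0 // (char0_neq0 _ 2).
exists (B *m E); first by rewrite unitmx_mul uB.
have Rep k j i : k != 0 -> (j < 6)%N -> ypt i *m B = k *: ypt' j ->
    represents (ypt i *m (B *m E)) (Q j).
  by move=> k0 j6 e; rewrite mulmxA e -scalemxAl; apply: rep_scale => //; apply: yQ.
case=> [|[|[|[|[|[|i]]]]]] // _; rewrite [nth 0%N _ _]/=.
- by apply: (Rep 1); rewrite ?oner_neq0 // /ypt /ypt' /= /B vec_rows3 !scale0r !addr0.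
- by apply: (Rep w2) => //; rewrite /ypt /ypt' /= /B vec_rows3 !scale0r addr0 add0r scale1r.
- by apply: (Rep w2) => //; rewrite /ypt /ypt' /= /B vec_rows3 !scale0r add0r add0r scale1r.
- apply: (Rep (1 - w)) => //; rewrite /ypt /ypt' /= /B vec_rows3.
  by apply: rV3P; apply: (Em (-1)); rewrite /w2 !mxE /=; ring.
- apply: (Rep (1 + 2 * w)) => //; rewrite /ypt /ypt' /= /B vec_rows3.
  apply: rV3P; [apply: (Em 0)|apply: (Em (1 - w))|apply: (Em (2 + w))];
    by rewrite /w2 !mxE /=; ring.
- apply: (Rep (1 + 2 * w)) => //; rewrite /ypt /ypt' /= /B vec_rows3.
  apply: rV3P; [apply: (Em 0)|apply: (Em (2 + w))|apply: (Em (1 - w))];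
    by rewrite /w2 !mxE /=; ring.
Qed.

Lemma ypt'_neq0 i : ypt' i != 0.
Proof.
have N (x : 'rV[F]_3) j : x 0 j = 1 -> x != 0.
  by move=> xj; apply/eqP => x0; have := oner_neq0 F; rewrite -xj x0 mxE eqxx.
by case: i => [|[|[|[|[|[|i]]]]]]; rewrite /ypt' /= ?nth_nil;
  first [by apply: (N _ o1); rewrite vecE | by apply: (N _ o0); rewrite vecE].
Qed.

Lemma six_perm Q l : l \in perms6 -> six (fun i => Q (nth 0%N l i)) = six Q.
Proof.
move=> lP; have sz : size l = 6%N by move: lP; rewrite mem_perms6 => /perm_size ->.
apply/seteqP; split=> _ [i /= i6 <-].
  by exists (nth 0%N l i) => //; apply: (perms6_lt lP); rewrite mem_nth ?sz.
have il := perms6_mem lP i6; exists (index i l); first by rewrite /= -sz index_mem.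
by rewrite nth_index.
Qed.

Lemma yrep_dual_exists E P : E \in unitmx -> yrep E P ->
  exists E' P', [/\ E' \in unitmx, yrep E' P' & triple_points (six P) = six P'].
Proof.
move=> uE yP; have /choice[Q yQ] : forall i, exists p : P2 F, represents (ypt' i *m E) p.
  move=> i; apply: P2_pt; apply: contra_neq (ypt'_neq0 i) => E0.
  by rewrite -[LHS](mulmxK uE) E0 mul0mx.
have yQ6 i : (i < 6)%N -> represents (ypt' i *m E) (Q i) by move=> _; apply: yQ.
have [E' uE' yQ'] := yrep_dual uE yQ6.
exists E', (fun i => Q (nth 0%N [:: 0; 4; 3; 1; 5; 2]%N i)); split=> //.
by rewrite (yrep_triple uE yP yQ6) six_perm.
Qed.

Lemma yrep_card E P : E \in unitmx -> yrep E P -> six P #= `I_6.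
Proof.
by move=> uE yP; have [v vP [nd _]] := yrep_nondeg uE yP; apply/card_of_enum/(nondeg_inj vP nd).
Qed.

Lemma yrep_property E P : E \in unitmx -> yrep E P -> propertyP (six P).
Proof.
move=> uE yP; split; [exact: yrep_card yP| |exact: ypt_not_conic yP].
by have [E' [P' [uE' yP' ->]]] := yrep_dual_exists uE yP; apply: yrep_card yP'.
Qed.

Lemma yrep_dual_property E P : E \in unitmx -> yrep E P -> propertyP (triple_points (six P)).
Proof.
by move=> uE /(yrep_dual_exists uE)[E' [P' [uE' yP' ->]]]; apply: yrep_property yP'.
Qed.

End Omega.

(** With 0, 1, 2 as basis and 3 as unit point, write 4 = (1, p, q) and 5 = (1, r, s). Four
    concurrencies give r = q, s = p, p = q^2 and q = p^2, so p^3 = 1; p = 1 would identify the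
    points 3 and 4. *)
Lemma Y_normal_form v :
  (forall s, s \in Y_synths -> concurrent v s) -> (forall t, t \in Y_triples -> ~~ collinear v t) ->
  cross (v 3%N) (v 4%N) != 0 ->
  exists E w, [/\ E \in unitmx, w ^+ 2 + w + 1 = 0 &
    forall i, (i < 6)%N -> exists2 k, k != 0 & v i = k *: (ypt w i *m E)].
Proof.
move=> Cv Zv v34.
have D0 := Zv [:: 0; 1; 2]%N isT.
have z (i : nat) : (i \in [:: 3; 4; 5])%N -> [/\ br (v i) (v 1%N) (v 2%N) != 0,
    br (v 0%N) (v i) (v 2%N) != 0 & br (v 0%N) (v 1%N) (v i) != 0].
  move=> i3; split.
  - by rewrite -br_rot; apply: (Zv [:: 1; 2; i]%N); move: i3; rewrite !inE => /or3P[]/eqP->.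
  - by rewrite br_swap23 oppr_eq0; apply: (Zv [:: 0; 2; i]%N); move: i3; rewrite !inE => /or3P[]/eqP->.
  - by apply: (Zv [:: 0; 1; i]%N); move: i3; rewrite !inE => /or3P[]/eqP->.
rewrite /= in D0; set D := br (v 0%N) (v 1%N) (v 2%N) in D0.
have [x0 x1 x2] := z 3 isT; have [y0 y1 y2] := z 4 isT; have [u0 u1 u2] := z 5 isT.
pose e1 := (br (v 3%N) (v 1%N) (v 2%N) / D) *: v 0%N.
pose e2 := (br (v 0%N) (v 3%N) (v 2%N) / D) *: v 1%N.
pose e3 := (br (v 0%N) (v 1%N) (v 3%N) / D) *: v 2%N.
pose E := rows3 e1 e2 e3.
have uE : E \in unitmx.
  by rewrite unitmxE unitfE det_rows3 brZ !mulf_neq0 ?invr_eq0.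
pose X i := br (v i) (v 1%N) (v 2%N) / br (v 3%N) (v 1%N) (v 2%N).
pose Y i := br (v 0%N) (v i) (v 2%N) / br (v 0%N) (v 3%N) (v 2%N) / X i.
pose W i := br (v 0%N) (v 1%N) (v i) / br (v 0%N) (v 1%N) (v 3%N) / X i.
have vE i : br (v i) (v 1%N) (v 2%N) != 0 -> v i = X i *: (vec 1 (Y i) (W i) *m E).
  move=> xi; have Xi : X i != 0 by rewrite mulf_neq0 ?invr_eq0.
  rewrite vec_rows3 !scalerDr !scalerA.
  rewrite (_ : X i * 1 * _ = br (v i) (v 1%N) (v 2%N) / D); last by rewrite /X; field; rewrite D0 x0.
  rewrite (_ : X i * Y i * _ = br (v 0%N) (v i) (v 2%N) / D); last by rewrite /Y; field; rewrite Xi D0 x1.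
  rewrite (_ : X i * W i * _ = br (v 0%N) (v 1%N) (v i) / D); last by rewrite /W; field; rewrite Xi D0 x2.
  apply: (scalerI D0); rewrite !scalerDr !scalerA ![D * (_ / D)]mulrC !divfK //.
  by apply: rV3P; rewrite /D /br !mxE; ring.
have v0E : v 0%N = (D / br (v 3%N) (v 1%N) (v 2%N)) *: (vec 1 0 0 *m E).
  rewrite vec_rows3 scale1r !scale0r !addr0 scalerA mulrA divfK // divff // scale1r //.
have v1E : v 1%N = (D / br (v 0%N) (v 3%N) (v 2%N)) *: (vec 0 1 0 *m E).
  rewrite vec_rows3 scale1r !scale0r addr0 add0r scalerA mulrA divfK // divff // scale1r //.
have v2E : v 2%N = (D / br (v 0%N) (v 1%N) (v 3%N)) *: (vec 0 0 1 *m E).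
  rewrite vec_rows3 scale1r !scale0r !add0r scalerA mulrA divfK // divff // scale1r //.
have [v3E v4E v5E] := And3 (vE _ x0) (vE _ y0) (vE _ u0).
have k0 : D / br (v 3%N) (v 1%N) (v 2%N) != 0 by rewrite mulf_neq0 ?invr_eq0.
have k1 : D / br (v 0%N) (v 3%N) (v 2%N) != 0 by rewrite mulf_neq0 ?invr_eq0.
have k2 : D / br (v 0%N) (v 1%N) (v 3%N) != 0 by rewrite mulf_neq0 ?invr_eq0.
have k3 : X 3%N != 0 by rewrite mulf_neq0 ?invr_eq0.
have k4 : X 4%N != 0 by rewrite mulf_neq0 ?invr_eq0.
have k5 : X 5%N != 0 by rewrite mulf_neq0 ?invr_eq0.
have Y3 : Y 3%N = 1 by rewrite /Y /X divff // divff // divr1.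
have W3 : W 3%N = 1 by rewrite /W /X divff // divff // divr1.
have p0 : Y 4%N != 0 by rewrite !mulf_neq0 ?invr_eq0.
rewrite Y3 W3 in v3E.
have c1 := eqP (Cv [:: 0; 3; 1; 4; 2; 5]%N isT).
have c2 := eqP (Cv [:: 0; 3; 1; 5; 2; 4]%N isT).
have c3 := eqP (Cv [:: 0; 4; 1; 3; 2; 5]%N isT).
have c4 := eqP (Cv [:: 0; 4; 1; 5; 2; 3]%N isT).
rewrite /= in c1 c2 c3 c4.
move: (X 3%N) (X 4%N) (X 5%N) (Y 4%N) (W 4%N) (Y 5%N) (W 5%N) k3 k4 k5 p0 v3E v4E v5E
  => l3 l4 l5 p q r s k3 k4 k5 p0 v3E v4E v5E.
move: (D / _) (D / _) (D / _) k0 k1 k2 v0E v1E v2E => l2 l1 l0 k0 k1 k2 v0E v1E v2E.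
rewrite v0E v1E v2E v3E v4E v5E in c1 c2 c3 c4.
have qr : r = q.
  by apply/eqP; rewrite eq_sym -subr_eq0; apply/eqP; rewrite -[RHS](conc_config_eq0 uE c1) // /conc /br !vecE; ring.
have sp : s = p.
  by apply/eqP; rewrite -subr_eq0; apply/eqP; rewrite -[RHS](conc_config_eq0 uE c2) // /conc /br !vecE; ring.
have pq : p = q * r.
  by apply/eqP; rewrite -subr_eq0; apply/eqP; rewrite -[RHS](conc_config_eq0 uE c3) // /conc /br !vecE; ring.
have psq : p * s = q.
  by apply/eqP; rewrite -subr_eq0; apply/eqP; rewrite -[RHS](conc_config_eq0 uE c4) // /conc /br !vecE; ring.
rewrite qr in pq; rewrite sp in psq.
have hp : p ^+ 2 + p + 1 = 0.
  have : p * ((p - 1) * (p ^+ 2 + p + 1)) = 0.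
    by transitivity ((p * p) * (p * p) - p); [ring | rewrite psq -pq subrr].
  move/eqP; rewrite !mulf_eq0 (negPf p0) subr_eq0 /= => /orP[/eqP p1|/eqP //].
  case/eqP: v34; rewrite v3E v4E p1 -psq p1 mulr1.
  by apply: rV3P; rewrite /cross !vecE !mxE; ring.
have qE : q = - 1 - p by rewrite -psq -[RHS]addr0 -hp; ring.
exists E, p; split=> // i; case: i => [|[|[|[|[|[|i]]]]]] // _; rewrite /ypt /=.
- by exists l0 => //; rewrite v0E.
- by exists l1 => //; rewrite v1E.
- by exists l2 => //; rewrite v2E.
- by exists l3 => //; rewrite v3E.
- by exists l4 => //; rewrite v4E qE.
- by exists l5 => //; rewrite v5E qr sp qE.
Qed.

End YTheory.

(** * Recovering parameters and triangle from the set of points *)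

Lemma enum_inj (T : eqType) (f : nat -> T) n : (0 < n)%N -> f @` `I_n #= `I_n -> inj_below n f.
Proof.
move=> n0 /(card_enum n0)[g injg fg].
have U : uniq [seq f i | i <- iota 0 n].
  apply: (leq_size_uniq (enum_uniq injg)) => [x|]; last by rewrite !size_map.
  by move=> /enum_seq; rewrite -fg => /enum_seq.
have sz : size [seq f i | i <- iota 0 n] = n by rewrite size_map size_iota.
have nthf i : (i < n)%N -> nth (f 0%N) [seq f i | i <- iota 0 n] i = f i.
  by move=> lt; rewrite (nth_map 0%N) ?size_iota // nth_iota.
move=> i j lti ltj fij; apply/eqP.
by rewrite -(nth_uniq (f 0%N) _ _ U) ?sz // !nthf // fij.
Qed.

(** The twelve pairs of labels on different sides each occur in exactly one syntheme of [K_synths],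
    so a pair occurring in two of them is a side. *)
Lemma same_side i j k l m m' : (i < 6)%N -> (j < 6)%N -> (k < 6)%N -> (l < 6)%N ->
  (m < 3)%N -> (m' < 3)%N -> i != j -> k != l ->
  {subset [:: i; j] <= [:: nth 0%N (nth [::] K_synths k) m.*2; nth 0%N (nth [::] K_synths k) m.*2.+1]} ->
  {subset [:: i; j] <= [:: nth 0%N (nth [::] K_synths l) m'.*2; nth 0%N (nth [::] K_synths l) m'.*2.+1]} ->
  i./2 = j./2.
Proof.
pose sub i j k m := all (fun h => h \in
  [:: nth 0%N (nth [::] K_synths k) m.*2; nth 0%N (nth [::] K_synths k) m.*2.+1]) [:: i; j].
have /allP H : all (fun i => all (fun j => all (fun k => all (fun l => all (fun m => all (fun m' =>
    [&& i != j, k != l, sub i j k m & sub i j l m'] ==> (i./2 == j./2))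
    (iota 0 3)) (iota 0 3)) (iota 0 6)) (iota 0 6)) (iota 0 6)) (iota 0 6).
  by vm_cast_no_check (erefl true).
have io a n : (a < n)%N -> a \in iota 0 n by rewrite mem_iota.
move=> i6 j6 k6 l6 m3 m3' ij kl /allP s1 /allP s2.
have /allP Hi := H i (io _ _ i6); have /allP Hj := Hi j (io _ _ j6).
have /allP Hk := Hj k (io _ _ k6); have /allP Hl := Hk l (io _ _ l6).
have /allP Hm := Hl m (io _ _ m3); have := Hm m' (io _ _ m3').
by rewrite ij kl /sub s1 s2 => /eqP.
Qed.

Section Uniqueness.
Variable F : numFieldType.
Implicit Types (P Q : nat -> P2 F) (u v : nat -> 'rV[F]_3) (E M : 'M[F]_3) (a b c : F).

Lemma sel_Z v l t : collinear v (sel l t) = collinear (fun i => v (nth 0%N l i)) t.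
Proof. by case: t => [|i [|j [|k [|]]]]. Qed.

Lemma sel_C v l s : concurrent v (sel l s) = concurrent (fun i => v (nth 0%N l i)) s.
Proof. by case: s => [|a [|b [|c [|d [|e [|f [|]]]]]]]. Qed.

Lemma pattern_normal_form v l : l \in perms6 ->
  (forall i j, (i < 6)%N -> (j < 6)%N -> i != j -> cross (v i) (v j) != 0) ->
  pattern K_synths K_triples (collinear v) (concurrent v) l || pattern Y_synths Y_triples (collinear v) (concurrent v) l ->
  (exists E a b c, [/\ E \in unitmx, [/\ a != 0, b != 0 & c != 0] &
    forall i, (i < 6)%N -> exists2 k, k != 0 & v (nth 0%N l i) = k *: (kpt a b c i *m E)]) \/
  (exists E w, [/\ E \in unitmx, w ^+ 2 + w + 1 = 0 &
    forall i, (i < 6)%N -> exists2 k, k != 0 & v (nth 0%N l i) = k *: (ypt w i *m E)]).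
Proof.
move=> lP cr /orP[]/andP[/allP Cs /hasPn Zs]; [left|right].
  apply: (@K_normal_form F (fun i => v (nth 0%N l i))) => [s /Cs|t /Zs].
    by rewrite sel_C.
  by rewrite sel_Z.
have sz : size l = 6%N by move: lP; rewrite mem_perms6 => /perm_size ->.
apply: (@Y_normal_form F (fun i => v (nth 0%N l i))) => [s /Cs|t /Zs|].
- by rewrite sel_C.
- by rewrite sel_Z.
by apply: cr; rewrite ?nth_uniq ?sz ?(perms6_uniqP lP) // (perms6_lt lP) // mem_nth ?sz.
Qed.

(** Changing the sign of a parameter exchanges the two points of a side. The set of points thus
    depends only on a^2, b^2, c^2, and these equations describe it without choosing signs. *)
Lemma kpt_complete a b c (y : 'rV[F]_3) : y != 0 ->
  [\/ y 0 o0 = 0 /\ y 0 o2 ^+ 2 = a ^+ 2 * y 0 o1 ^+ 2,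
      y 0 o1 = 0 /\ y 0 o0 ^+ 2 = b ^+ 2 * y 0 o2 ^+ 2
    | y 0 o2 = 0 /\ y 0 o1 ^+ 2 = c ^+ 2 * y 0 o0 ^+ 2] ->
  exists2 j, (j < 6)%N & exists2 k, k != 0 & y = k *: kpt a b c j.
Proof.
have S (p q r : F) : p ^+ 2 = q ^+ 2 * r ^+ 2 -> p = q * r \/ p = - (q * r).
  by move/eqP; rewrite -exprMn eqf_sqr => /orP[]/eqP->; [left|right].
move=> y0 [] [yz /S yS].
- have r0 : y 0 o1 != 0.
    apply: contra_neq y0 => r0; apply: rV3P; rewrite !mxE // .
    by case: yS => ->; rewrite r0 mulr0 ?oppr0.
  case: yS => yE; [exists 0%N => //|exists 1%N => //]; exists (y 0 o1) => //;
    by apply: rV3P; rewrite mxE /kpt /= vecE ?yE ?yz; ring.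
- have r0 : y 0 o2 != 0.
    apply: contra_neq y0 => r0; apply: rV3P; rewrite !mxE // .
    by case: yS => ->; rewrite r0 mulr0 ?oppr0.
  case: yS => yE; [exists 2%N => //|exists 3%N => //]; exists (y 0 o2) => //;
    by apply: rV3P; rewrite mxE /kpt /= vecE ?yE ?yz; ring.
- have r0 : y 0 o0 != 0.
    apply: contra_neq y0 => r0; apply: rV3P; rewrite !mxE // .
    by case: yS => ->; rewrite r0 mulr0 ?oppr0.
  case: yS => yE; [exists 4%N => //|exists 5%N => //]; exists (y 0 o0) => //;
    by apply: rV3P; rewrite mxE /kpt /= vecE ?yE ?yz; ring.
Qed.

Lemma kpt_side a b c i : (i < 6)%N ->
  [\/ i./2 = 0%N /\ kpt a b c i 0 o0 = 0 /\ kpt a b c i 0 o2 ^+ 2 = a ^+ 2 * kpt a b c i 0 o1 ^+ 2,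
      i./2 = 1%N /\ kpt a b c i 0 o1 = 0 /\ kpt a b c i 0 o0 ^+ 2 = b ^+ 2 * kpt a b c i 0 o2 ^+ 2
    | i./2 = 2%N /\ kpt a b c i 0 o2 = 0 /\ kpt a b c i 0 o1 ^+ 2 = c ^+ 2 * kpt a b c i 0 o0 ^+ 2].
Proof.
case: i => [|[|[|[|[|[|i]]]]]] // _; rewrite /kpt /= !vecE.
- by constructor 1; do !split=> //; ring.
- by constructor 1; do !split=> //; ring.
- by constructor 2; do !split=> //; ring.
- by constructor 2; do !split=> //; ring.
- by constructor 3; do !split=> //; ring.
- by constructor 3; do !split=> //; ring.
Qed.

Lemma krep_squares E a b c a' b' c' P P' : krep E a b c P -> krep E a' b' c' P' ->
  a ^+ 2 = a' ^+ 2 -> b ^+ 2 = b' ^+ 2 -> c ^+ 2 = c' ^+ 2 -> six P `<=` six P'.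
Proof.
move=> kP kP' ea eb ec _ [i /= i6 <-].
have [] := @kpt_complete a' b' c' (kpt a b c i) (kpt_neq0 _ _ _ _).
  rewrite -ea -eb -ec; case: (kpt_side a b c i6) => -[_ H].
  - by constructor 1. - by constructor 2. - by constructor 3.
move=> j j6 [k k0 kE]; exists j => //.
by apply: rep_inj (kP i i6); rewrite kE -scalemxAl; apply: rep_scale => //; apply: kP'.
Qed.

Lemma krep_squares_inj E a b c a' b' c' P P' : E \in unitmx -> krep E a b c P -> krep E a' b' c' P' ->
  six P `<=` six P' -> [/\ a ^+ 2 = a' ^+ 2, b ^+ 2 = b' ^+ 2 & c ^+ 2 = c' ^+ 2].
Proof.
move=> uE kP kP' sub.
have eqv i : (i < 6)%N -> exists2 j, (j < 6)%N & exists2 k, k != 0 & kpt a b c i = k *: kpt a' b' c' j.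
  move=> i6; have [|j /= j6 ij] := sub (P i); first by exists i.
  exists j => //; have := kP i i6; rewrite -ij => /(rep_prop (kP' j j6))[k k0 kE].
  by exists k => //; rewrite -[LHS](mulmxK uE) kE -scalemxAl mulmxK.
have one := oner_neq0 F.
split.
- have [j j6 [k k0 kE]] := eqv 0%N isT.
  have := (congr1 (fun x : 'rV[F]_3 => (x 0 o0, x 0 o1, x 0 o2)) kE).
  case: j j6 {kE} => [|[|[|[|[|[|j]]]]]] // _; rewrite !mxE /= => -[e0 e1 e2].
  + by move: e1 e2; rewrite mulr1 => <- ->; ring.
  + by move: e1 e2; rewrite mulr1 => <- ->; ring.
  + by case/eqP: one; rewrite e1 mulr0.
  + by case/eqP: one; rewrite e1 mulr0.
  + by case/eqP: k0; rewrite -[LHS]mulr1 -e0.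
  + by case/eqP: k0; rewrite -[LHS]mulr1 -e0.
- have [j j6 [k k0 kE]] := eqv 2%N isT.
  have := (congr1 (fun x : 'rV[F]_3 => (x 0 o0, x 0 o1, x 0 o2)) kE).
  case: j j6 {kE} => [|[|[|[|[|[|j]]]]]] // _; rewrite !mxE /= => -[e0 e1 e2].
  + by case/eqP: k0; rewrite -[LHS]mulr1 -e1.
  + by case/eqP: k0; rewrite -[LHS]mulr1 -e1.
  + by move: e2 e0; rewrite mulr1 => <- ->; ring.
  + by move: e2 e0; rewrite mulr1 => <- ->; ring.
  + by case/eqP: one; rewrite e2 mulr0.
  + by case/eqP: one; rewrite e2 mulr0.
- have [j j6 [k k0 kE]] := eqv 4%N isT.
  have := (congr1 (fun x : 'rV[F]_3 => (x 0 o0, x 0 o1, x 0 o2)) kE).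
  case: j j6 {kE} => [|[|[|[|[|[|j]]]]]] // _; rewrite !mxE /= => -[e0 e1 e2].
  + by case/eqP: one; rewrite e0 mulr0.
  + by case/eqP: one; rewrite e0 mulr0.
  + by case/eqP: k0; rewrite -[LHS]mulr1 -e2.
  + by case/eqP: k0; rewrite -[LHS]mulr1 -e2.
  + by move: e0 e1; rewrite mulr1 => <- ->; ring.
  + by move: e0 e1; rewrite mulr1 => <- ->; ring.
Qed.

(* For (abc)^2 = 1 the configuration is a complete quadrilateral, which is its own
   set of triple points. *)
Lemma quadrilateral_triple E a b c P : E \in unitmx -> a != 0 -> b != 0 -> c != 0 ->
  (a * b * c) ^+ 2 = 1 -> krep E a b c P -> inj_below 6 P ->
  triple_points (six P) `<=` six P.
Proof.
move=> uE a0 b0 c0 t1 kP inj x; have [v vP vE] := krep_reps kP.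
move/(triple_code inj vP) => [s]; rewrite mem_cat => /orP[/mapP[h]|sP].
  by rewrite mem_iota => /= i6 -> [_ ->]; exists h.
rewrite code_ok_synth // => -[/andP[Cs /hasPn Zs] _].
(* The four lines of the quadrilateral when abc = 1, and then when abc = -1. *)
pose T1 := [:: [:: 0; 2; 5]; [:: 0; 3; 4]; [:: 1; 2; 4]; [:: 1; 3; 5]]%N.
pose T2 := [:: [:: 0; 2; 4]; [:: 0; 3; 5]; [:: 1; 2; 5]; [:: 1; 3; 4]]%N.
have Zk t : t \in triples -> collinear v t = collinear (kpt a b c) t.
  have /allP lt6 : all (all (fun i => i < 6)%N) triples by [].
  by move=> tP; rewrite (collinear_eq vE (lt6 t tP)) (collinear_config _ uE).
have allZ T : {subset T <= triples} -> all (collinear v) T = all (collinear (kpt a b c)) T.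
  by move=> TT; apply: eq_in_all => t /TT; apply: Zk.
have Z1 : all (collinear v) T1 || all (collinear v) T2.
  move/eqP: t1; rewrite sqrf_eq1 => /orP[]/eqP t1; apply/orP; [left|right];
    rewrite allZ /= /kpt /=; try by apply/allP.
    have e (z : F) : z = 1 - a * b * c -> z == 0 by move=> ->; rewrite t1 subrr.
    by rewrite !e //; rewrite /br !vecE; ring.
  have e (z : F) : z = 1 + a * b * c -> z == 0 by move=> ->; rewrite t1 subrr.
  by rewrite !e //; rewrite /br !vecE; ring.
have noT T : all (collinear v) T -> {subset T <= triples} -> ~~ has (touches s) T.
  move=> /allP ZT TT; apply/hasPn => t tT; apply/negP => st.
  by have := Zs t; rewrite mem_filter st TT // ZT // => /(_ isT).
(* Every other syntheme has a pair on one of the four lines. What remains are the three diagonals,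
   whose concurrency polynomial is -8abc. *)
have sE : s = [:: 0; 1; 2; 3; 4; 5]%N.
  have /allP H : all (fun s => (s == [:: 0; 1; 2; 3; 4; 5]%N) || (has (touches s) T1 && has (touches s) T2)) synthemes.
    by vm_cast_no_check (erefl true).
  case/orP: (H s sP) => [/eqP //|/andP[h1 h2]].
  case/orP: Z1 => [/noT|/noT]; rewrite ?h1 ?h2 => /(_ _)/negP[] //; by apply/allP.
have cE : conc (vec 0 1 a) (vec 0 1 (- a)) (vec b 0 1) (vec (- b) 0 1) (vec 1 c 0) (vec 1 (- c) 0)
    = - (8 * (a * b * c)) by rewrite /conc /br !vecE; ring.
move: Cs; rewrite sE (concurrent_eq vE) // (concurrent_config _ uE) /concurrent /kpt /= cE oppr_eq0 !mulf_eq0.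
by rewrite pnatr_eq0 (negPf a0) (negPf b0) (negPf c0).
Qed.

End Uniqueness.

Section Monomial.
Variable F : numFieldType.
Implicit Types (P Q : nat -> P2 F) (E M : 'M[F]_3) (a b c : F).

(* A side of the triangle of a configuration is recognized as a line containing two
   points of the configuration and two of its triple points. *)
Lemma krep_sides E a b c P E1 a1 b1 c1 P1 r :
  E \in unitmx -> a != 0 -> b != 0 -> c != 0 ->
  (a * b * c) ^+ 2 != 1 -> (a * b * c) ^+ 2 != -1 -> krep E a b c P ->
  E1 \in unitmx -> a1 != 0 -> b1 != 0 -> c1 != 0 ->
  (a1 * b1 * c1) ^+ 2 != 1 -> (a1 * b1 * c1) ^+ 2 != -1 -> krep E1 a1 b1 c1 P1 ->
  triple_points (six P) #= `I_6 -> six P1 = six P -> (r < 3)%N ->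
  exists i j, [/\ (i < 6)%N, (j < 6)%N, i./2 = j./2, P1 r.*2 = P i & P1 r.*2.+1 = P j].
Proof.
move=> uE a0 b0 c0 t1 t2 kP uE1 a10 b10 c10 t11 t12 kP1 c6 PP r3.
have [Q kQ] := krep_exists (b * c)^-1 (c * a)^-1 (a * b)^-1 uE.
have [Q1 kQ1] := krep_exists (b1 * c1)^-1 (c1 * a1)^-1 (a1 * b1)^-1 uE1.
have injQ := krep_inj' uE a0 b0 c0 t1 t2 kQ.
have injQ1 := krep_inj' uE1 a10 b10 c10 t11 t12 kQ1.
have injP1 := krep_inj uE1 a10 b10 c10 t11 kP1.
have TQ := krep_triple uE a0 b0 c0 t1 kP kQ injQ c6.
have TQ1 : six Q = six Q1.
  rewrite -TQ -PP; apply: (krep_triple uE1 a10 b10 c10 t11 kP1 kQ1 injQ1).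
  by rewrite PP.
have [r6 r6'] : (r.*2 < 6)%N /\ (r.*2.+1 < 6)%N by case: r r3 => [|[|[|r]]].
have rr : r.*2 != r.*2.+1 by rewrite neq_ltn leqnn.
have [i /= i6 Pi] : six P (P1 r.*2) by rewrite -PP; exists r.*2.
have [j /= j6 Pj] : six P (P1 r.*2.+1) by rewrite -PP; exists r.*2.+1.
have [k /= k6 Qk] : six Q (Q1 r.*2) by rewrite TQ1; exists r.*2.
have [l /= l6 Ql] : six Q (Q1 r.*2.+1) by rewrite TQ1; exists r.*2.+1.
have ij : i != j.
  apply/negP => /eqP ij; case/eqP: rr; apply: injP1 => //; by rewrite -Pi -Pj ij.
have kl : k != l.
  apply/negP => /eqP kl; case/eqP: rr; apply: injQ1 => //; by rewrite -Qk -Ql kl.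
have onk : on (Q k) (line (P i) (P j)).
  rewrite Qk Pi Pj (krep_on uE1 a10 b10 c10 t11 kP1 kQ1) //.
  by case: r r3 {r6 r6' rr Pi Pj Qk Ql} => [|[|[|r]]] // _; rewrite /br /kpt /= !vecE; apply/eqP; ring.
have onl : on (Q l) (line (P i) (P j)).
  rewrite Ql Pi Pj (krep_on uE1 a10 b10 c10 t11 kP1 kQ1) //.
  by case: r r3 {r6 r6' rr Pi Pj Qk Ql onk} => [|[|[|r]]] // _; rewrite /br /kpt /= !vecE; apply/eqP; ring.
exists i, j; split=> //.
have [v vP vE] := krep_reps kP.
have nd := nondeg_config uE (kpt_nondeg a0 b0 c0 t1) vE.
have [sk relk] := krep_rel uE a0 b0 c0 t1 kP kQ k6.
have [sl rell] := krep_rel uE a0 b0 c0 t1 kP kQ l6.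
have [m m3 [_ subk]] := rel_duad vP nd sk relk i6 j6 ij onk.
have [m' m3' [_ subl]] := rel_duad vP nd sl rell i6 j6 ij onl.
exact: same_side i6 j6 k6 l6 m3 m3' ij kl subk subl.
Qed.

Lemma col_neq0 M j : M \in unitmx -> M o0 j = 0 -> M o1 j = 0 -> M o2 j = 0 -> False.
Proof.
rewrite unitmxE unitfE det_br => /eqP D m0 m1 m2; apply: D.
by move: j m0 m1 m2; apply: forall_I3; rewrite /br !mxE => -> -> ->; ring.
Qed.

(** [M] permutes the axes up to scalars, so the configuration keeps its form. The ratios z/y, x/z,
    y/x are taken in cyclic order: even permutations permute the parameters, odd ones also invert
    them. *)
Lemma monomial_config M (p q r : 'I_3) a b c : M \in unitmx -> a != 0 -> b != 0 -> c != 0 ->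
  M o1 p = 0 -> M o2 p = 0 -> M o0 q = 0 -> M o2 q = 0 -> M o0 r = 0 -> M o1 r = 0 ->
  exists a' b' c', [/\ a' != 0, b' != 0, c' != 0 & forall i, (i < 6)%N ->
    exists2 j, (j < 6)%N & exists2 k, k != 0 & kpt a b c i *m M = k *: kpt a' b' c' j].
Proof.
move=> uM a0 b0 c0 M1p M2p M0q M2q M0r M1r.
have m0 : M o0 p != 0 by apply/eqP => M0p; apply: (col_neq0 uM M0p).
have m1 : M o1 q != 0 by apply/eqP => M1q; apply: (col_neq0 uM M0q M1q).
have m2 : M o2 r != 0 by apply/eqP => M2r; apply: (col_neq0 uM M0r M1r).
have pq : p != q by apply: contraNneq m0 => ->; rewrite M0q.
have pr : p != r by apply: contraNneq m0 => ->; rewrite M0r.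
have qr : q != r by apply: contraNneq m1 => ->; rewrite M1r.
pose A := a * M o2 r / M o1 q; pose B := b * M o0 p / M o2 r; pose C := c * M o1 q / M o0 p.
have [A0 B0 C0] : [/\ A != 0, B != 0 & C != 0] by split; rewrite !mulf_neq0 ?invr_eq0.
have sides i : (i < 6)%N -> let z := kpt a b c i *m M in
  [\/ z 0 p = 0 /\ z 0 r ^+ 2 = A ^+ 2 * z 0 q ^+ 2,
      z 0 q = 0 /\ z 0 p ^+ 2 = B ^+ 2 * z 0 r ^+ 2
    | z 0 r = 0 /\ z 0 q ^+ 2 = C ^+ 2 * z 0 p ^+ 2].
  move=> i6 /=; rewrite !mul_rV3 M1p M2p M0q M2q M0r M1r !mulr0 !(add0r, addr0).
  case: (kpt_side a b c i6) => -[_ [-> e]].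
  - by constructor 1; rewrite mul0r !exprMn e /A; split=> //; field; rewrite m1.
  - by constructor 2; rewrite mul0r !exprMn e /B; split=> //; field; rewrite m2.
  - by constructor 3; rewrite mul0r !exprMn e /C; split=> //; field; rewrite m0.
have inv (k x y : F) : k != 0 -> x ^+ 2 = k ^+ 2 * y ^+ 2 -> y ^+ 2 = k^-1 ^+ 2 * x ^+ 2.
  by move=> k0 ->; field.
have z0 i : kpt a b c i *m M != 0.
  by apply: contra_neq (kpt_neq0 a b c i) => e; rewrite -[LHS](mulmxK uM) e mul0mx.
have [iA iB iC] : [/\ A^-1 != 0, B^-1 != 0 & C^-1 != 0] by rewrite !invr_neq0.
move: (A) (B) (C) A0 B0 C0 iA iB iC sides => {}A {}B {}C A0 B0 C0 iA iB iC.
move: p q r pq pr qr {M1p M2p M0q M2q M0r M1r m0 m1 m2}.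
apply: forall_I3; apply: forall_I3; apply: forall_I3 => // _ _ _ sides.
- exists A, B, C; split=> // i i6; apply: kpt_complete => //.
  case: (sides i i6) => -[e1 e2]; [constructor 1|constructor 2|constructor 3]; split=> //.
- exists A^-1, C^-1, B^-1; split=> // i i6; apply: kpt_complete => //.
  case: (sides i i6) => -[e1 e2]; [constructor 1|constructor 3|constructor 2]; split=> //; exact: inv e2.
- exists B^-1, A^-1, C^-1; split=> // i i6; apply: kpt_complete => //.
  case: (sides i i6) => -[e1 e2]; [constructor 2|constructor 1|constructor 3]; split=> //; exact: inv e2.
- exists C, A, B; split=> // i i6; apply: kpt_complete => //.
  case: (sides i i6) => -[e1 e2]; [constructor 2|constructor 3|constructor 1]; split=> //.
- exists B, C, A; split=> // i i6; apply: kpt_complete => //.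
  case: (sides i i6) => -[e1 e2]; [constructor 3|constructor 1|constructor 2]; split=> //.
- exists C^-1, B^-1, A^-1; split=> // i i6; apply: kpt_complete => //.
  case: (sides i i6) => -[e1 e2]; [constructor 3|constructor 2|constructor 1]; split=> //; exact: inv e2.
Qed.

End Monomial.

Lemma enum_sub (T : eqType) (f g : nat -> T) n : inj_below n f ->
  f @` `I_n `<=` g @` `I_n -> f @` `I_n = g @` `I_n.
Proof.
move=> injf sub.
have sub' : {subset [seq f i | i <- iota 0 n] <= [seq g i | i <- iota 0 n]}.
  by move=> x /enum_seq/sub/enum_seq.
have [|_ eqfg] := uniq_min_size (enum_uniq injf) sub'; first by rewrite !size_map.
by apply/seteqP; split=> x /enum_seq xP; apply/enum_seq; rewrite ?eqfg // -eqfg.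
Qed.

(** * Extension of the ground field *)

Section Change.
Variables (F F' : numFieldType) (f : {rmorphism F -> F'}).

Lemma vec_map x y z : map_mx f (vec x y z) = vec (f x) (f y) (f z).
Proof. by apply: rV3P; rewrite !mxE. Qed.

Lemma kpt_map a b c i : map_mx f (kpt a b c i) = kpt (f a) (f b) (f c) i.
Proof.
by case: i => [|[|[|[|[|[|i]]]]]]; rewrite /kpt /= ?nth_nil vec_map ?rmorph0 ?rmorph1 ?rmorphN.
Qed.

Lemma br_map (u v w : 'rV[F]_3) : br (map_mx f u) (map_mx f v) (map_mx f w) = f (br u v w).
Proof. by rewrite /br !mxE !(rmorphD, rmorphN, rmorphM). Qed.

Lemma collinear_map (u : nat -> 'rV[F]_3) : collinear (fun i => map_mx f (u i)) = collinear u.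
Proof. by apply/funext => -[|i [|j [|k [|]]]] //=; rewrite br_map fmorph_eq0. Qed.

Lemma concurrent_map (u : nat -> 'rV[F]_3) : concurrent (fun i => map_mx f (u i)) = concurrent u.
Proof.
apply/funext => -[|a [|b [|c [|d [|e [|g [|]]]]]]] //=.
by rewrite /conc !br_map -!rmorphM -rmorphB fmorph_eq0.
Qed.

Lemma cross_map_eq0 (u v : 'rV[F]_3) : cross u v = 0 -> cross (map_mx f u) (map_mx f v) = 0.
Proof.
move=> uv0; have -> : cross (map_mx f u) (map_mx f v) = map_mx f (cross u v).
  by apply: rV3P; rewrite /cross !(mxE, vecE) !(rmorphD, rmorphN, rmorphM).
by rewrite uv0 map_mx0.
Qed.

End Change.

Section Quadrilateral.
Variable F : numFieldType.
Implicit Types (P Q : nat -> P2 F) (E M : 'M[F]_3) (a b c : F).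

(** A quadrilateral contains all its triple points. Were they the six points of [P], the two sets
    would agree, although [P] has no collinear triple. *)
Lemma quadrilateral_not_dual E a b c P E1 a1 b1 c1 P1 :
  E \in unitmx -> a != 0 -> b != 0 -> c != 0 -> (a * b * c) ^+ 2 != 1 -> krep E a b c P ->
  E1 \in unitmx -> a1 != 0 -> b1 != 0 -> c1 != 0 -> krep E1 a1 b1 c1 P1 -> inj_below 6 P1 ->
  triple_points (six P1) = six P -> (a1 * b1 * c1) ^+ 2 != 1.
Proof.
move=> uE a0 b0 c0 t1 kP uE1 a10 b10 c10 kP1 inj1 TP; apply/eqP => t11.
have sub := quadrilateral_triple uE1 a10 b10 c10 t11 kP1 inj1; rewrite TP in sub.
have injP := krep_inj uE a0 b0 c0 t1 kP.
have PP : six P = six P1 := enum_sub injP sub.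
have [v vP vE] := krep_reps kP.
have nd := nondeg_config uE (kpt_nondeg a0 b0 c0 t1) vE.
have [k [k6 k0 k2 kt]] : exists k, [/\ (k < 6)%N, 0%N != k, 2%N != k &
    br (kpt a1 b1 c1 0) (kpt a1 b1 c1 2) (kpt a1 b1 c1 k) = 0].
  move/eqP: t11; rewrite sqrf_eq1 => /orP[]/eqP t11; [exists 5%N|exists 4%N]; split=> //.
    by transitivity (1 - a1 * b1 * c1); [rewrite /br /kpt /= !vecE; ring | rewrite t11 subrr].
  by transitivity (1 + a1 * b1 * c1); [rewrite /br /kpt /= !vecE; ring | rewrite t11 subrr].
have [h /= h6 hE] : six P (P1 0%N) by rewrite PP; exists 0%N.
have [i /= i6 iE] : six P (P1 2%N) by rewrite PP; exists 2%N.
have [j /= j6 jE] : six P (P1 k) by rewrite PP; exists k.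
have N x y x' y' : (x < 6)%N -> (y < 6)%N -> x != y -> P x' = P1 x -> P y' = P1 y -> x' != y'.
  move=> x6 y6 xy xE yE; apply: contra_neq xy => x'y'; apply: inj1 => //.
  by rewrite -xE -yE x'y'.
have := nondeg_off vP nd h6 i6 j6 (N 0%N 2%N _ _ isT isT isT hE iE) (N 0%N _ _ _ isT k6 k0 hE jE)
  (N 2%N _ _ _ isT k6 k2 iE jE).
rewrite hE iE jE (on_lineE (kP1 0%N isT) (kP1 2%N isT) (kP1 k k6)); last exact: (neq_pt inj1).
by rewrite brM_det kt mul0r eqxx.
Qed.

End Quadrilateral.

(** * Real configurations and their preimages *)

Section RealPart.
Variable R : realType.
Local Notation C := R[i].
Local Notation rc := (real_complex R).
Implicit Types (E : 'M[R]_3) (a b c : R).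

Definition rrep E a b c (P : nat -> P2 C) := krep (map_mx rc E) (rc a) (rc b) (rc c) P.

Lemma rrepE E a b c P : rrep E a b c P <->
  forall i, (i < 6)%N -> represents (map_mx rc (kpt a b c i *m E)) (P i).
Proof. by split=> H i /H; rewrite map_mxM kpt_map. Qed.

Lemma rc_inj (x y : R) : rc x = rc y -> x = y. Proof. exact: fmorph_inj. Qed.

Definition side (n : nat) : 'I_3 := if n == 0%N then o0 else if n == 1%N then o1 else o2.

Lemma kpt_side0 a b c i : (i < 6)%N -> kpt a b c i 0 (side i./2) = 0.
Proof. by case: i => [|[|[|[|[|[|i]]]]]] // _; rewrite /kpt /= vecE. Qed.

Lemma rc_sqr_neqN1 (t : R) : t ^+ 2 != - 1.
Proof. by apply/eqP => e; have := sqr_ge0 t; rewrite e lerNr oppr0 ler10. Qed.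

Lemma rcX3 a b c : (rc a * rc b * rc c) ^+ 2 = rc ((a * b * c) ^+ 2).
Proof. by rewrite -!rmorphM -rmorphXn. Qed.

Lemma rcV2 a b : (rc a * rc b)^-1 = rc (a * b)^-1.
Proof. by rewrite -rmorphM -fmorphV. Qed.

(** The triple points of [P1] have normal form in the basis of [P1], and they are the points of [P].
    Recognizing the sides of both triangles inside this one set shows that the change of basis is
    monomial. *)
Lemma real_same_basis E a b c P E1 a1 b1 c1 P1 :
  E \in unitmx -> a != 0 -> b != 0 -> c != 0 -> (a * b * c) ^+ 2 != 1 -> rrep E a b c P ->
  E1 \in unitmx -> a1 != 0 -> b1 != 0 -> c1 != 0 -> (a1 * b1 * c1) ^+ 2 != 1 ->
  rrep E1 a1 b1 c1 P1 -> triple_points (six P) #= `I_6 -> triple_points (six P1) #= `I_6 ->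
  triple_points (six P1) = six P ->
  exists a2 b2 c2 P2, [/\ [/\ a2 != 0, b2 != 0 & c2 != 0], rrep E a2 b2 c2 P2 & six P1 = six P2].
Proof.
move=> uE a0 b0 c0 t1 kP uE1 a10 b10 c10 t11 kP1 cP cP1 TP.
have ruE : map_mx rc E \in unitmx by rewrite map_unitmx.
have ruE1 : map_mx rc E1 \in unitmx by rewrite map_unitmx.
have nz x : x != 0 -> rc x != 0 by rewrite fmorph_eq0.
have n1 (x y z : R) : (x * y * z) ^+ 2 != 1 -> (rc x * rc y * rc z) ^+ 2 != 1.
  by rewrite rcX3 fmorph_eq1.
have nN1 (x y z : R) : (rc x * rc y * rc z) ^+ 2 != -1.
  rewrite rcX3 -[1](rmorph1 rc) -rmorphN; apply: contra_neq (rc_sqr_neqN1 (x * y * z)); exact: rc_inj.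
have [Q1 kQ1] := krep_exists (rc b1 * rc c1)^-1 (rc c1 * rc a1)^-1 (rc a1 * rc b1)^-1 ruE1.
have injQ1 := krep_inj' ruE1 (nz _ a10) (nz _ b10) (nz _ c10) (n1 _ _ _ t11) (nN1 _ _ _) kQ1.
have TQ1 := krep_triple ruE1 (nz _ a10) (nz _ b10) (nz _ c10) (n1 _ _ _ t11) kP1 kQ1 injQ1 cP1.
have PQ : six Q1 = six P by rewrite -TQ1.
rewrite !rcV2 in kQ1.
set a' := (b1 * c1)^-1 in kQ1; set b' := (c1 * a1)^-1 in kQ1; set c' := (a1 * b1)^-1 in kQ1.
have [a'0 b'0 c'0] : [/\ a' != 0, b' != 0 & c' != 0] by split; rewrite invr_neq0 ?mulf_neq0.
have t'1 : (a' * b' * c') ^+ 2 != 1.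
  by rewrite inv_t // exprVn invr_eq1 sqrf_eq1 negb_or t11 rc_sqr_neqN1.
have sides r := krep_sides (r := r) ruE (nz _ a0) (nz _ b0) (nz _ c0) (n1 _ _ _ t1) (nN1 _ _ _) kP
  ruE1 (nz _ a'0) (nz _ b'0) (nz _ c'0) (n1 _ _ _ t'1) (nN1 _ _ _) kQ1 cP PQ.
pose M := E1 *m invmx E.
have uM : M \in unitmx by rewrite unitmx_mul uE1 unitmx_inv.
have MZ i j : (i < 6)%N -> (j < 6)%N -> Q1 i = P j ->
    (kpt a' b' c' i *m M) 0 (side j./2) = 0.
  move=> i6 j6 ij; have := (rrepE _ _ _ _ _).1 kQ1 i i6; rewrite ij.
  move=> /(rep_prop ((rrepE _ _ _ _ _).1 kP j j6))[k _ kE].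
  have e : map_mx rc (kpt a' b' c' i *m M) = k *: map_mx rc (kpt a b c j).
    rewrite /M mulmxA map_mxM kE map_mxM -scalemxAl -mulmxA -map_mxM mulmxV //.
    by rewrite map_mx1 mulmx1.
  have := congr1 (fun x : 'rV[C]_3 => x 0 (side j./2)) e; rewrite !mxE kpt_side0 // rmorph0 mulr0.
  by move/eqP; rewrite fmorph_eq0 => /eqP.
have two := char0_neq0 R 1.
(* The two points of a side differ by a sign; their two vanishing coordinates, added and subtracted,
   give two zero entries of [M]. *)
have pm (x y : R) : x + y = 0 -> x - y = 0 -> x = 0 /\ y = 0.
  by move=> e1 e2; split; apply: (mulfI two); rewrite mulr0; [rewrite -[RHS](addr0 0) -{1}e1 -e2|rewrite -[RHS](subr0 0) -{1}e1 -e2]; ring.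
have [i0 [j0 [i06 j06 ij0 Qi0 Qj0]]] := sides 0%N isT.
have [i1 [j1 [i16 j16 ij1 Qi1 Qj1]]] := sides 1%N isT.
have [i2 [j2 [i26 j26 ij2 Qi2 Qj2]]] := sides 2%N isT.
have M0 := MZ 0%N _ isT i06 Qi0; have M0' := MZ 1%N _ isT j06 Qj0; rewrite -ij0 in M0'.
have M1 := MZ 2%N _ isT i16 Qi1; have M1' := MZ 3%N _ isT j16 Qj1; rewrite -ij1 in M1'.
have M2 := MZ 4%N _ isT i26 Qi2; have M2' := MZ 5%N _ isT j26 Qj2; rewrite -ij2 in M2'.
move: M0 M0' M1 M1' M2 M2'; rewrite !mul_rV3 /kpt /= !vecE !mul0r !mul1r !mulNr !(add0r, addr0).
move=> /pm H0 /H0[Mp1 /eqP]; rewrite mulf_eq0 (negPf a'0) /= => /eqP Mp2.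
rewrite ![_ + M o2 _]addrC => /pm H1 /H1[Mq2 /eqP]; rewrite mulf_eq0 (negPf b'0) /= => /eqP Mq0.
move=> /pm H2 /H2[Mr0 /eqP]; rewrite mulf_eq0 (negPf c'0) /= => /eqP Mr1.
have [a2 [b2 [c2 [a20 b20 c20 H]]]] := monomial_config uM a10 b10 c10 Mp1 Mp2 Mq0 Mq2 Mr0 Mr1.
have [P2 kP2] := krep_exists (rc a2) (rc b2) (rc c2) ruE.
exists a2, b2, c2, P2; split=> //; apply: enum_sub.
  exact: krep_inj ruE1 (nz _ a10) (nz _ b10) (nz _ c10) (n1 _ _ _ t11) kP1.
move=> _ [i /= i6 <-]; have [j j6 [k k0 kE]] := H i i6; exists j => //.
apply: rep_inj ((rrepE _ _ _ _ _).1 kP1 i i6).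
have -> : kpt a1 b1 c1 i *m E1 = k *: (kpt a2 b2 c2 j *m E).
  by rewrite scalemxAl -kE /M mulmxA mulmxKV.
by rewrite map_mxZ; apply: rep_scale; rewrite ?fmorph_eq0 //; apply: (rrepE _ _ _ _ _).1.
Qed.

End RealPart.

Section RealDual.
Variable R : realType.
Local Notation C := R[i].
Local Notation rc := (real_complex R).
Implicit Types (E : 'M[R]_3) (a b c : R).

Lemma real_reps (P : nat -> P2 C) : (forall i, exists u : 'rV[R]_3, represents (map_mx rc u) (P i)) ->
  exists u : nat -> 'rV[R]_3, reps (fun i => map_mx rc (u i)) P.
Proof. by move=> /choice[u uP]; exists u. Qed.

Lemma six_modn (P : nat -> P2 C) : six (fun i => P (if (i < 6)%N then i else 0%N)) = six P.
Proof.
by apply/seteqP; split=> _ [i /= i6 <-]; exists i => //=; rewrite i6.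
Qed.

(** Collinearity and concurrency are unaffected by extending the field, so the pattern found over
    the complex numbers is normalized with real vectors. Type K_3 + K_3 would need a real root of
    w^2 + w + 1. *)
Lemma real_normal_form (B : set (P2 C)) : real_points B -> propertyP B ->
  exists P E a b c, [/\ B = six P, E \in unitmx, [/\ a != 0, b != 0 & c != 0] & rrep E a b c P].
Proof.
move=> realB [B6 T6 nc].
have [P0 inj0 BP0] := card_enum (isT : 0 < 6)%N B6.
(* Repeating a point of [B] beyond index 5 makes every value real, so that real representatives can
   be chosen for all indices. *)
pose P i := P0 (if (i < 6)%N then i else 0%N).
have BP : B = six P by rewrite six_modn.
have injP : inj_below 6 P.
  by apply: enum_inj => //; rewrite -[_ @` _]/(six P) -BP.
have [|u uP] := @real_reps P.
  move=> i; apply: realB; rewrite BP0 /P; case: ifP => i6; first by exists i.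
  by exists 0%N.
rewrite BP in nc T6.
have [l lP] := classification injP uP nc T6; rewrite collinear_map concurrent_map => pat.
have crossu i j : (i < 6)%N -> (j < 6)%N -> i != j -> cross (u i) (u j) != 0.
  move=> i6 j6 ij; apply: contra_neq (cross_neq0 injP uP i6 j6 ij); exact: cross_map_eq0.
have [[E [a [b [c [uE [a0 b0 c0] uk]]]]]|[E [w [_ hw _]]]] := pattern_normal_form lP crossu pat.
  exists (fun i => P (nth 0%N l i)), E, a, b, c; split=> //; first by rewrite BP six_perm.
  apply/rrepE => i i6; have [k k0 kE] := uk i i6.
  have := uP (nth 0%N l i); rewrite kE map_mxZ => /(rep_scale (a := (rc k)^-1)).
  by rewrite scalerA mulVf ?fmorph_eq0 // scale1r; apply; rewrite invr_eq0 fmorph_eq0.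
have : 0 < w ^+ 2 + w + 1.
  by nra.
by rewrite hw ltxx.
Qed.

Lemma rrep_real E a b c P : rrep E a b c P -> real_points (six P).
Proof.
by move=> /rrepE kP _ [i /= i6 <-]; exists (kpt a b c i *m E); apply: kP.
Qed.

Lemma real_predual E a b c (P : nat -> P2 C) :
  E \in unitmx -> a != 0 -> b != 0 -> c != 0 -> rrep E a b c P ->
  (a * b * c) ^+ 2 != 1 -> (a * b * c) ^+ 4 - 322 * (a * b * c) ^+ 2 + 1 != 0 ->
  propertyP (six P) ->
  exists! B : set (P2 C), [/\ real_points B, propertyP B & triple_points B = six P].
Proof.
move=> uE a0 b0 c0 kP t1 tgold [P6 TP6 _].
set t := a * b * c in t1 tgold.
have t0 : t != 0 by rewrite !mulf_neq0.
have tpos : 0 < `|t| by rewrite normr_gt0.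
(* The first parameter of the triple points of (aT, bT, cT) is 1/(bc T^2), which equals a or -a
   precisely when T^2 = 1/|t|. *)
pose T := Num.sqrt (`|t|^-1).
have TT : T ^+ 2 = `|t|^-1 by rewrite sqr_sqrtr // invr_ge0 ltW.
have T0 : T != 0 by rewrite sqrtr_eq0 -ltNge invr_gt0.
have ruE : map_mx rc E \in unitmx by rewrite map_unitmx.
have nz x : x != 0 -> rc x != 0 by rewrite fmorph_eq0.
have tt : `|t| ^+ 2 = t ^+ 2 by rewrite -normrX ger0_norm // sqr_ge0.
have T4 : T ^+ 4 * t ^+ 2 = 1.
  by rewrite -[4%N]/(2 * 2)%N exprM TT exprVn tt mulVf // expf_neq0.
have [P0 kP0] := krep_exists (rc (a * T)) (rc (b * T)) (rc (c * T)) ruE.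
have [aT0 bT0 cT0] : [/\ a * T != 0, b * T != 0 & c * T != 0] by rewrite !mulf_neq0.
set s := (a * T * (b * T) * (c * T)) ^+ 2.
have sE : s = `|t|^-1.
  have -> : s = (T ^+ 4 * t ^+ 2) * T ^+ 2 by rewrite /s /t; ring.
  by rewrite T4 mul1r TT.
have s0 : 0 < s by rewrite sE invr_gt0.
have ss : s ^+ 2 * t ^+ 2 = 1 by rewrite sE -tt -exprMn mulVf ?expr1n // gt_eqF.
have s1 : s != 1.
  by apply: contra_neq t1 => s1; rewrite s1 expr1n mul1r in ss.
(* Otherwise s + 1/s = 18, hence s^2 + 1/s^2 = 18^2 - 2 = 322, where 1/s^2 = t^2. *)
have sg : (s - 1) ^+ 2 != 16 * s.
  apply: contra_neq tgold => e.
  have e1 : s ^+ 2 + 1 = 18 * s.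
    apply/eqP; rewrite -subr_eq0 (_ : _ - _ = (s - 1) ^+ 2 - 16 * s); last by ring.
    by rewrite e subrr.
  have e2 : (s ^+ 2 + 1) ^+ 2 = 324 * s ^+ 2 by rewrite e1; ring.
  have : (s ^+ 2 * t ^+ 2 + t ^+ 2) ^+ 2 = 324 * (s ^+ 2 * t ^+ 2) * t ^+ 2.
    have -> : (s ^+ 2 * t ^+ 2 + t ^+ 2) ^+ 2 = (s ^+ 2 + 1) ^+ 2 * t ^+ 4 by ring.
    by rewrite e2; ring.
  rewrite ss => e3; have -> : t ^+ 4 - 322 * t ^+ 2 + 1 = (1 + t ^+ 2) ^+ 2 - 324 * 1 * t ^+ 2 by ring.
  by rewrite e3 subrr.
have rs : (rc (a * T) * rc (b * T) * rc (c * T)) ^+ 2 = rc s by rewrite rcX3.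
have prop0 : propertyP (six P0).
  apply: krep_property kP0; rewrite ?nz // rs.
  - by rewrite fmorph_eq1.
  - by rewrite -[1](rmorph1 rc) -rmorphN; apply: contra_neq (rc_sqr_neqN1 (a * T * (b * T) * (c * T))) => /rc_inj.
  - have -> : 16 * rc s = rc (16 * s) by rewrite (rmorphM rc 16 s) (rmorph_nat rc 16).
    by rewrite -[1](rmorph1 rc) -rmorphB -rmorphXn; apply: contra_neq sg => /rc_inj.
have nV (x y : R) : x ^+ 2 = y ^+ 2 -> rc x ^+ 2 = rc y ^+ 2 by rewrite -!rmorphXn => ->.
have sq x y z : y != 0 -> z != 0 -> x * y * z = t -> ((y * T) * (z * T))^-1 ^+ 2 = x ^+ 2.
  move=> y0 z0 xyz; have e : (y * T * (z * T)) ^+ 2 * x ^+ 2 = 1 by rewrite -T4 -xyz; ring.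
  by rewrite exprVn -[LHS]mulr1 -e mulKf // expf_neq0 // !mulf_neq0.
have n1 (x y z : R) : (x * y * z) ^+ 2 != 1 -> (rc x * rc y * rc z) ^+ 2 != 1.
  by rewrite rcX3 fmorph_eq1.
have nN1 (x y z : R) : (rc x * rc y * rc z) ^+ 2 != -1.
  rewrite rcX3 -[1](rmorph1 rc) -rmorphN; apply: contra_neq (rc_sqr_neqN1 (x * y * z)); exact: rc_inj.
have TP0 : triple_points (six P0) = six P.
  have [Q kQ] := krep_exists (rc (b * T) * rc (c * T))^-1 (rc (c * T) * rc (a * T))^-1
    (rc (a * T) * rc (b * T))^-1 ruE.
  have [_ T06 _] := prop0.
  rewrite (krep_triple ruE (nz _ aT0) (nz _ bT0) (nz _ cT0) _ kP0 kQ) //; first last.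
  - apply: krep_inj' kQ; rewrite ?nz //; exact: n1.
  - exact: n1.
  rewrite !rcV2 in kQ.
  have [ea eb ec] : [/\ (b * T * (c * T))^-1 ^+ 2 = a ^+ 2, (c * T * (a * T))^-1 ^+ 2 = b ^+ 2 &
      (a * T * (b * T))^-1 ^+ 2 = c ^+ 2].
    by split; apply: sq => //; rewrite /t; ring.
  apply/seteqP; split.
    by apply: krep_squares kQ kP _ _ _; apply: nV.
  by apply: krep_squares kP kQ _ _ _; apply: nV.
exists (six P0); split; first by split=> //; apply: rrep_real kP0.
(* Uniqueness: a competing set is normalized, shown not to be a quadrilateral, rewritten in the
   basis [E], and then its parameters are determined up to sign by those of [P]. *)
move=> B [realB pB TB]; have [P1 [E1 [a1 [b1 [c1 [BP1 uE1 [a10 b10 c10] kP1]]]]]] := real_normal_form realB pB.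
have ruE1 : map_mx rc E1 \in unitmx by rewrite map_unitmx.
have [B6 TB6 _] := pB; rewrite BP1 in B6 TB6 TB *.
have inj1 : inj_below 6 P1 by apply: enum_inj.
have rt (x y z : R) : (rc x * rc y * rc z) ^+ 2 != 1 -> (x * y * z) ^+ 2 != 1.
  by rewrite rcX3 fmorph_eq1.
have t11 := rt _ _ _ (quadrilateral_not_dual ruE (nz _ a0) (nz _ b0) (nz _ c0) (n1 _ _ _ t1) kP
  ruE1 (nz _ a10) (nz _ b10) (nz _ c10) kP1 inj1 TB).
have [a2 [b2 [c2 [P2 [[a20 b20 c20] kP2 PP2]]]]] :=
  real_same_basis uE a0 b0 c0 t1 kP uE1 a10 b10 c10 t11 kP1 TP6 TB6 TB.
rewrite PP2 in B6 TB6 TB *.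
have inj2 : inj_below 6 P2 by apply: enum_inj.
have t21 := rt _ _ _ (quadrilateral_not_dual ruE (nz _ a0) (nz _ b0) (nz _ c0) (n1 _ _ _ t1) kP
  ruE (nz _ a20) (nz _ b20) (nz _ c20) kP2 inj2 TB).
have [Q kQ] := krep_exists (rc b2 * rc c2)^-1 (rc c2 * rc a2)^-1 (rc a2 * rc b2)^-1 ruE.
have injQ := krep_inj' ruE (nz _ a20) (nz _ b20) (nz _ c20) (n1 _ _ _ t21) (nN1 _ _ _) kQ.
have TQ := krep_triple ruE (nz _ a20) (nz _ b20) (nz _ c20) (n1 _ _ _ t21) kP2 kQ injQ TB6.
rewrite !rcV2 in kQ.
have subQ : six Q `<=` six P by rewrite -TB TQ.
have [ea eb ec] := krep_squares_inj ruE kQ kP subQ.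
have Vn (x y : R) : rc x ^+ 2 = rc y ^+ 2 -> x ^+ 2 = y ^+ 2 by rewrite -!rmorphXn => /rc_inj.
move: (Vn _ _ ea) (Vn _ _ eb) (Vn _ _ ec) => {}ea {}eb {}ec.
(* Since T^4 = 1/t^2 involves no absolute value, fourth powers are compared first; both squares are
   nonnegative, so the squares agree too. *)
have G (x y z p q r : R) : x != 0 -> y != 0 -> z != 0 -> p != 0 -> q != 0 -> r != 0 -> p * q * r = t ->
    (y * z)^-1 ^+ 2 = p ^+ 2 -> (z * x)^-1 ^+ 2 = q ^+ 2 -> (x * y)^-1 ^+ 2 = r ^+ 2 ->
    (p * T) ^+ 2 = x ^+ 2.
  move=> x0 y0 z0 p0 q0 r0 pqr ep eq er.
  apply/eqP; rewrite -(@eqrXn2 _ 2) ?sqr_ge0 //; apply/eqP.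
  apply: (mulIf (_ : q ^+ 2 * r ^+ 2 != 0)); first by rewrite mulf_neq0 ?expf_neq0.
  transitivity (p ^+ 2 * (T ^+ 4 * t ^+ 2)); first by rewrite -pqr; ring.
  by rewrite T4 mulr1 -ep -eq -er; field; rewrite x0 y0 z0.
apply/seteqP; split.
  apply: krep_squares kP0 kP2 _ _ _; apply: nV.
  - by apply: (G a2 b2 c2 a b c).
  - by apply: (G b2 c2 a2 b c a) => //; rewrite /t; ring.
  - by apply: (G c2 a2 b2 c a b) => //; rewrite /t; ring.
apply: krep_squares kP2 kP0 _ _ _; apply/esym/nV.
- by apply: (G a2 b2 c2 a b c).
- by apply: (G b2 c2 a2 b c a) => //; rewrite /t; ring.
- by apply: (G c2 a2 b2 c a b) => //; rewrite /t; ring.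
Qed.

End RealDual.

(** * A discriminant *)

Section Discriminant.

(* For the six points of kpt a b c and t = abc, the two products of brackets below are
   proportional to 1 - t^2 and 4 t; the five factors then become 1 - t^2, (1 + t^2)^2,
   1 + t^4, t^8 - 18 t^4 + 1 and t^4 - 322 t^2 + 1, up to constants, and the last four
   have no rational root. *)
Definition disc (K : nzRingType) (A B : K) : K :=
  A * (4 * (A * A) + B * B) * (8 * (A * A) + B * B)
  * ((8 * (A * A) + B * B) * (8 * (A * A) + B * B) - 5 * ((B * B) * (B * B)))
  * (A * A - 20 * (B * B)).

Lemma disc_morph (K K' : nzRingType) (f : {rmorphism K -> K'}) A B : f (disc A B) = disc (f A) (f B).
Proof. rewrite /disc !(rmorph_nat, rmorphM, rmorphB, rmorphD). reflexivity. Qed.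

(** The exponent of 5 is even on one side and odd on the other. *)
Lemma sqr_neq5sqr x y : (x * x = 5 * (y * y) -> x = 0)%N.
Proof.
move=> e; case: x e => // x e; have y0 : (0 < y)%N by case: y e.
have := congr1 (fun n => odd (logn 5 n)) e.
by rewrite !lognM ?muln_gt0 ?y0 //= !oddD /= !addbb.
Qed.

Variable F : numFieldType.

Lemma discZ (k A B : F) : disc (k * A) (k * B) = k ^+ 11 * disc A B.
Proof. by rewrite /disc; ring. Qed.

(** Beyond its first factor [disc] depends only on A^2 and B^2. The sums give k times positive
    integers, and the last two factors are k^2 and k times forms x^2 - 5 y^2. The value k = 1 serves
    integer brackets and k = -3 the rigid type. *)
Lemma disc_neq0 (k A B : F) m n : k != 0 -> (0 < m)%N ->
  A * A = k * (m * m)%:R -> B * B = k * (n * n)%:R -> disc A B != 0.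
Proof.
move=> k0 m0 eA eB.
have A0 : A != 0.
  by apply: contra_neq k0 => A0; apply: (mulIf (_ : (m * m)%:R != 0)); rewrite ?pnatr_eq0 -?eA ?A0 ?mul0r // ; lia.
have nz p : (0 < p)%N -> k * p%:R != 0 by move=> p0; rewrite mulf_neq0 // pnatr_eq0; lia.
rewrite /disc eA eB.
have -> : 4 * (k * (m * m)%:R) + k * (n * n)%:R = k * (4 * (m * m) + n * n)%:R by rewrite natrD natrM; ring.
have -> : 8 * (k * (m * m)%:R) + k * (n * n)%:R = k * (8 * (m * m) + n * n)%:R by rewrite natrD natrM; ring.
set N := (8 * (m * m) + n * n)%N.
have -> : k * N%:R * (k * N%:R) - 5 * (k * (n * n)%:R * (k * (n * n)%:R)) =
    k * k * ((N * N)%:R - (5 * ((n * n) * (n * n)))%:R) by rewrite !natrM; ring.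
have -> : k * (m * m)%:R - 20 * (k * (n * n)%:R) = k * ((m * m)%:R - (5 * ((2 * n) * (2 * n)))%:R).
  by rewrite !natrM; ring.
have h2 : k * (4 * (m * m) + n * n)%:R != 0 by apply: nz; lia.
have h3 : k * N%:R != 0 by apply: nz; lia.
have h4 : (N * N)%:R - (5 * (n * n * (n * n)))%:R != 0 :> F.
  by rewrite subr_eq0 eqr_nat; apply/eqP => /sqr_neq5sqr; lia.
have h5 : (m * m)%:R - (5 * (2 * n * (2 * n)))%:R != 0 :> F.
  by rewrite subr_eq0 eqr_nat; apply/eqP => /sqr_neq5sqr; lia.
by do ?[exact: A0 | exact: k0 | exact: h2 | exact: h3 | exact: h4 | exact: h5 | apply: mulf_neq0].
Qed.

Implicit Types (v x y : nat -> 'rV[F]_3) (E : 'M[F]_3).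

Definition oddeven x (l : seq nat) : F :=
  br (x (nth 0%N l 0)) (x (nth 0%N l 2)) (x (nth 0%N l 4))
  * br (x (nth 0%N l 1)) (x (nth 0%N l 3)) (x (nth 0%N l 5)).
Definition halves x (l : seq nat) : F :=
  br (x (nth 0%N l 0)) (x (nth 0%N l 1)) (x (nth 0%N l 2))
  * br (x (nth 0%N l 3)) (x (nth 0%N l 4)) (x (nth 0%N l 5)).
Definition discs x := \prod_(l <- perms6) disc (oddeven x l) (halves x l).

(** Both bracket products are linear in each of the six points, so rescaling and change of basis
    multiply them by one common factor [K]. *)
Lemma disc_config x y (s : nat -> nat) (k : nat -> F) E l : E \in unitmx -> l \in perms6 ->
  (forall i, (i < 6)%N -> k i != 0 /\ x i = k i *: (y (s i) *m E)) ->
  (disc (oddeven x l) (halves x l) != 0) =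
  (disc (oddeven y (map s l)) (halves y (map s l)) != 0).
Proof.
rewrite unitmxE unitfE => detE lP xE.
have lt i : (i < 6)%N -> (nth 0%N l i < 6)%N.
  by move=> i6; apply: (perms6_lt lP); apply: mem_nth; move: lP; rewrite mem_perms6 => /perm_size ->.
have nthE i : (i < 6)%N -> x (nth 0%N l i) = k (nth 0%N l i) *: (y (nth 0%N (map s l) i) *m E).
  move=> i6; rewrite (nth_map 0%N); first by have [_ ->] := xE _ (lt i i6).
  by move: lP; rewrite mem_perms6 => /perm_size ->.
pose K := k (nth 0%N l 0) * k (nth 0%N l 1) * k (nth 0%N l 2) * k (nth 0%N l 3) * k (nth 0%N l 4)
  * k (nth 0%N l 5) * (\det E * \det E).
have K0 : K != 0 by rewrite !mulf_neq0 //; apply: (xE _ _).1; apply: lt.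
have -> : oddeven x l = K * oddeven y (map s l).
  by rewrite /oddeven !nthE // !brZ !brM_det /K; ring.
have -> : halves x l = K * halves y (map s l).
  by rewrite /halves !nthE // !brZ !brM_det /K; ring.
by rewrite discZ mulf_eq0 expf_eq0 (negPf K0).
Qed.

Lemma disc_kpt a b c (t := a * b * c) : disc (oddeven (kpt a b c) (iota 0 6)) (halves (kpt a b c) (iota 0 6)) != 0 ->
  [/\ t ^+ 2 != 1, t ^+ 2 != - 1, t ^+ 4 != - 1, (t ^+ 4 - 1) ^+ 2 != 16 * t ^+ 4 &
      t ^+ 4 - 322 * t ^+ 2 + 1 != 0].
Proof.
have -> : oddeven (kpt a b c) (iota 0 6) = 1 - t ^+ 2 by rewrite /oddeven /kpt /= /br !vecE /t; ring.
have -> : halves (kpt a b c) (iota 0 6) = 4 * t by rewrite /halves /kpt /= /br !vecE /t; ring.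
rewrite /disc !mulf_eq0 !negb_or => /andP[/andP[/andP[/andP[h1 h2] h3] h4] h5]; split.
- by apply: contra_neq h1 => ->; rewrite subrr.
- by apply: contra_neq h2 => e; transitivity (4 * (t ^+ 2 + 1) ^+ 2); [ring|rewrite e; ring].
- by apply: contra_neq h3 => e; transitivity (8 * (t ^+ 4 + 1)); [ring|rewrite e; ring].
- apply: contra_neq h4 => e; transitivity (64 * ((t ^+ 4 - 1) ^+ 2 - 16 * t ^+ 4)); first by ring.
  by rewrite e subrr mulr0.
- by apply: contra_neq h5 => <-; ring.
Qed.

Lemma perms6_distinct l (i j : nat) : l \in perms6 -> (i < 6)%N -> (j < 6)%N -> i != j ->
  nth 0%N l i != nth 0%N l j.
Proof.
move=> lP i6 j6 ij; have sz : size l = 6%N by move: lP; rewrite mem_perms6 => /perm_size ->.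
by rewrite nth_uniq ?sz ?(perms6_uniqP lP).
Qed.

Lemma perms6_nth l (i : nat) : l \in perms6 -> (i < 6)%N -> (nth 0%N l i < 6)%N.
Proof.
move=> lP i6; apply: (perms6_lt lP); apply: mem_nth.
by move: lP; rewrite mem_perms6 => /perm_size ->.
Qed.

(** At (2, 1, 1), where t = 2, all twenty brackets are nonzero integers. Their squares are used
    because sorting the labels changes signs. *)
Lemma disc_rational l : l \in perms6 ->
  disc (oddeven (kpt 2 1 1) l) (halves (kpt 2 1 1) l) != 0.
Proof.
move=> lP; pose sqbr t : F := if t is [:: i; j; k] then
  br (kpt 2 1 1 i) (kpt 2 1 1 j) (kpt 2 1 1 k) * br (kpt 2 1 1 i) (kpt 2 1 1 j) (kpt 2 1 1 k) else 0.
have sq_normal t : sqbr (triple_normal t) = sqbr t.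
  apply: (@triple_normalE _ sqbr) => -[|i [|j [|k [|? ?]]]] //=.
    by rewrite br_swap12 mulrNN.
  by rewrite br_swap23 mulrNN.
have sqT t : t \in triples -> exists2 m, (0 < m)%N & sqbr t = (m * m)%:R.
  have E (e : F) m : (0 < m)%N -> (e = m%:R \/ e = - m%:R) -> exists2 m', (0 < m')%N & e * e = (m' * m')%:R.
    by move=> m0 []->; exists m => //; rewrite natrM ?mulrNN.
  rewrite /triples !inE => tP.
  repeat (move: tP => /orP[/eqP->|tP]; [rewrite /sqbr;
    first [ apply: (E _ 1%N) => //; rewrite /kpt /= /br !vecE; by [left; ring|right; ring]
          | apply: (E _ 2%N) => //; rewrite /kpt /= /br !vecE; by [left; ring|right; ring]
          | apply: (E _ 3%N) => //; rewrite /kpt /= /br !vecE; by [left; ring|right; ring]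
          | apply: (E _ 4%N) => //; rewrite /kpt /= /br !vecE; by [left; ring|right; ring] ] | ]).
  move/eqP: tP => ->; rewrite /sqbr; apply: (E _ 2%N) => //; rewrite /kpt /= /br !vecE; by [left; ring|right; ring].
have sq i j k : (i < 6)%N -> (j < 6)%N -> (k < 6)%N -> i != j -> i != k -> j != k ->
    exists2 m, (0 < m)%N & sqbr [:: nth 0%N l i; nth 0%N l j; nth 0%N l k] = (m * m)%:R.
  move=> i6 j6 k6 ij ik jk; rewrite -sq_normal; apply: sqT.
  by apply: triple_normal_mem; rewrite ?(perms6_distinct lP) ?(perms6_nth lP).
have mulsq (p q : F) m n : p * p = (m * m)%:R -> q * q = (n * n)%:R ->
    p * q * (p * q) = 1 * ((m * n) * (m * n))%:R.
  move=> pm qn; rewrite mul1r; transitivity ((p * p) * (q * q)); first by ring.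
  by rewrite pm qn !natrM; ring.
have [m1 m10 e1] := sq 0%N 2%N 4%N isT isT isT isT isT isT.
have [m2 m20 e2] := sq 1%N 3%N 5%N isT isT isT isT isT isT.
have [m3 m30 e3] := sq 0%N 1%N 2%N isT isT isT isT isT isT.
have [m4 m40 e4] := sq 3%N 4%N 5%N isT isT isT isT isT isT.
apply: (@disc_neq0 1 _ _ (m1 * m2) (m3 * m4)); rewrite ?oner_neq0 ?muln_gt0 ?m10 //.
  exact: mulsq.
exact: mulsq.
Qed.

(** A single bracket need not be rational, but the product of two complementary ones is an integer
    multiple of a square root of -3. *)
Lemma disc_omega w l : w ^+ 2 + w + 1 = 0 -> l \in perms6 ->
  disc (oddeven (ypt w) l) (halves (ypt w) l) != 0.
Proof.
move=> hw lP; pose sqbr t : F := if t is [:: i; j; k] then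
  br (ypt w i) (ypt w j) (ypt w k) * br (ypt w i) (ypt w j) (ypt w k) else 0.
have sq_normal t : sqbr (triple_normal t) = sqbr t.
  apply: (@triple_normalE _ sqbr) => -[|i [|j [|k [|? ?]]]] //=.
    by rewrite br_swap12 mulrNN.
  by rewrite br_swap23 mulrNN.
pose compl (t : seq nat) := [seq i <- iota 0 6 | i \notin t].
have sqT t : t \in triples -> exists2 m, (0 < m)%N & sqbr t * sqbr (compl t) = - 3 * (m * m)%:R.
  have E (e f : F) m : (0 < m)%N -> e = - 3 * (m * m)%:R + f * (w ^+ 2 + w + 1) ->
      exists2 m', (0 < m')%N & e = - 3 * (m' * m')%:R.
    by move=> m0 ->; exists m => //; rewrite hw mulr0 addr0.
  have T (i j k i' j' k' : nat) : compl [:: i; j; k] = [:: i'; j'; k'] ->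
      (exists f, exists2 m, (0 < m)%N & sqbr [:: i; j; k] * sqbr [:: i'; j'; k'] =
        - 3 * (m * m)%:R + f * (w ^+ 2 + w + 1)) ->
      exists2 m, (0 < m)%N & sqbr [:: i; j; k] * sqbr (compl [:: i; j; k]) = - 3 * (m * m)%:R.
    by move=> -> [f [m m0 e]]; apply: (E _ f m).
  rewrite /triples !inE => tP.
  repeat (move: tP => /orP[/eqP->|tP]; [apply: T; first reflexivity; rewrite /sqbr;
    first [ exists 4, 1%N => //; rewrite /ypt /= /br !vecE; ring
          | exists (7 + 5 * w + w ^+ 2), 1%N => //; rewrite /ypt /= /br !vecE; ring
          | exists (3 - 3 * w + w ^+ 2), 1%N => //; rewrite /ypt /= /br !vecE; ring
          | exists 36, 3%N => //; rewrite /ypt /= /br !vecE; ring ] | ]).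
  move/eqP: tP => ->; apply: T; first reflexivity; rewrite /sqbr.
  by exists 36, 3%N => //; rewrite /ypt /= /br !vecE; ring.
have sq i j k i' j' k' : (i < 6)%N -> (j < 6)%N -> (k < 6)%N -> i != j -> i != k -> j != k ->
    (forall l, l \in perms6 -> triple_normal [:: nth 0%N l i'; nth 0%N l j'; nth 0%N l k'] =
       compl (triple_normal [:: nth 0%N l i; nth 0%N l j; nth 0%N l k])) ->
    exists2 m, (0 < m)%N & sqbr [:: nth 0%N l i; nth 0%N l j; nth 0%N l k] *
      sqbr [:: nth 0%N l i'; nth 0%N l j'; nth 0%N l k'] = - 3 * (m * m)%:R.
  move=> i6 j6 k6 ij ik jk cP; rewrite -[sqbr [:: nth 0%N l i'; _; _]]sq_normal cP //.
  rewrite -[X in exists2 m, _ & X * _ = _]sq_normal; apply: sqT.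
  by apply: triple_normal_mem; rewrite ?(perms6_distinct lP) ?(perms6_nth lP).
have compl_check i j k i' j' k' : all (fun l => triple_normal [:: nth 0%N l i'; nth 0%N l j'; nth 0%N l k'] ==
       compl (triple_normal [:: nth 0%N l i; nth 0%N l j; nth 0%N l k])) perms6 ->
    forall l, l \in perms6 -> triple_normal [:: nth 0%N l i'; nth 0%N l j'; nth 0%N l k'] =
       compl (triple_normal [:: nth 0%N l i; nth 0%N l j; nth 0%N l k]).
  by move=> /allP H l' /H/eqP.
have [|m m0 e] := sq 0%N 2%N 4%N 1%N 3%N 5%N isT isT isT isT isT isT; first by apply: compl_check; vm_cast_no_check (erefl true).
have [|n n0 e'] := sq 0%N 1%N 2%N 3%N 4%N 5%N isT isT isT isT isT isT; first by apply: compl_check; vm_cast_no_check (erefl true).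
apply: (@disc_neq0 (- 3) _ _ m n) => //; first by rewrite oppr_eq0 pnatr_eq0.
  by rewrite -e /sqbr /oddeven; ring.
by rewrite -e' /sqbr /halves; ring.
Qed.

End Discriminant.

(** * Genericity *)

Section Multidegree.
Variable F : numFieldType.
Local Notation S := {mpoly F[(6 * 3)%N]}.
Implicit Types (d : 'I_6 -> nat) (f g : S).

Definition mdeg_is d f := forall m, m \in msupp f ->
  forall i : 'I_6, (\sum_(j < 3) m (mxvec_index i j))%N = d i.

Lemma mdeg_isD d f g : mdeg_is d f -> mdeg_is d g -> mdeg_is d (f + g).
Proof. by move=> hf hg m /msuppD_le; rewrite mem_cat => /orP[/hf|/hg]. Qed.

Lemma mdeg_isN d f : mdeg_is d f -> mdeg_is d (- f).
Proof. by move=> hf m; rewrite (perm_mem (msuppN f)); apply: hf. Qed.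

Lemma mdeg_isB d f g : mdeg_is d f -> mdeg_is d g -> mdeg_is d (f - g).
Proof. by move=> hf /mdeg_isN; apply: mdeg_isD. Qed.

Lemma mdeg_is_nat d n f : mdeg_is d f -> mdeg_is d (n%:R * f).
Proof.
move=> hf; rewrite mulr_natl; elim: n => [|n IH]; first by rewrite mulr0n => m; rewrite msupp0.
by rewrite mulrS; apply: mdeg_isD.
Qed.

Lemma mdeg_isM d d' f g : mdeg_is d f -> mdeg_is d' g -> mdeg_is (fun i => d i + d' i)%N (f * g).
Proof.
move=> hf hg m /msuppM_le/allpairsP[[m1 m2] /= [/hf h1 /hg h2 ->]] i.
by rewrite -h1 -h2 -big_split /=; apply: eq_bigr => j _; rewrite mnmDE.
Qed.

Lemma mdeg_is_ext d d' f : d =1 d' -> mdeg_is d f -> mdeg_is d' f.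
Proof. by move=> dd hf m /hf h i; rewrite h dd. Qed.

Definition coord (i : nat) (j : 'I_3) : S := 'X_(mxvec_index (inord i) j).

Lemma mdeg_is_coord i j : mdeg_is (fun k : 'I_6 => (k == inord i :> 'I_6) : nat) (coord i j).
Proof.
move=> m; rewrite msuppX inE => /eqP-> k.
under eq_bigr => l _ do rewrite mnm1E.
have inj (k' : 'I_6) (l : 'I_3) : (mxvec_index (inord i) j == mxvec_index k' l) = (k' == inord i) && (l == j).
  apply/eqP/andP => [e|[/eqP-> /eqP->] //].
  have := @enum_rank_inj _ (inord i, j) (k', l); move: e; rewrite /mxvec_index.
  by move=> /cast_ord_inj e /(_ e)[-> ->].
under eq_bigr => l _ do rewrite inj.
have [_|_] := eqVneq k (inord i); last by rewrite big1.
by rewrite (bigD1 j) //= eqxx big1 // => l /negPf ->.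
Qed.

Definition bracket (i j k : nat) : S :=
  coord i o0 * (coord j o1 * coord k o2 - coord j o2 * coord k o1)
  - coord i o1 * (coord j o0 * coord k o2 - coord j o2 * coord k o0)
  + coord i o2 * (coord j o0 * coord k o1 - coord j o1 * coord k o0).

Definition weight (i j k : nat) (x : 'I_6) : nat :=
  ((x == inord i :> 'I_6) + ((x == inord j :> 'I_6) + (x == inord k :> 'I_6)))%N.

Lemma mdeg_is_bracket i j k : mdeg_is (weight i j k) (bracket i j k).
Proof.
by apply: mdeg_isD; [apply: mdeg_isB|]; apply: mdeg_isM; try exact: mdeg_is_coord;
  apply: mdeg_isB; apply: mdeg_isM; exact: mdeg_is_coord.
Qed.

Definition disc_poly (l : seq nat) : S :=
  disc (bracket (nth 0%N l 0) (nth 0%N l 2) (nth 0%N l 4) * bracket (nth 0%N l 1) (nth 0%N l 3) (nth 0%N l 5))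
       (bracket (nth 0%N l 0) (nth 0%N l 1) (nth 0%N l 2) * bracket (nth 0%N l 3) (nth 0%N l 4) (nth 0%N l 5)).

Lemma mdeg_is_disc d (f g : S) : mdeg_is d f -> mdeg_is d g -> exists d', mdeg_is d' (disc f g).
Proof.
move=> hf hg; pose d2 i := (d i + d i)%N; pose d4 i := (d2 i + d2 i)%N.
have ff : mdeg_is d2 (f * f) := mdeg_isM hf hf.
have gg : mdeg_is d2 (g * g) := mdeg_isM hg hg.
have q n : mdeg_is d2 (n%:R * (f * f) + g * g) := mdeg_isD (mdeg_is_nat (n := n) ff) gg.
eexists; apply: mdeg_isM; first (apply: mdeg_isM; first (apply: mdeg_isM; first apply: mdeg_isM)).
- exact: hf.
- exact: q.
- exact: q.
- apply: (mdeg_isB (d := d4)); first exact: mdeg_isM.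
  by apply: mdeg_is_nat; apply: mdeg_isM.
- by apply: (mdeg_isB (d := d2)) => //; apply: mdeg_is_nat.
Qed.

Definition disc_all : S := \prod_(l <- perms6) disc_poly l.

Lemma disc_all_multihomogeneous : multihomogeneous disc_all.
Proof.
rewrite /disc_all; elim: perms6 => [|l s [d hd]].
  rewrite big_nil; exists (fun=> 0%N) => m; rewrite msupp1 inE => /eqP-> i.
  by rewrite big1 // => j _; rewrite mnm0E.
have [d' hd'] : exists d, mdeg_is d (disc_poly l).
  apply: mdeg_is_disc; first by apply: mdeg_isM; apply: mdeg_is_bracket.
  (* Both bracket products use each label of [l] once, hence have the same multidegree. *)
  apply: mdeg_is_ext; last by apply: mdeg_isM; apply: mdeg_is_bracket.
  by move=> x; rewrite /weight; lia.
by rewrite big_cons; exists (fun i => d' i + d i)%N; apply: mdeg_isM.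
Qed.

Definition rows_of (v : 'M[F]_(6, 3)) (i : nat) : 'rV[F]_3 := row (inord i) v.

Lemma bracketE v i j k : (bracket i j k).@[mxvec v 0] = br (rows_of v i) (rows_of v j) (rows_of v k).
Proof.
have cE a b : (coord a b).@[mxvec v 0] = rows_of v a 0 b by rewrite mevalXU mxvecE mxE.
by rewrite /bracket /br !(mevalD, mevalN, mevalM) !cE.
Qed.

Lemma disc_allE v : disc_all.@[mxvec v 0] = discs (rows_of v).
Proof.
rewrite /disc_all /discs rmorph_prod; apply: eq_bigr => l _ /=.
by rewrite /disc_poly disc_morph /= !mevalM !bracketE.
Qed.

End Multidegree.

(** * Polynomial functions of one parameter *)

Section PolynomialFunctions.
Variable F : numFieldType.

Definition polyfun (h : F -> F) := exists p : {poly F}, forall s, h s = p.[s].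

Lemma polyfunC c : polyfun (fun=> c). Proof. by exists c%:P => s; rewrite hornerC. Qed.
Lemma polyfun_id : polyfun id. Proof. by exists 'X => s; rewrite hornerX. Qed.
Lemma polyfunD h k : polyfun h -> polyfun k -> polyfun (fun s => h s + k s).
Proof. by move=> [p hp] [q hq]; exists (p + q) => s; rewrite hornerD hp hq. Qed.
Lemma polyfunM h k : polyfun h -> polyfun k -> polyfun (fun s => h s * k s).
Proof. by move=> [p hp] [q hq]; exists (p * q) => s; rewrite hornerM hp hq. Qed.
Lemma polyfunN h : polyfun h -> polyfun (fun s => - h s).
Proof. by move=> [p hp]; exists (- p) => s; rewrite hornerN hp. Qed.
Lemma polyfunX h n : polyfun h -> polyfun (fun s => h s ^+ n).
Proof. by move=> [p hp]; exists (p ^+ n) => s; rewrite horner_exp hp. Qed.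
Lemma polyfun_sum (I : Type) (r : seq I) (h : I -> F -> F) : (forall i, polyfun (h i)) ->
  polyfun (fun s => \sum_(i <- r) h i s).
Proof.
move=> /choice[p hp]; exists (\sum_(i <- r) p i) => s.
by rewrite horner_sum; apply: eq_bigr => i _.
Qed.
Lemma polyfun_prod (I : Type) (r : seq I) (h : I -> F -> F) : (forall i, polyfun (h i)) ->
  polyfun (fun s => \prod_(i <- r) h i s).
Proof.
move=> /choice[p hp]; exists (\prod_(i <- r) p i) => s.
by rewrite horner_prod; apply: eq_bigr => i _.
Qed.

Lemma polyfun_meval n (f : {mpoly F[n]}) (v : F -> 'I_n -> F) :
  (forall i, polyfun (v^~ i)) -> polyfun (fun s => f.@[v s]).
Proof.
move=> hv; have [p hp] : polyfun (fun s => \sum_(m <- msupp f) f@_m * \prod_i v s i ^+ m i).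
  apply: polyfun_sum => m; apply: polyfunM; first exact: polyfunC.
  by apply: polyfun_prod => i; apply: polyfunX.
by exists p => s; rewrite -hp mevalE.
Qed.

Lemma poly_eq0 (p : {poly F}) : (forall s, p.[s] = 0) -> p = 0.
Proof.
move=> p0; apply/eqP; apply: contraT => pn0.
have := @max_poly_roots _ p [seq i%:R | i <- iota 0 (size p)] pn0.
rewrite size_map size_iota ltnn; apply.
  by apply/allP => x _; rewrite /root p0.
by rewrite map_inj_uniq ?iota_uniq // => i j /eqP; rewrite eqr_nat => /eqP.
Qed.

(** The product of the two polynomials vanishes on an infinite field, hence is zero, and the second
    factor is not. *)
Lemma polyfun_density h k (s1 s : F) : polyfun h -> polyfun k -> k s1 != 0 ->
  (forall s, k s != 0 -> h s = 0) -> h s = 0.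
Proof.
move=> [p hp] [q hq] k1 H; have : p * q = 0.
  apply: poly_eq0 => x; rewrite hornerM -hp -hq; have [->|/H ->] := eqVneq (k x) 0.
    by rewrite mulr0.
  by rewrite mul0r.
move/eqP; rewrite mulf_eq0 => /orP[]/eqP e; first by rewrite hp e horner0.
by case/eqP: k1; rewrite hq e horner0.
Qed.

End PolynomialFunctions.

Lemma map_index_perm l l' : l \in perms6 -> l' \in perms6 -> map (index^~ l) l' \in perms6.
Proof.
move=> lP l'P; have sz x : x \in perms6 -> size x = 6%N by rewrite mem_perms6 => /perm_size ->.
have mem_l i : i \in l' -> i \in l by move=> /(perms6_lt l'P); apply: perms6_mem.
apply: perms6_uniq; rewrite ?size_map ?sz //.
  rewrite map_inj_in_uniq ?(perms6_uniqP l'P) // => i j il jl e.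
  by rewrite -(nth_index 0%N (mem_l i il)) e nth_index // mem_l.
by apply/allP => _ /mapP[i il ->]; rewrite -(sz l lP) index_mem mem_l.
Qed.

Lemma map_index_self l : l \in perms6 -> map (index^~ l) l = iota 0 6.
Proof.
move=> lP; have sz : size l = 6%N by move: lP; rewrite mem_perms6 => /perm_size ->.
apply: (@eq_from_nth _ 0%N); rewrite size_map sz // => i i6.
by rewrite (nth_map 0%N) ?sz // nth_iota // index_uniq ?sz ?(perms6_uniqP lP).
Qed.

(** * Ordered sextuples and density of the open set *)

Section Parametrization.
Variable F : numFieldType.
Implicit Types (P : 'I_6 -> P2 F) (Q : nat -> P2 F) (E : 'M[F]_3) (v : 'M[F]_(6, 3)).

Definition seq_of P (n : nat) : P2 F := P (inord n).

Lemma range_six P : range P = six (seq_of P).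
Proof.
apply/seteqP; split=> _ [i _ <-]; last by exists (inord i).
by exists (val i); rewrite /= ?ltn_ord // /seq_of inord_val.
Qed.

Lemma rows_reps P v : (forall i, represents (row i v) (P i)) -> reps (rows_of v) (seq_of P).
Proof. by move=> vP i; apply: vP. Qed.

Lemma rep_unscale k (u : 'rV[F]_3) p : k != 0 -> represents (k *: u) p -> represents u p.
Proof.
move=> k0 /(rep_scale (a := k^-1)); rewrite scalerA mulVf // scale1r; apply.
by rewrite invr_eq0.
Qed.

Lemma normal_form Q x : reps x Q -> propertyP (six Q) -> exists2 l, l \in perms6 &
  (exists E a b c, [/\ E \in unitmx, [/\ a != 0, b != 0 & c != 0] & krep E a b c (fun i => Q (nth 0%N l i))])
  \/ (exists E w, [/\ E \in unitmx, w ^+ 2 + w + 1 = 0 & yrep w E (fun i => Q (nth 0%N l i))]).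
Proof.
move=> xQ [Q6 T6 nc]; have inj : inj_below 6 Q by apply: enum_inj.
have [l lP pat] := classification inj xQ nc T6; exists l => //.
have [[E [a [b [c [uE abc0 xE]]]]]|[E [w [uE hw xE]]]] := pattern_normal_form lP (cross_neq0 inj xQ) pat.
  left; exists E, a, b, c; split=> // i i6; have [k k0 kE] := xE i i6.
  by apply: (rep_unscale k0); rewrite -kE; apply: xQ.
right; exists E, w; split=> // i i6; have [k k0 kE] := xE i i6.
by apply: (rep_unscale k0); rewrite -kE; apply: xQ.
Qed.

Lemma six_eq_perm Q Q1 : inj_below 6 Q1 -> six Q1 = six Q ->
  exists2 l, l \in perms6 & forall i, (i < 6)%N -> Q1 i = Q (nth 0%N l i).
Proof.
move=> inj1 QQ; have /choice[s sP] : forall i, exists j, (i < 6)%N -> (j < 6)%N /\ Q j = Q1 i.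
  move=> i; have [i6|] := boolP (i < 6)%N; last by exists 0%N.
  have : six Q (Q1 i) by rewrite -QQ; exists i.
  by case=> j /= j6 e; exists j.
exists (map s (iota 0 6)); last first.
  by move=> i i6; rewrite (nth_map 0%N) ?size_iota // nth_iota //; have [_ ->] := sP i i6.
apply: perms6_uniq; rewrite ?size_map //.
  rewrite map_inj_in_uniq ?iota_uniq // => i j; rewrite !mem_iota => i6 j6 sij.
  by apply: inj1 => //; rewrite -(sP i i6).2 -(sP j j6).2 sij.
apply/allP => _ /mapP[i im ->]; move: im; rewrite mem_iota => i6.
by have [] := sP i i6.
Qed.

Lemma discs_neq0P (x : nat -> 'rV[F]_3) : discs x != 0 <->
  forall l, l \in perms6 -> disc (oddeven x l) (halves x l) != 0.
Proof.
rewrite /discs prodf_seq_neq0; split=> [/allP H l /H //|H].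
by apply/allP => l /H.
Qed.

Lemma index_rep l (y x : nat -> 'rV[F]_3) Q Q1 E : l \in perms6 -> reps x Q ->
  (forall i, (i < 6)%N -> Q1 i = Q (nth 0%N l i)) ->
  (forall i, (i < 6)%N -> represents (y i *m E) (Q1 i)) ->
  exists k, forall n, (n < 6)%N -> k n != 0 /\ x n = k n *: (y (index n l) *m E).
Proof.
move=> lP xQ QQ yQ; have sz : size l = 6%N by move: lP; rewrite mem_perms6 => /perm_size ->.
have /choice[k kP] : forall n, exists k, (n < 6)%N -> k != 0 /\ x n = k *: (y (index n l) *m E).
  move=> n; have [n6|] := boolP (n < 6)%N; last by exists 0.
  have nl := perms6_mem lP n6; have i6 : (index n l < 6)%N by rewrite -sz index_mem.
  have := yQ _ i6; rewrite QQ // nth_index // => /rep_prop/(_ (xQ n))[k k0 kE].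
  by exists k.
by exists k.
Qed.

Lemma disc_conditions l x Q Q1 E a b c (t := a * b * c) : E \in unitmx -> l \in perms6 -> reps x Q ->
  (forall i, (i < 6)%N -> Q1 i = Q (nth 0%N l i)) -> krep E a b c Q1 -> discs x != 0 ->
  [/\ t ^+ 2 != 1, t ^+ 2 != - 1, t ^+ 4 != - 1, (t ^+ 4 - 1) ^+ 2 != 16 * t ^+ 4 &
      t ^+ 4 - 322 * t ^+ 2 + 1 != 0].
Proof.
move=> uE lP xQ QQ kQ /discs_neq0P/(_ l lP).
have [k kE] := index_rep lP xQ QQ kQ.
by rewrite (disc_config uE lP kE) map_index_self //; apply: disc_kpt.
Qed.

Lemma kpt_polyfun (al be ga : F -> F) n j : polyfun al -> polyfun be -> polyfun ga ->
  polyfun (fun s => kpt (al s) (be s) (ga s) n 0 j).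
Proof.
move=> pa pb pc.
have N (h : F -> F) : polyfun h -> polyfun (fun s => - h s) by apply: polyfunN.
have e (h k : F -> F) : polyfun h -> h =1 k -> polyfun k.
  by move=> [p hp] hk; exists p => s; rewrite -hk.
move: j; case: n => [|[|[|[|[|[|n]]]]]]; rewrite /kpt /= ?nth_nil; apply: forall_I3;
  first [ by apply: (e _ _ (polyfunC 0)) => s; rewrite ?nth_nil vecE
        | by apply: (e _ _ (polyfunC 1)) => s; rewrite ?nth_nil vecE
        | by apply: (e _ _ pa) => s; rewrite ?nth_nil vecE
        | by apply: (e _ _ pb) => s; rewrite ?nth_nil vecE
        | by apply: (e _ _ pc) => s; rewrite ?nth_nil vecE
        | by apply: (e _ _ (N _ pa)) => s; rewrite ?nth_nil vecE
        | by apply: (e _ _ (N _ pb)) => s; rewrite ?nth_nil vecE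
        | by apply: (e _ _ (N _ pc)) => s; rewrite ?nth_nil vecE ].
Qed.

Definition disc_zero : set ('I_6 -> P2 F) :=
  [set P | forall f, [set disc_all F] f -> vanishes_at f P].

Lemma disc_zero_closed : zariski_closed disc_zero.
Proof. by exists [set disc_all F]; split=> // f ->; apply: disc_all_multihomogeneous. Qed.

Lemma disc_zeroN P v : (forall i, represents (row i v) (P i)) -> discs (rows_of v) != 0 -> ~ disc_zero P.
Proof. by move=> vP dv /(_ _ erefl v vP); rewrite disc_allE => /eqP; apply/negP. Qed.

Lemma not_disc_zero P : ~ disc_zero P -> exists2 v,
  forall i, represents (row i v) (P i) & discs (rows_of v) != 0.
Proof.
move=> NZ; apply: contrapT => H; apply: NZ => f -> v vP; rewrite disc_allE.
by have [//|dv] := eqVneq (discs (rows_of v)) 0; case: H; exists v.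
Qed.

Lemma yrep_generic P l E w : l \in perms6 -> E \in unitmx -> w ^+ 2 + w + 1 = 0 ->
  yrep w E (fun i => seq_of P (nth 0%N l i)) -> ~ disc_zero P.
Proof.
move=> lP uE hw yP; have /choice[x xP] : forall i, exists x : 'rV[F]_3, represents x (P i).
  by move=> i; apply: rep_exists.
pose v : 'M[F]_(6, 3) := \matrix_i x i.
have vP i : represents (row i v) (P i) by rewrite rowK.
apply: (disc_zeroN vP); apply/discs_neq0P => l' l'P.
have [k kE] := index_rep lP (rows_reps vP) (fun _ _ => erefl) yP.
by rewrite (disc_config uE l'P kE) disc_omega // map_index_perm.
Qed.

(** The parameters move along a straight line from (a, b, c) at s = 0 to (2, 1, 1) at s = 1, with
    basis and scalars fixed. An equation of [Zc] is a polynomial in s that vanishes wherever the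
    configuration lies in the open set, hence everywhere, hence at P. *)
Lemma krep_generic P l E a b c (Zc : set ('I_6 -> P2 F)) : l \in perms6 -> E \in unitmx ->
  krep E a b c (fun i => seq_of P (nth 0%N l i)) -> zariski_closed Zc ->
  [set P : 'I_6 -> P2 F | propertyP (range P)] `\` disc_zero `<=` Zc -> Zc P.
Proof.
move=> lP uE kP [S [_ ->]] sub f Sf v vP.
have [k kE] := index_rep lP (rows_reps vP) (fun _ _ => erefl) kP.
pose al s := a + s * (2 - a); pose be s := b + s * (1 - b); pose ga s := c + s * (1 - c).
pose V s : 'M[F]_(6, 3) := \matrix_(i, j)
  (k (val i) *: (kpt (al s) (be s) (ga s) (index (val i) l) *m E)) 0 j.
have VE s n : (n < 6)%N -> rows_of (V s) n = k n *: (kpt (al s) (be s) (ga s) (index n l) *m E).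
  by move=> n6; apply/rowP => j; rewrite /rows_of mxE mxE /= inordK.
have V0 : V 0 = v.
  apply/row_matrixP => i; have := VE 0 _ (ltn_ord i); rewrite /rows_of inord_val => ->.
  by rewrite /al /be /ga !mul0r !addr0 -(kE _ (ltn_ord i)).2 /rows_of inord_val.
have lin (p q : F) : polyfun (fun s => p + s * q).
  by apply: polyfunD; [exact: polyfunC|apply: polyfunM; [exact: polyfun_id|exact: polyfunC]].
have [pa pb pc] : [/\ polyfun al, polyfun be & polyfun ga] by split; apply: lin.
have pV (g : {mpoly F[(6 * 3)%N]}) : polyfun (fun s => g.@[mxvec (V s) 0]).
  apply: polyfun_meval => i; case: (mxvec_indexP i) => i' j.
  have [p hp] : polyfun (fun s => k (val i') * (kpt (al s) (be s) (ga s) (index (val i') l) 0 o0 * E o0 j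
     + kpt (al s) (be s) (ga s) (index (val i') l) 0 o1 * E o1 j
     + kpt (al s) (be s) (ga s) (index (val i') l) 0 o2 * E o2 j)).
    apply: polyfunM; first exact: polyfunC.
    by apply: polyfunD; first apply: polyfunD; apply: polyfunM; try exact: polyfunC; apply: kpt_polyfun.
  by exists p => s; rewrite -hp mxvecE !mxE sum3.
pose t s := al s * be s * ga s.
(* The product of the quantities that [krep_property] requires to be nonzero. At s = 1, where t = 2,
   it is 2 * 3 * 5 * (9 - 64) = -1650. *)
pose good s := t s * ((t s ^+ 2 - 1) * ((t s ^+ 2 + 1) * ((t s ^+ 2 - 1) ^+ 2 - 16 * t s ^+ 2))).
have pt : polyfun t by apply: polyfunM => //; apply: polyfunM.
have pgood : polyfun good.
  apply: polyfunM => //; apply: polyfunM.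
    by apply: polyfunD; [apply: polyfunX|exact: polyfunC].
  apply: polyfunM.
    by apply: polyfunD; [apply: polyfunX|exact: polyfunC].
  apply: polyfunD; first by apply: polyfunX; apply: polyfunD; [apply: polyfunX|exact: polyfunC].
  by apply: polyfunN; apply: polyfunM; [exact: polyfunC|apply: polyfunX].
rewrite -V0; apply: (@polyfun_density F (fun s => f.@[mxvec (V s) 0])
  (fun s => (disc_all F).@[mxvec (V s) 0] * good s) 1 0) => //.
- exact: polyfunM.
- have [al1 be1 ga1] : [/\ al 1 = 2, be 1 = 1 & ga 1 = 1].
    by rewrite /al /be /ga; split; rewrite mul1r addrCA subrr addr0.
  rewrite mulf_neq0 //.
    rewrite disc_allE; apply/discs_neq0P => l' l'P.
    have kV n : (n < 6)%N -> k n != 0 /\ rows_of (V 1) n = k n *: (kpt 2 1 1 (index n l) *m E).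
      by move=> n6; rewrite VE // al1 be1 ga1; split=> //; have [] := kE n n6.
    by rewrite (disc_config uE l'P kV) disc_rational // map_index_perm.
  have -> : good 1 = - (1650%:R).
    by rewrite /good /t al1 be1 ga1; ring.
  by rewrite oppr_eq0 pnatr_eq0.
move=> s; rewrite mulf_eq0 negb_or disc_allE => /andP[ds].
rewrite /good !mulf_eq0 !negb_or !subr_eq0 (addr_eq0 (t s ^+ 2)).
move=> /and4P[/andP[/andP[al0 be0] ga0] t1 t2 t3].
have /choice[Ps Pss] : forall i : 'I_6, exists p : P2 F, represents (row i (V s)) p.
  move=> i; apply: P2_pt; have := VE s _ (ltn_ord i); rewrite /rows_of inord_val => ->.
  have [k0 _] := kE _ (ltn_ord i); rewrite scaler_eq0 (negPf k0) /=.
  apply: contra_neq (kpt_neq0 (al s) (be s) (ga s) (index (val i) l)) => e.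
  by rewrite -[LHS](mulmxK uE) e mul0mx.
have sz : size l = 6%N by move: lP; rewrite mem_perms6 => /perm_size ->.
have kPs : krep E (al s) (be s) (ga s) (fun i => seq_of Ps (nth 0%N l i)).
  move=> i i6; have li6 : (nth 0%N l i < 6)%N := perms6_nth lP i6.
  have [k0 _] := kE _ li6; apply: (rep_unscale k0).
  have := VE s _ li6; rewrite index_uniq ?sz ?(perms6_uniqP lP) // => <-.
  exact: Pss.
have XPs : propertyP (range Ps).
  by rewrite range_six -(six_perm _ lP); apply: krep_property kPs.
have HS : [set P | forall f, S f -> vanishes_at f P] Ps.
  by apply: sub; split=> //; apply: disc_zeroN Pss ds.
exact: HS f Sf (V s) Pss.
Qed.

(** The conditions of [krep_property] at the parameter 1/t^2 of the triple points, with denominators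
    cleared. *)
Lemma krep_dual_property E a b c Q (t := a * b * c) : E \in unitmx -> a != 0 -> b != 0 -> c != 0 ->
  t ^+ 2 != 1 -> t ^+ 2 != -1 -> t ^+ 4 != -1 -> (t ^+ 4 - 1) ^+ 2 != 16 * t ^+ 4 ->
  krep E a b c Q -> triple_points (six Q) #= `I_6 -> propertyP (triple_points (six Q)).
Proof.
move=> uE a0 b0 c0 t1 t2 t3 t4 kQ Q6.
have [Q' kQ'] := krep_exists (b * c)^-1 (c * a)^-1 (a * b)^-1 uE.
rewrite (krep_triple uE a0 b0 c0 t1 kQ kQ' (krep_inj' uE a0 b0 c0 t1 t2 kQ') Q6).
have t0 : t != 0 by rewrite !mulf_neq0.
have e : ((t ^+ 2)^-1) ^+ 2 = (t ^+ 4)^-1 by rewrite exprVn -exprM.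
apply: krep_property kQ'; rewrite ?invr_neq0 ?mulf_neq0 // inv_t // -/t e.
- rewrite invr_eq1 -[4%N]/(2 * 2)%N exprM sqrf_eq1 negb_or t1 //.
- by rewrite -[X in _ != X]invrK (inj_eq invr_inj) invrN1.
- apply: contra_neq t4 => H; transitivity (((t ^+ 4)^-1 - 1) ^+ 2 * t ^+ 4 ^+ 2); first by field.
  by rewrite H; field.
Qed.

End Parametrization.

Theorem theorem1p3 (R : realType) :
  holds_generically
    (fun P : 'I_6 -> P2 R[i] => propertyP (range P))
    (fun P : 'I_6 -> P2 R[i] =>
       propertyP (triple_points (range P)) /\
       (real_points (range P) ->
        exists! B : set (P2 R[i]),
          [/\ real_points B, propertyP B & triple_points B = range P])).
Proof.
exists ([set P : 'I_6 -> P2 R[i] | propertyP (range P)] `\` @disc_zero R[i]); split.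
- by exists (@disc_zero R[i]); split=> //; apply: disc_zero_closed.
- move=> Zc closedZ sub P XP.
  have /choice[x xP] : forall i, exists x, represents x (seq_of P i) by move=> i; apply: rep_exists.
  have XP6 : propertyP (six (seq_of P)) by rewrite -range_six.
  (* Configurations of type K_4 are reached by deforming their parameters; those of type K_3 + K_3
     already lie in the open set. *)
  have [l lP [[E [a [b [c [uE _ kP]]]]]|[E [w [uE hw yP]]]]] := normal_form xP XP6.
    exact: krep_generic lP uE kP closedZ sub.
  by apply: sub; split=> //; apply: yrep_generic lP uE hw yP.
move=> P [XP /not_disc_zero[v vP dv]].
have XP6 : propertyP (six (seq_of P)) by rewrite -range_six.
have TP6 : triple_points (six (seq_of P)) #= `I_6 by case: XP6.
have xP := rows_reps vP; rewrite range_six; split.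
  have [l lP [[E [a [b [c [uE [a0 b0 c0] kP]]]]]|[E [w [uE hw yP]]]]] := normal_form xP XP6.
    have [t1 t2 t3 t4 _] := disc_conditions uE lP xP (fun _ _ => erefl) kP dv.
    by rewrite -(six_perm _ lP) in TP6 *; apply: krep_dual_property kP TP6.
  by rewrite -(six_perm _ lP); apply: yrep_dual_property yP.
move=> /real_normal_form/(_ XP6)[Q [E [a [b [c [PQ uE [a0 b0 c0] kQ]]]]]].
have ruE : map_mx (real_complex R) E \in unitmx by rewrite map_unitmx.
have injQ : inj_below 6 Q.
  by apply: enum_inj => //; rewrite -[_ @` _]/(six Q) -PQ; case: XP6.
(* The real normal form brings its own labelling; the discriminant, a product over all labellings,
   also constrains this one. *)
have [l lP QP] := six_eq_perm injQ (esym PQ).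
have [t1 _ _ _ t5] := disc_conditions ruE lP xP QP kQ dv.
rewrite PQ in XP6 *; apply: real_predual kQ _ _ XP6 => //.
  by move: t1; rewrite rcX3 fmorph_eq1.
apply: contra_neq t5 => t5; rewrite -!rmorphM -!rmorphXn -(rmorph_nat (real_complex R) 322).
by rewrite -rmorphM -rmorphB -[X in _ + X](rmorph1 (real_complex R)) -rmorphD t5 rmorph0.
Qed.
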